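(* Let $H$ be a finite-dimensional semisimple Hopf algebra over $\mathbb{C}$ and let $N=\operatorname{FSexp}(H)$. Then $$\bar{\nu}(V)\ \ge\ \frac{N\dim V}{\dim H}$$ for all finite-dimensional $H$-modules $V$. In particular, $\bar{\nu}(V)>0$ for any non-zero finite-dimensional $H$-module $V$.
   Context: For a finite-dimensional semisimple Hopf algebra $H$ over $\mathbb{C}$, let $\Lambda$ be the normalized integral of $H$ (the two-sided integral with $\varepsilon(\Lambda)=1$), and put $\Lambda^{[n]}=\Lambda_1\Lambda_2\cdots\Lambda_n$, where $\Lambda_1\otimes\cdots\otimes\Lambda_n$ is the Sweedler notation for the $n$-fold comultiplication of $\Lambda$. For a finite-dimensional $H$-module $V$ with character $\chi_V$, the $n$-th Frobenius-Schur indicator is $\nu_n(V)=\chi_V(\Lambda^{[n]})$. (This agrees with the categorical indicator of $V$ in the spherical fusion category $\operatorname{Rep}(H)$ with its canonical pivotal structure, the usual isomorphism $V\to V^{**}$ of vector spaces, for which the pivotal dimension is $\dim V$.) The Frobenius-Schur exponent $\operatorname{FSexp}(H)$ is the least positive integer $n$ such that $\nu_n(V)=\dim V$ for all finite-dimensional $H$-modules $V$ (it is known to be finite). With $N=\operatorname{FSexp}(H)$, the total Frobenius-Schur indicator of $V$ is $\bar{\nu}(V)=\sum_{n=1}^N\nu_n(V)$. *)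

(* Defs.v *)
From HB Require Import structures.
From mathcomp Require Import all_boot all_order all_algebra.
From mathcomp Require Import falgebra.

Set Implicit Arguments.
Unset Strict Implicit.
Unset Printing Implicit Defensive.

Import GRing.Theory.

Local Open Scope ring_scope.

Section TensorProduct.
Variable K : fieldType.

(* U ⊗ V in coordinates: the entry (i, j) of a matrix in tensor U V is the
   coefficient of e_i ⊗ f_j, for the bases vbasis fullv of U and V. *)
Definition tensor (U V : vectType K) : vectType K :=
  'M[K]_(\dim {:U}, \dim {:V}).

Definition tens (U V : vectType K) (u : U) (v : V) : tensor U V :=
  \matrix_(i, j) (coord (vbasis {:U}) i u * coord (vbasis {:V}) j v).

(* The linear map U ⊗ V -> W induced by f; only meant for bilinear f, for
   which it is characterized by tlift_tens. *)
Definition tlift (U V W : vectType K) (f : U -> V -> W) (t : tensor U V) : W :=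
  \sum_i \sum_j t i j *: f (vbasis {:U})`_i (vbasis {:V})`_j.

Definition bilin (U V W : vectType K) (f : U -> V -> W) : Prop :=
  (forall u, linear (f u)) /\ (forall v, linear (f^~ v)).

Definition tmap (U V U' V' : vectType K) (f : U -> U') (g : V -> V') :
    tensor U V -> tensor U' V' :=
  tlift (fun u v => tens (f u) (g v)).

Definition tassoc (U V W : vectType K) :
    tensor (tensor U V) W -> tensor U (tensor V W) :=
  tlift (fun t w => tlift (fun u v => tens u (tens v w)) t).

Definition tmul (A B : falgType K) (s t : tensor A B) : tensor A B :=
  tlift (fun a b => tlift (fun c d => tens (a * c) (b * d)) t) s.

Lemma tens_bilin (U V : vectType K) : bilin (@tens U V).
Proof.
split=> [u k v v'|v k u u'] /=; apply/matrixP=> i j.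
  rewrite [LHS]mxE [RHS]mxE [in RHS]mxE [X in _ = _ + X]mxE [in RHS]mxE linearP.
  by rewrite mulrDr mulrCA.
rewrite [LHS]mxE [RHS]mxE [in RHS]mxE [X in _ = _ + X]mxE [in RHS]mxE linearP.
by rewrite mulrDl mulrA.
Qed.

Lemma tlift_linear (U V W : vectType K) (f : U -> V -> W) : linear (tlift f).
Proof.
move=> k s t; rewrite /tlift scaler_sumr -big_split; apply: eq_bigr => i _ /=.
rewrite scaler_sumr -big_split; apply: eq_bigr => j _ /=.
by rewrite !mxE scalerDl scalerA.
Qed.

Lemma tlift_tens (U V W : vectType K) (f : U -> V -> W) (u : U) (v : V) :
  bilin f -> tlift f (tens u v) = f u v.
Proof.
move=> [fr fl].
pose pr x : {linear V -> W} :=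
  HB.pack (f x) (GRing.isLinear.Build _ _ _ _ _ (fr x)).
pose pl y : {linear U -> W} :=
  HB.pack (f^~ y) (GRing.isLinear.Build _ _ _ _ _ (fl y)).
rewrite [in RHS](coord_vbasis (memvf u)) -[RHS]/(pl v _) linear_sum.
apply: eq_bigr => i _; rewrite linearZ /= -[f _ v]/(pr _ v).
rewrite [in RHS](coord_vbasis (memvf v)) linear_sum scaler_sumr.
by apply: eq_bigr => j _; rewrite linearZ scalerA /= mxE.
Qed.

Lemma linear_tlift (U V W X : vectType K) (L : W -> X) (f : U -> V -> W)
  (t : tensor U V) :
  linear L -> L (tlift f t) = tlift (fun u v => L (f u v)) t.
Proof.
move=> Llin.
pose l : {linear W -> X} := HB.pack L (GRing.isLinear.Build _ _ _ _ _ Llin).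
rewrite /tlift -[L]/(GRing.Linear.sort l) linear_sum; apply: eq_bigr => i _.
by rewrite linear_sum; apply: eq_bigr => j _; rewrite linearZ.
Qed.

Lemma tens_span (U V : vectType K) (t : tensor U V) :
  t = \sum_i \sum_j t i j *: tens (vbasis {:U})`_i (vbasis {:V})`_j.
Proof.
rewrite {1}(matrix_sum_delta t); apply: eq_bigr => i _; apply: eq_bigr => j _.
congr (_ *: _); apply/matrixP=> k l; rewrite !mxE.
have fr (T : vectType K) : free (vbasis {:T}) := basis_free (vbasisP _).
by rewrite !coord_free // -natrM mulnb eq_sym [l == j]eq_sym.
Qed.

End TensorProduct.

Section HopfAlgebra.
Variable K : fieldType.

Record hopfAlgebra := HopfAlgebra {
  hopf_alg :> falgType K;
  comul : 'Hom(hopf_alg, tensor hopf_alg hopf_alg);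
  counit : {scalar hopf_alg};
  antipode : 'End(hopf_alg);
  comulA : forall h,
    tassoc (tmap comul id (comul h)) = tmap id comul (comul h);
  counitl : forall h, tlift (fun a b => counit a *: b) (comul h) = h;
  counitr : forall h, tlift (fun a b => counit b *: a) (comul h) = h;
  comul1 : comul 1 = tens 1 1;
  comulM : forall g h, comul (g * h) = tmul (comul g) (comul h);
  counit1 : counit 1 = 1;
  counitM : forall g h, counit (g * h) = counit g * counit h;
  antipodel : forall h,
    tlift (fun a b => antipode a * b) (comul h) = counit h *: 1;
  antipoder : forall h,
    tlift (fun a b => a * antipode b) (comul h) = counit h *: 1
}.

Variable H : hopfAlgebra.

Definition left_ideal (I : {vspace H}) : Prop := (fullv * I <= I)%VS.

Definition semisimple : Prop :=
  forall I : {vspace H}, left_ideal I ->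
  exists J : {vspace H},
    [/\ left_ideal J, (I + J = fullv)%VS & (I :&: J = 0)%VS].

Definition normalized_integral (L : H) : Prop :=
  (forall h, h * L = counit H h *: L /\ L * h = counit H h *: L) /\
  counit H L = 1.

(* H^{⊗ (n+1)}, associated to the right. *)
Fixpoint tpow (n : nat) : vectType K :=
  if n is n'.+1 then tensor H (tpow n') else H.

Fixpoint iter_comul (n : nat) : H -> tpow n :=
  match n with
  | 0 => id
  | n'.+1 => fun h => tmap id (iter_comul n') (comul H h)
  end.

Fixpoint iter_mul (n : nat) : tpow n -> H :=
  match n with
  | 0 => id
  | n'.+1 => tlift (fun a t => a * iter_mul t)
  end.

(* h^{[n]} = h_1 h_2 ... h_n, with the usual convention h^{[0]} = ε(h) 1. *)
Definition sweedler_pow (h : H) (n : nat) : H :=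
  if n is n'.+1 then iter_mul (iter_comul n' h) else counit H h *: 1.

Lemma sweedler_powSS (h : H) (n : nat) :
  sweedler_pow h n.+2 =
  tlift (fun a b => a * sweedler_pow b n.+1) (comul H h).
Proof.
have linM m : linear (@iter_mul m).
  by case: m => [|m] //; apply: tlift_linear.
rewrite /sweedler_pow /= /tmap.
rewrite (linear_tlift _ _ (@tlift_linear _ _ _ _ _)).
apply: eq_bigr => i _; apply: eq_bigr => j _; congr (_ *: _).
rewrite tlift_tens //; split=> [u k x y|x k u v] /=.
  by rewrite linM mulrDr scalerAr.
by rewrite mulrDl scalerAl.
Qed.

Record hmodule := HModule {
  hmod_space :> vectType K;
  hact : {linear H -> 'End(hmod_space)};
  hact1 : hact 1 = \1%VF;
  hactM : forall g h, hact (g * h) = (hact g \o hact h)%VF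
}.

Definition hchar (V : hmodule) (h : H) : K :=
  \tr (passmx.mxof (vbasis {:V}) (vbasis {:V}) (hact V h)).

Definition fs_indicator (L : H) (n : nat) (V : hmodule) : K :=
  hchar V (sweedler_pow L n).

Definition fs_trivial (L : H) (n : nat) : Prop :=
  forall V : hmodule, fs_indicator L n V = (\dim {:V})%:R.

Definition is_FSexp (L : H) (N : nat) : Prop :=
  [/\ (0 < N)%N, fs_trivial L N &
      forall n : nat, (0 < n)%N -> fs_trivial L n -> (N <= n)%N].

Definition total_fs_indicator (L : H) (N : nat) (V : hmodule) : K :=
  \sum_(1 <= n < N.+1) fs_indicator L n V.

End HopfAlgebra.

(* Main.v *)
(* By Larson and Radford, S^2 = 1: the traces of the left and right
   multiplications twisted by S^2 are integrals of the dual, they differ by a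
   group-like element G, and positivity on the blocks of H gives tr(S^2) > 0,
   which forces G = 1. Then S^4 = 1 and tr(S^2) is a positive multiple of dim H,
   so S^2 = 1.

   Let theta (x) = x_(-1) x_(0) be the twist on the Yetter-Drinfeld module
   H (x) V cofreely generated by V. Then Tr(theta^k) = dim H nu_k(V), and theta
   fixes the dim V independent vectors 1 (x) v. The eigenvalues of theta have
   modulus 1, by a variant of Vafa's theorem: the determinants of the
   braidings of X with Y_1 (x) ... (x) Y_k are multiplicative in the Y_i but
   bounded, as all Sweedler powers of H are combinations of finitely many of
   them. Since Tr(theta^N) is the dimension of H (x) V, all eigenvalues are N-th
   roots of unity, whose first N power sums are N at the eigenvalue 1 and 0
   elsewhere. Summing, dim H times the total indicator is at least N dim V. *)

Require Import Defs.
From mathcomp Require Import all_boot all_order all_algebra.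
From mathcomp Require Import falgebra reals complex.
From HB Require Import structures.
From mathcomp Require Import perm mxtens spectral ring zify.

Set Implicit Arguments.
Unset Strict Implicit.
Unset Printing Implicit Defensive.

Import Order.TTheory GRing.Theory Num.Theory.

Local Open Scope ring_scope.

(** * Sweedler sums *)

(** S^2 = 1 is used through h_2 S(h_1) = S(h_2) h_1 = eps(h): these rules make theta commute with
    action and coaction, invert the braidings, and simplify theta on the cofree module to h (x) v ->
    h_1 (x) h_2 v.

    Positivity on a block: S^2 is conjugation by some t^-1, and Radford's formula for S^4 shows that
    [G] is a scalar times t^2 there. With t rescaled to a square root of [G], its eigenvalues have
    modulus 1, so tr(t^-1) is the conjugate of tr(t) and the trace of S^2 on the block is a
    nonnegative multiple of |tr t|^2.

    A determinant sees only the product of the eigenvalues of theta. Hence theta is restricted to an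
    eigenspace, again a Yetter-Drinfeld module, where its determinant is a power of the eigenvalue.
    The bound on determinants is M^dim, with one M for all modules; comparing X with X (x) X
    improves it to modulus at most 1.

    Modules are families of matrices (an action rho and coaction coefficients del_i), so that tensor
    products are Kronecker products. *)

Section Linearity.
Variable K : fieldType.

Lemma linZ (U V : lmodType K) (f : U -> V) c x :
  linear f -> f (c *: x) = c *: f x.
Proof.
move=> fl; have f0 : f 0 = 0.
  by have := fl (-1) 0 0; rewrite scaler0 addr0 scaleN1r addNr.
by rewrite -[c *: x]addr0 fl f0 addr0.
Qed.

Lemma lin_sumE (U V : lmodType K) (f : U -> V) I (r : seq I) (P : pred I) F :
  linear f -> f (\sum_(i <- r | P i) F i) = \sum_(i <- r | P i) f (F i).
Proof.
move=> fl; apply: (big_morph f); last by rewrite -(scale0r 0) (linZ _ _ fl) scale0r.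
by move=> x y; rewrite -{1}[x]scale1r fl scale1r.
Qed.

Lemma linB (U V : lmodType K) (f : U -> V) x y :
  linear f -> f (x - y) = f x - f y.
Proof. by move=> fl; rewrite -scaleN1r addrC fl scaleN1r addrC. Qed.

Lemma linD (U V : lmodType K) (f : U -> V) x y :
  linear f -> f (x + y) = f x + f y.
Proof. by move=> fl; rewrite -{1}[x]scale1r fl scale1r. Qed.

Lemma lin_id (U : lmodType K) : linear (fun x : U => x).
Proof. by []. Qed.

Lemma lin_comp (U V W : lmodType K) (f : V -> W) (g : U -> V) :
  linear f -> linear g -> linear (fun x => f (g x)).
Proof. by move=> fl gl k x y; rewrite gl fl. Qed.

Lemma lin_compK (U V : lmodType K) (f : V -> K) (g : U -> V) :
  linear (f : V -> K^o) -> linear g -> linear (fun x => f (g x) : K^o).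
Proof. exact: lin_comp. Qed.

Lemma lin_mull (U : lmodType K) (A : algType K) (a : A) (g : U -> A) :
  linear g -> linear (fun x => a * g x).
Proof. by move=> gl k x y; rewrite gl mulrDr scalerAr. Qed.

Lemma lin_mulr (U : lmodType K) (A : algType K) (a : A) (g : U -> A) :
  linear g -> linear (fun x => g x * a).
Proof. by move=> gl k x y; rewrite gl mulrDl scalerAl. Qed.

Lemma lin_mulmxl (U : lmodType K) m n p (a : 'M[K]_(m, n))
    (g : U -> 'M[K]_(n, p)) :
  linear g -> linear (fun x => a *m g x).
Proof. by move=> gl k x y; rewrite gl linearP. Qed.

Lemma lin_mulmxr (U : lmodType K) m n p (a : 'M[K]_(n, p))
    (g : U -> 'M[K]_(m, n)) :
  linear g -> linear (fun x => g x *m a).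
Proof. by move=> gl k x y; rewrite gl mulmxDl scalemxAl. Qed.

Lemma lin_tensl (U : lmodType K) m n p q (a : 'M[K]_(m, n))
    (g : U -> 'M[K]_(p, q)) :
  linear g -> linear (fun x => tensmx a (g x)).
Proof.
move=> gl k x y; rewrite gl; apply/matrixP=> i j; rewrite !mxE.
by rewrite mulrDr mulrCA.
Qed.

Lemma lin_tensr (U : lmodType K) m n p q (a : 'M[K]_(p, q))
    (g : U -> 'M[K]_(m, n)) :
  linear g -> linear (fun x => tensmx (g x) a).
Proof.
move=> gl k x y; rewrite gl; apply/matrixP=> i j; rewrite !mxE.
by rewrite mulrDl mulrA.
Qed.

Lemma lin_scale (U V : lmodType K) (c : K) (g : U -> V) :
  linear g -> linear (fun x => c *: g x).
Proof. by move=> gl k x y; rewrite gl scalerDr !scalerA mulrC. Qed.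

Lemma lin_scaleK (U : lmodType K) (c : K) (g : U -> K) :
  linear (g : U -> K^o) -> linear (fun x => c *: (g x : K^o)).
Proof. exact: lin_scale. Qed.

Lemma lin_scaler (U V : lmodType K) (v : V) (g : U -> K^o) :
  linear g -> linear (fun x => (g x : K) *: v).
Proof. by move=> gl k x y; rewrite gl scalerDl scalerA. Qed.

Lemma lin_scalar (U V : lmodType K) (q : {scalar V}) (g : U -> V) :
  linear g -> linear (fun x => q (g x) : K^o).
Proof. by move=> gl k x y; rewrite gl linearP. Qed.

Lemma lin_coord (U : lmodType K) (V : vectType K) n (X : n.-tuple V) i
    (g : U -> V) :
  linear g -> linear (fun x => coord X i (g x) : K^o).
Proof. by move=> gl k x y; rewrite gl linearP. Qed.

Lemma lin_sum (U V : lmodType K) I (r : seq I) (P : pred I)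
    (g : I -> U -> V) :
  (forall i, linear (g i)) -> linear (fun x => \sum_(i <- r | P i) g i x).
Proof.
move=> gl k x y; rewrite scaler_sumr -big_split.
by apply: eq_bigr => i _; rewrite gl.
Qed.

End Linearity.

Section Sweedler.
Variables (K : fieldType) (H : hopfAlgebra K).
Implicit Types (W : vectType K) (g h : H).

(** The sum of F(h_1, h_2) in Sweedler notation; nesting produces h_1, h_2, h_3, and so on. It is
    meaningful for bilinear [F], whence the linearity side conditions of the rules below. *)
Definition Sw W (F : H -> H -> W) h : W := tlift F (comul H h).

Lemma Sw_lin W (F : H -> H -> W) : linear (Sw F).
Proof. by move=> k x y; rewrite /Sw linearP tlift_linear. Qed.

Lemma eq_Sw W (F G : H -> H -> W) h :
  (forall a b, F a b = G a b) -> Sw F h = Sw G h.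
Proof.
by move=> FG; apply: eq_bigr => i _; apply: eq_bigr => j _; rewrite FG.
Qed.

Lemma Sw_linear W W' (L : W -> W') (F : H -> H -> W) h :
  linear L -> L (Sw F h) = Sw (fun a b => L (F a b)) h.
Proof. exact: linear_tlift. Qed.

Lemma Sw_sum W I (r : seq I) (P : pred I) (F : I -> H -> H -> W) h :
  Sw (fun a b => \sum_(i <- r | P i) F i a b) h =
  \sum_(i <- r | P i) Sw (F i) h.
Proof.
rewrite /Sw /tlift [RHS]exchange_big; apply: eq_bigr => i _ /=.
rewrite [RHS]exchange_big; apply: eq_bigr => j _ /=.
by rewrite scaler_sumr.
Qed.

Lemma SwC W (F : H -> H -> H -> H -> W) g h :
  Sw (fun a b => Sw (F a b) g) h = Sw (fun c d => Sw (fun a b => F a b c d) h) g.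
Proof.
transitivity (\sum_i \sum_j comul H h i j *:
    Sw (F (vbasis {:H})`_i (vbasis {:H})`_j) g); first by [].
under eq_bigr => i _.
  under eq_bigr => j _ do
    rewrite (Sw_linear _ g (L := *:%R _) (lin_scale _ (@lin_id _ _))).
  rewrite -Sw_sum; over.
by rewrite -Sw_sum; apply: eq_Sw.
Qed.

Lemma Sw_lin_arg W (U : lmodType K) (F : H -> H -> W) (g : U -> H) :
  linear g -> linear (fun x => Sw F (g x)).
Proof. by move=> gl; apply: lin_comp gl; apply: Sw_lin. Qed.

Lemma Sw_lin_fun W (U : lmodType K) (F : U -> H -> H -> W) h :
  (forall a b, linear (fun x => F x a b)) -> linear (fun x => Sw (F x) h).
Proof.
move=> Fl; apply: lin_sum => i; apply: lin_sum => j; apply: lin_scale.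
exact: Fl.
Qed.

End Sweedler.

Ltac lin_hyp :=
  match goal with
  | H : _ |- _ => solve [apply H]
  end.

Ltac lin_ext := fail.

(* Proves [linear (fun x => E x)] (and [bilin]) by recursion on [E]; [lin_ext]
   is a hook, redefined once further linear constructions are available. *)
Ltac lin :=
  intros; cbv beta;
  lazymatch goal with
  | |- _ /\ _ => split; lin
  | |- bilin _ => split; lin
  | |- @GRing.linear_for _ _ _ _ _ =>
      first [ solve [exact (@lin_id _ _)] | lin_hyp | lin_rec ]
  end
with lin_rec :=
  match goal with
  | |- _ => lin_ext
  | |- @GRing.linear_for _ _ _ _ (fun x => @Sw _ _ _ ?F (@?g x)) =>
      apply (@Sw_lin_arg _ _ _ _ F g); lin
  | |- @GRing.linear_for _ _ _ _ (fun x => @Sw _ _ _ (@?F x) ?h) =>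
      apply (@Sw_lin_fun _ _ _ _ F h); lin
  | |- @GRing.linear_for _ _ _ _ (fun x => bigop _ ?r (fun i => BigBody i _ (@?P i) (@?g i x))) =>
      apply (@lin_sum _ _ _ _ r P g); lin
  | |- @GRing.linear_for _ _ _ _ (fun x => @GRing.mul _ ?a (@?g x)) =>
      apply (@lin_mull _ _ _ a g); lin
  | |- @GRing.linear_for _ _ _ _ (fun x => @GRing.mul _ (@?g x) ?a) =>
      apply (@lin_mulr _ _ _ a g); lin
  | |- @GRing.linear_for _ _ _ _ (fun x => @GRing.scale _ _ ?a (@?g x)) =>
      apply (@lin_scale _ _ _ a g); lin
  | |- @GRing.linear_for _ _ _ _ (fun x => @GRing.scale _ _ ?a (@?g x)) =>
      apply (@lin_scaleK _ _ a g); lin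
  | |- @GRing.linear_for _ _ _ _ (fun x => @GRing.scale _ _ (@?g x) ?a) =>
      apply (@lin_scaler _ _ _ a g); lin
  | |- @GRing.linear_for _ _ _ _ (fun x => @mulmx _ _ _ _ ?a (@?g x)) =>
      apply (@lin_mulmxl _ _ _ _ _ a g); lin
  | |- @GRing.linear_for _ _ _ _ (fun x => @mulmx _ _ _ _ (@?g x) ?a) =>
      apply (@lin_mulmxr _ _ _ _ _ a g); lin
  | |- @GRing.linear_for _ _ _ _ (fun x => @tensmx _ _ _ _ _ ?a (@?g x)) =>
      apply (@lin_tensl _ _ _ _ _ _ a g); lin
  | |- @GRing.linear_for _ _ _ _ (fun x => @tensmx _ _ _ _ _ (@?g x) ?a) =>
      apply (@lin_tensr _ _ _ _ _ _ a g); lin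
  | |- @GRing.linear_for _ _ _ _ (fun x => coord ?X ?i (@?g x)) =>
      apply (@lin_coord _ _ _ _ X i g); lin
  | |- @GRing.linear_for _ _ _ _ (fun x => fun_of_lfun ?f (@?g x)) =>
      apply (@lin_comp _ _ _ _ (fun_of_lfun f) g); [exact: linearP | lin]
  | |- @GRing.linear_for _ _ _ _ (fun x => GRing.Linear.sort ?f (@?g x)) =>
      apply (@lin_scalar _ _ _ f g); lin
  | |- @GRing.linear_for _ _ _ _ (fun x => GRing.Linear.sort ?f (@?g x)) =>
      apply (@lin_comp _ _ _ _ (GRing.Linear.sort f) g); [exact: linearP | lin]
  | |- @GRing.linear_for _ _ _ _ (fun x => ?F (@?g x)) =>
      apply (@lin_comp _ _ _ _ F g); [lin_hyp | lin]
  | |- @GRing.linear_for _ _ _ _ (fun x => ?F (@?g x)) =>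
      apply (@lin_compK _ _ _ F g); [lin_hyp | lin]
  | |- @GRing.linear_for _ _ _ _ (fun x => ?F (@?g x) ?b) =>
      apply (@lin_comp _ _ _ _ (fun y => F y b) g); [lin_hyp | lin]
  | |- @GRing.linear_for _ _ _ _ (fun x => ?F (@?g x) ?b ?c) =>
      apply (@lin_comp _ _ _ _ (fun y => F y b c) g); [lin_hyp | lin]
  | |- @GRing.linear_for _ _ _ _ (fun x => ?F (@?g x) ?b ?c ?d) =>
      apply (@lin_comp _ _ _ _ (fun y => F y b c d) g); [lin_hyp | lin]
  end.

(** * The Hopf algebra axioms as rules for Sweedler sums *)

Section SweedlerLaws.
Variables (K : fieldType) (H : hopfAlgebra K).
Implicit Types (W : vectType K) (g h : H).
Local Notation S := (antipode H).
Local Notation eps := (counit H).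

Lemma tens_linr (U V : vectType K) (u : U) : linear (@tens _ U V u).
Proof. by case: (tens_bilin U V). Qed.

Lemma tlift_lin_fun (U V W : vectType K) (X : lmodType K)
    (F : X -> U -> V -> W) t :
  (forall u v, linear (fun x => F x u v)) -> linear (fun x => tlift (F x) t).
Proof. by move=> Fl; apply: lin_sum => i; apply: lin_sum => j; lin. Qed.

Lemma eq_tlift (U V W : vectType K) (F G : U -> V -> W) t :
  (forall u v, F u v = G u v) -> tlift F t = tlift G t.
Proof.
by move=> FG; apply: eq_bigr => i _; apply: eq_bigr => j _; rewrite FG.
Qed.

(** Coassociativity tested against a trilinear map: [F] induces a linear map [Phi] on the triple
    tensor product, which is applied to [comulA]. *)
Lemma Sw_assoc W (F : H -> H -> H -> W) h :
  (forall b c, linear (fun a => F a b c)) ->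
  (forall a c, linear (fun b => F a b c)) ->
  (forall a b, linear (fun c => F a b c)) ->
  Sw (fun x c => Sw (fun a b => F a b c) x) h =
  Sw (fun a y => Sw (fun b c => F a b c) y) h.
Proof.
move=> F1 F2 F3.
pose Phi (t : tensor H (tensor H H)) : W := tlift (fun a => tlift (F a)) t.
have Phil : linear Phi by apply: tlift_linear.
have bF a : bilin (F a) by lin.
have Phi_tens a t : Phi (tens a t) = tlift (F a) t.
  rewrite /Phi tlift_tens //; split=> [u|v]; first exact: tlift_linear.
  by apply: tlift_lin_fun => b c; lin.
have <- : Phi (tmap id (comul H) (comul H h)) = Sw (fun a => Sw (F a)) h.
  rewrite /tmap (linear_tlift _ _ Phil).
  by apply: eq_tlift => u v; rewrite Phi_tens.
rewrite -comulA /tmap.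
have assl := @tlift_linear K _ _ _
   (fun t w => tlift (fun u v => tens u (tens v w)) t : tensor H (tensor H H)).
rewrite /tassoc (linear_tlift _ _ assl) (linear_tlift _ _ Phil).
apply: eq_Sw => x c; rewrite tlift_tens.
  rewrite (linear_tlift _ _ Phil); apply: eq_tlift => u v.
  by rewrite Phi_tens tlift_tens.
split=> [u|v]; last exact: tlift_linear.
apply: tlift_lin_fun => a b; apply: lin_comp (tens_linr _) _.
exact: tens_linr.
Qed.

Lemma Sw_scale W (F : H -> H -> W) (c : K) h :
  Sw (fun a b => c *: F a b) h = c *: Sw F h.
Proof. by rewrite [RHS](Sw_linear _ _ (lin_scale c (@lin_id _ W))). Qed.

Lemma Sw_counitl W (f : H -> W) h :
  linear f -> Sw (fun a b => eps a *: f b) h = f h.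
Proof.
move=> fl; rewrite -{2}(counitl h) (linear_tlift _ _ fl).
by apply: eq_tlift => a b; rewrite linZ.
Qed.

Lemma Sw_counitr W (f : H -> W) h :
  linear f -> Sw (fun a b => eps b *: f a) h = f h.
Proof.
move=> fl; rewrite -{2}(counitr h) (linear_tlift _ _ fl).
by apply: eq_tlift => a b; rewrite linZ.
Qed.

Lemma Sw_antil W (f : H -> W) h :
  linear f -> Sw (fun a b => f (S a * b)) h = eps h *: f 1.
Proof. by move=> fl; rewrite -linZ // -antipodel (linear_tlift _ _ fl). Qed.

Lemma Sw_antir W (f : H -> W) h :
  linear f -> Sw (fun a b => f (a * S b)) h = eps h *: f 1.
Proof. by move=> fl; rewrite -linZ // -antipoder (linear_tlift _ _ fl). Qed.

Lemma Sw1 W (F : H -> H -> W) : bilin F -> Sw F 1 = F 1 1.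
Proof. by move=> bF; rewrite /Sw comul1 tlift_tens. Qed.

Lemma SwM W (F : H -> H -> W) g h :
  (forall b, linear (fun a => F a b)) ->
  (forall a, linear (fun b => F a b)) ->
  Sw F (g * h) = Sw (fun a b => Sw (fun c d => F (a * c) (b * d)) h) g.
Proof.
move=> F1 F2; rewrite /Sw comulM /tmul.
rewrite (linear_tlift _ _ (@tlift_linear _ _ _ _ F)).
apply: eq_tlift => a b; rewrite (linear_tlift _ _ (@tlift_linear _ _ _ _ F)).
by apply: eq_tlift => c d; rewrite tlift_tens.
Qed.

Lemma antipode1 : S 1 = 1.
Proof.
have := Sw_antil (f := id) 1 (@lin_id _ _); rewrite Sw1; last by lin.
by rewrite mulr1 counit1 scale1r.
Qed.

End SweedlerLaws.

(** * The antipode reverses products and coproducts *)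

Section Antipode.
Variables (K : fieldType) (H : hopfAlgebra K).
Implicit Types (W : vectType K) (g h : H).
Local Notation S := (antipode H).
Local Notation eps := (counit H).

(** Both sides are convolution inverses of the product map on H (x) H. [Z] is the triple convolution
    product S(g_1 h_1) (g_2 h_2) (S(h_3) S(g_3)); contracting its left or its right pair gives one
    side or the other. *)
Lemma antipodeM g h : S (g * h) = S h * S g.
Proof.
pose Z : H := Sw (fun x g3 => Sw (fun g1 g2 => Sw (fun y h3 => Sw (fun h1 h2 =>
  S (g1 * h1) * (g2 * h2) * (S h3 * S g3)) y) h) x) g.
have E1 : Z = S h * S g.
  rewrite /Z; transitivity
    (Sw (fun x g3 => eps x *: Sw (fun y h3 => eps y *: (S h3 * S g3)) h) g).
    apply: eq_Sw => x g3.
    rewrite SwC -Sw_scale.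
    apply: eq_Sw => y h3.
    transitivity (Sw (fun a b => S a * b * (S h3 * S g3)) (x * y)).
      rewrite SwM; try lin.
      by apply: eq_Sw => a b; apply: eq_Sw => c d.
    rewrite (Sw_antil (f := fun t => t * (S h3 * S g3))) ?mul1r; last by lin.
    by rewrite counitM scalerA.
  rewrite (Sw_counitl (f := fun g3 => Sw (fun y h3 => eps y *: (S h3 * S g3)) h));
    last by lin.
  by rewrite (Sw_counitl (f := fun h3 => S h3 * S g)) //; lin.
rewrite -E1 /Z Sw_assoc; try lin.
transitivity (Sw (fun g1 x => eps x *: Sw (fun h1 y => eps y *: S (g1 * h1)) h) g).
  rewrite (Sw_counitr (f := fun g1 => Sw (fun h1 y => eps y *: S (g1 * h1)) h));
    last by lin.
  by rewrite (Sw_counitr (f := fun h1 => S (g * h1))) //; lin.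
apply: eq_Sw => g1 x.
transitivity (Sw (fun h1 y => Sw (fun b c => Sw (fun h2 h3 =>
   S (g1 * h1) * (b * h2) * (S h3 * S c)) y) x) h); last first.
  rewrite SwC; apply: eq_Sw => b c; rewrite Sw_assoc //; lin.
rewrite -Sw_scale.
apply: eq_Sw => h1 y; rewrite SwC.
transitivity (eps y *: Sw (fun b c => S (g1 * h1) * (b * S c)) x).
  rewrite (Sw_antir (f := fun t => S (g1 * h1) * t)); last by lin.
  by rewrite mulr1 !scalerA mulrC.
rewrite -Sw_scale.
rewrite SwC; apply: eq_Sw => b c; symmetry.
transitivity (Sw (fun h2 h3 => S (g1 * h1) * (b * (h2 * S h3) * S c)) y).
  by apply: eq_Sw => h2 h3; rewrite !mulrA.
by rewrite (Sw_antir (f := fun t => S (g1 * h1) * (b * t * S c))) ?mulr1 //; lin.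
Qed.

Lemma counit_antipode h : eps (S h) = eps h.
Proof.
have epsl : linear (eps : H -> K^o) := lin_scalar eps (@lin_id _ H).
transitivity (Sw (fun a b => eps (S a * b) : K^o) h).
  have Sl : linear (fun a => eps (S a) : K^o) by lin.
  rewrite -(Sw_counitr h Sl).
  by apply: (@eq_Sw _ _ K^o) => a b; rewrite counitM mulrC.
by rewrite (Sw_antil h epsl) counit1 [_ *: _]mulr1.
Qed.

(** Both sides are convolution inverses of the coproduct, among maps from H to H (x) H: [Z] is
    Delta(S(h_1)) Delta(h_2) (S(h_4) (x) S(h_3)), contracted in two ways. *)
Lemma Sw_antipode W (F : H -> H -> W) h :
  (forall b, linear (fun a => F a b)) ->
  (forall a, linear (fun b => F a b)) ->
  Sw F (S h) = Sw (fun a b => F (S b) (S a)) h.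
Proof.
move=> F1 F2.
pose Z : W := Sw (fun t z => Sw (fun x y => Sw (fun p q => Sw (fun c d =>
  Sw (fun e f => F (p * c * S f) (q * d * S e)) z) y) (S x)) t) h.
have -> : Sw (fun a b => F (S b) (S a)) h = Z.
  pose G z := Sw (fun e f => F (S f) (S e)) z.
  transitivity (Sw (fun x z => eps x *: G z) h).
    by rewrite Sw_counitl //; rewrite /G; lin.
  apply: eq_Sw => t z; symmetry.
  transitivity (Sw (fun x y => Sw (fun p q => Sw (fun e f =>
    F (p * S f) (q * S e)) z) (S x * y)) t).
    by apply: eq_Sw => x y; rewrite SwM //; lin.
  rewrite (Sw_antil (f := fun w => Sw (fun p q => Sw (fun e f =>
    F (p * S f) (q * S e)) z) w)); last by lin.
  rewrite Sw1; last by lin.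
  by congr (_ *: _); apply: eq_Sw => e f; rewrite !mul1r.
rewrite /Z Sw_assoc; try lin.
transitivity (Sw (fun x y => eps y *: Sw F (S x)) h).
  by rewrite Sw_counitr //; lin.
apply: eq_Sw => x w; rewrite SwC -Sw_scale; apply: eq_Sw => p q.
symmetry; rewrite Sw_assoc; try lin.
transitivity (Sw (fun c w' => Sw (fun v f => Sw (fun d e =>
    F (p * c * S f) (q * d * S e)) v) w') w).
  by apply: eq_Sw => c w'; rewrite Sw_assoc //; lin.
transitivity (Sw (fun c w' => Sw (fun v f => eps v *: F (p * c * S f) q) w') w).
  apply: eq_Sw => c w'; apply: eq_Sw => v f.
  transitivity (Sw (fun d e => F (p * c * S f) (q * (d * S e))) v).
    by apply: eq_Sw => d e; rewrite mulrA.
  by rewrite (Sw_antir (f := fun u => F (p * c * S f) (q * u))) ?mulr1 //; lin.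
transitivity (Sw (fun c w' => F (p * (c * S w')) q) w).
  apply: eq_Sw => c w'.
  by rewrite (Sw_counitl (f := fun f => F (p * c * S f) q)) ?mulrA //; lin.
by rewrite (Sw_antir (f := fun u => F (p * u) q)) ?mulr1 //; lin.
Qed.
End Antipode.

(** * Traces and integrals *)

Section Trace.
Variable K : fieldType.
Implicit Types U V W : vectType K.

Definition opmx U V (f : U -> V) : 'M[K]_(\dim {:V}, \dim {:U}) :=
  \matrix_(i, j) coord (vbasis {:V}) i (f (vbasis {:U})`_j).

Definition optr V (f : V -> V) : K := \tr (opmx f).

Lemma coord_exp V (W : lmodType K) (f : V -> W) v :
  linear f ->
  \sum_i coord (vbasis {:V}) i v *: f (vbasis {:V})`_i = f v.
Proof.
move=> fl; rewrite {2}(coord_vbasis (memvf v)).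
pose l : {linear V -> W} := HB.pack f (GRing.isLinear.Build _ _ _ _ _ fl).
rewrite -[f]/(GRing.Linear.sort l) linear_sum.
by apply: eq_bigr => i _; rewrite linearZ.
Qed.

Lemma coord_basis V (i j : 'I_(\dim {:V})) :
  coord (vbasis {:V}) i (vbasis {:V})`_j = (i == j)%:R.
Proof. by rewrite coord_free 1?eq_sym // (basis_free (vbasisP _)). Qed.

Lemma opmx_comp U V W (f : V -> W) (g : U -> V) :
  linear f -> opmx (fun x => f (g x)) = opmx f *m opmx g.
Proof.
move=> fl; apply/matrixP=> i k; rewrite !mxE.
have cfl : linear (fun v => coord (vbasis {:W}) i (f v) : K^o) by lin.
rewrite -(coord_exp (g _) cfl); apply: eq_bigr => j _.
by rewrite !mxE mulrC.
Qed.

Lemma eq_opmx U V (f g : U -> V) : f =1 g -> opmx f = opmx g.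
Proof. by move=> fg; apply/matrixP=> i j; rewrite !mxE fg. Qed.

Lemma opmx_id V : opmx (@id V) = 1%:M.
Proof. by apply/matrixP=> i j; rewrite !mxE coord_basis. Qed.

Lemma opmx_sum U V I (r : seq I) (P : pred I) (F : I -> U -> V) :
  opmx (fun x => \sum_(i <- r | P i) F i x) = \sum_(i <- r | P i) opmx (F i).
Proof.
apply/matrixP=> i j; rewrite !mxE linear_sum summxE.
by apply: eq_bigr => k _; rewrite !mxE.
Qed.

Lemma opmx_lin U V (X : lmodType K) (F : X -> U -> V) :
  (forall u, linear (fun x => F x u)) -> linear (fun x => opmx (F x)).
Proof. by move=> Fl k x y; apply/matrixP=> i j; rewrite !mxE Fl linearP. Qed.

Lemma opmx_inj U V (f g : U -> V) :
  linear f -> linear g -> opmx f = opmx g -> f =1 g.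
Proof.
move=> fl gl fg u; rewrite -(coord_exp u fl) -(coord_exp u gl).
apply: eq_bigr => j _; congr (_ *: _).
rewrite (coord_vbasis (memvf (f _))) (coord_vbasis (memvf (g _))).
by apply: eq_bigr => i _; have /matrixP/(_ i j) := fg; rewrite !mxE => ->.
Qed.

Lemma eq_optr V (f g : V -> V) : f =1 g -> optr f = optr g.
Proof. by move=> /eq_opmx fg; rewrite /optr fg. Qed.

Lemma optrC U V (f : U -> V) (g : V -> U) :
  linear f -> linear g -> optr (fun x => g (f x)) = optr (fun y => f (g y)).
Proof.
move=> fl gl; rewrite /optr (opmx_comp f gl) (opmx_comp g fl).
exact: mxtrace_mulC.
Qed.

Lemma optr_lin V (X : lmodType K) (F : X -> V -> V) :
  (forall u, linear (fun x => F x u)) -> linear (fun x => optr (F x) : K^o).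
Proof.
by move=> Fl k x y; rewrite /optr (opmx_lin Fl) linearD linearZ.
Qed.

Lemma optr_sum V I (r : seq I) (P : pred I) (F : I -> V -> V) :
  optr (fun x => \sum_(i <- r | P i) F i x) = \sum_(i <- r | P i) optr (F i).
Proof. by rewrite /optr opmx_sum linear_sum. Qed.

Lemma optr_id V : optr (@id V) = (\dim {:V})%:R.
Proof. by rewrite /optr opmx_id mxtrace1. Qed.

Lemma optr_rank1 V (q : V -> K^o) (v : V) :
  linear q -> optr (fun x => (q x : K) *: v) = q v.
Proof.
move=> ql; rewrite -[RHS](coord_exp v ql); apply: eq_bigr => i _.
by rewrite mxE linearZ /= mulrC.
Qed.

End Trace.

Section SweedlerTrace.
Variables (K : fieldType) (H : hopfAlgebra K).
Implicit Types (g h : H).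
Local Notation S := (antipode H).
Local Notation eps := (counit H).
Local Notation e i := ((vbasis {:H})`_i).
Local Notation "e^ i" := (coord (vbasis {:H}) i) (at level 2, i at level 1).

(* Cyclicity of the trace for Sweedler sums: the strand A a is cut elsewhere. *)
Lemma optr_loopl (A : H -> H) (F : H -> H -> K^o) :
  linear A -> (forall b, linear (fun a => F a b)) -> (forall a, linear (F a)) ->
  optr (fun x => Sw (fun a b => Sw (fun c d => (F d b : K) *: c) (A a)) x) =
  optr (fun z => Sw (fun c d => Sw (fun c1 c2 => (F d c2 : K) *: A c1) c) z).
Proof.
move=> Al F1 F2.
(* Expanding the cut strand in a basis writes the left map as the sum of the composites [B s], [A],
   [C s]; ordinary cyclicity then moves [B s] to the other end. *)
pose B (s : 'I_(\dim {:H})) z := Sw (fun c d => (F d (e s) : K) *: c) z.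
pose C s x := Sw (fun a b => e^s b *: a) x.
have Bl s : linear (B s) by rewrite /B; lin.
have Cl s : linear (C s) by rewrite /C; lin.
have BAl s : linear (fun y => B s (A y)) by lin.
have ACl s : linear (fun y => A (C s y)) by lin.
transitivity (optr (fun x => \sum_s B s (A (C s x)))).
  apply: eq_optr => x; transitivity
    (\sum_s Sw (fun a b => B s (A (e^s b *: a))) x); last first.
    by apply: eq_bigr => s _; rewrite -(Sw_linear _ _ (BAl s)).
  rewrite -Sw_sum; apply: eq_Sw => a b.
  pose G b := Sw (fun c d => (F d b : K) *: c) (A a).
  have Gl : linear G by rewrite /G; lin.
  rewrite -[LHS]/(G b) -(coord_exp b Gl); apply: eq_bigr => s _.
  by rewrite (linZ _ _ Al) (linZ _ _ (Bl s)).
transitivity (optr (fun x => \sum_s A (C s (B s x)))).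
  rewrite !optr_sum; apply: eq_bigr => s _.
  by rewrite (optrC (f := fun x => A (C s x)) (g := B s)) //; lin.
apply: eq_optr => z; rewrite /B.
under eq_bigr => s _ do rewrite (Sw_linear _ _ (ACl s)).
rewrite -Sw_sum; apply: eq_Sw => c d.
transitivity (\sum_(s < \dim {:H}) F d (e s) *: Sw (fun a b => e^s b *: A a) c).
  apply: eq_bigr => s _; rewrite (linZ _ _ (ACl s)) /C (Sw_linear _ _ Al).
  by congr (_ *: _); apply: eq_Sw => a b; rewrite (linZ _ _ Al).
transitivity (\sum_(s < \dim {:H}) Sw (fun a b => F d (e s) *: (e^s b *: A a)) c).
  by apply: eq_bigr => s _; rewrite Sw_scale.
rewrite -Sw_sum; apply: eq_Sw => a b.
rewrite -(coord_exp b (F2 d)) scaler_suml; apply: eq_bigr => s _.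
by rewrite !scalerA mulrC.
Qed.

Lemma optr_loopr (A : H -> H) (F : H -> H -> K^o) :
  linear A -> (forall b, linear (fun a => F a b)) -> (forall a, linear (F a)) ->
  optr (fun x => Sw (fun a b => Sw (fun c d => (F c a : K) *: d) (A b)) x) =
  optr (fun z => Sw (fun c d => Sw (fun d1 d2 => (F c d1 : K) *: A d2) d) z).
Proof.
move=> Al F1 F2.
pose B (s : 'I_(\dim {:H})) z := Sw (fun c d => (F c (e s) : K) *: d) z.
pose C s x := Sw (fun a b => e^s a *: b) x.
have Bl s : linear (B s) by rewrite /B; lin.
have Cl s : linear (C s) by rewrite /C; lin.
have BAl s : linear (fun y => B s (A y)) by lin.
have ACl s : linear (fun y => A (C s y)) by lin.
transitivity (optr (fun x => \sum_s B s (A (C s x)))).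
  apply: eq_optr => x; transitivity
    (\sum_s Sw (fun a b => B s (A (e^s a *: b))) x); last first.
    by apply: eq_bigr => s _; rewrite -(Sw_linear _ _ (BAl s)).
  rewrite -Sw_sum; apply: eq_Sw => a b.
  pose G a := Sw (fun c d => (F c a : K) *: d) (A b).
  have Gl : linear G by rewrite /G; lin.
  rewrite -[LHS]/(G a) -(coord_exp a Gl); apply: eq_bigr => s _.
  by rewrite (linZ _ _ Al) (linZ _ _ (Bl s)).
transitivity (optr (fun x => \sum_s A (C s (B s x)))).
  rewrite !optr_sum; apply: eq_bigr => s _.
  by rewrite (optrC (f := fun x => A (C s x)) (g := B s)) //; lin.
apply: eq_optr => z; rewrite /B.
under eq_bigr => s _ do rewrite (Sw_linear _ _ (ACl s)).
rewrite -Sw_sum; apply: eq_Sw => c d.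
transitivity (\sum_(s < \dim {:H}) F c (e s) *: Sw (fun a b => e^s a *: A b) d).
  apply: eq_bigr => s _; rewrite (linZ _ _ (ACl s)) /C (Sw_linear _ _ Al).
  by congr (_ *: _); apply: eq_Sw => a b; rewrite (linZ _ _ Al).
transitivity (\sum_(s < \dim {:H}) Sw (fun a b => F c (e s) *: (e^s a *: A b)) d).
  by apply: eq_bigr => s _; rewrite Sw_scale.
rewrite -Sw_sum; apply: eq_Sw => a b.
rewrite -(coord_exp a (F2 c)) scaler_suml; apply: eq_bigr => s _.
by rewrite !scalerA mulrC.
Qed.

End SweedlerTrace.

Ltac lin_ext ::=
  match goal with
  | |- @GRing.linear_for _ _ _ _ (fun x => opmx (@?F x)) =>
      apply (@opmx_lin _ _ _ _ F); lin
  end.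

(** * Integrals of the dual and the distinguished group-like element *)

Section Integrals.
Variables (K : fieldType) (H : hopfAlgebra K).
Implicit Types (W : vectType K) (g h : H).
Local Notation S := (antipode H).
Local Notation eps := (counit H).
Local Notation SS x := (S (S x)).

Lemma optr_Sw (V : vectType K) (F : H -> H -> V -> V) h :
  optr (fun x => Sw (fun a b => F a b x) h) = Sw (fun a b => optr (F a b) : K^o) h.
Proof.
rewrite /Sw /tlift optr_sum; apply: eq_bigr => i _; rewrite optr_sum.
apply: eq_bigr => j _; rewrite -[RHS]/(_ * _) /optr -mxtraceZ; congr (\tr _).
by apply/matrixP=> k l; rewrite !mxE linearZ.
Qed.

Lemma optrZ (V : vectType K) c (f : V -> V) :
  optr (fun x => c *: f x) = c * optr f.
Proof.
by rewrite /optr -mxtraceZ; congr (\tr _); apply/matrixP=> i j; rewrite !mxE linearZ.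
Qed.

Lemma coord_eq W (x y : W) :
  (forall q : W -> K^o, linear q -> q x = q y) -> x = y.
Proof.
move=> xy; rewrite (coord_vbasis (memvf x)) (coord_vbasis (memvf y)).
apply: eq_bigr => i _; congr (_ *: _).
by apply: (xy (coord (vbasis {:W}) i)) => k u v; rewrite linearP.
Qed.

Lemma Sw_SS W (F : H -> H -> W) h :
  (forall b, linear (fun a => F a b)) ->
  (forall a, linear (fun b => F a b)) ->
  Sw F (SS h) = Sw (fun a b => F (SS a) (SS b)) h.
Proof. by move=> F1 F2; rewrite Sw_antipode // Sw_antipode //; lin. Qed.

(* Up to normalization, the integrals of the dual are the traces of left and
   right multiplications twisted by S^2. *)
Definition laml h : K := optr (fun y => h * SS y).
Definition lamr h : K := optr (fun y => SS y * h).

Lemma laml_lin : linear (laml : H -> K^o).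
Proof. by apply: optr_lin => u; lin. Qed.

Lemma lamr_lin : linear (lamr : H -> K^o).
Proof. by apply: optr_lin => u; lin. Qed.

(** Cyclicity of the trace carries [g] past the multiplicative map S^2, which is thus the Nakayama
    automorphism of [laml]. *)
Lemma lamlM g h : laml (g * h) = laml (h * SS g).
Proof.
transitivity (optr (fun y => g * (h * SS y))).
  by apply: eq_optr => y; rewrite mulrA.
rewrite (optrC (f := fun y => h * SS y) (g := fun y => g * y)); try lin.
by apply: eq_optr => y; rewrite !antipodeM mulrA.
Qed.

Lemma lamrM g h : lamr (g * h) = lamr (SS h * g).
Proof.
transitivity (optr (fun y => (SS y * g) * h)).
  by apply: eq_optr => y; rewrite mulrA.
rewrite (optrC (f := fun y => SS y * g) (g := fun y => y * h)); try lin.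
by apply: eq_optr => y; rewrite !antipodeM mulrA.
Qed.

(** As S^2(y_2) S(y_1) = S(y_1 S(y_2)) collapses, h_1 (x) h_2 S^2(y) can be written as Delta(h
    S^2(y_2)) multiplied by S(y_1) in the first factor. After the loop is cut elsewhere, the factor
    is z_1 S(z_2), which collapses and leaves q(1) h S^2(z). *)
Lemma lamlP W (f : H -> W) h :
  linear f -> Sw (fun a b => laml b *: f a) h = laml h *: f 1.
Proof.
have ll := laml_lin.
move=> fl; apply: coord_eq => p pl.
rewrite (Sw_linear _ _ pl) (linZ _ _ pl).
pose q x := p (f x); have ql : linear q by rewrite /q; lin.
transitivity (optr (fun y => Sw (fun a b => (q a : K) *: (b * SS y)) h)).
  rewrite optr_Sw; apply: (@eq_Sw _ _ K^o) => a b.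
  by rewrite (linZ _ _ pl) optrZ -/(q a) [_ *: _]mulrC.
transitivity (optr (fun y => Sw (fun y1 y2 => Sw (fun c d =>
    (q (c * S y1) : K) *: d) (h * SS y2)) y)).
  apply: (@eq_optr K H) => y; symmetry.
  transitivity (Sw (fun y1 y2 => Sw (fun u v => Sw (fun a b =>
     (q (a * (SS u * S y1)) : K) *: (b * SS v)) h) y2) y).
    apply: eq_Sw => y1 y2; rewrite SwM; try lin.
    rewrite SwC Sw_SS; try lin.
    by apply: eq_Sw => u v; apply: eq_Sw => a b; rewrite mulrA.
  rewrite -Sw_assoc; try lin.
  transitivity (Sw (fun x v => eps x *: Sw (fun a b =>
     (q a : K) *: (b * SS v)) h) y); last first.
    by rewrite (Sw_counitl (f := fun v => Sw (fun a b =>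
      (q a : K) *: (b * SS v)) h)) //; lin.
  apply: eq_Sw => x v; rewrite SwC -Sw_scale; apply: eq_Sw => a b.
  transitivity (Sw (fun y1 u => (q (a * S (y1 * S u)) : K) *: (b * SS v)) x).
    by apply: eq_Sw => y1 u; rewrite antipodeM.
  rewrite (Sw_antir (f := fun t => (q (a * S t) : K) *: (b * SS v))); last by lin.
  by rewrite antipode1 mulr1.
rewrite (optr_loopr (A := fun z => h * SS z) (F := fun c a => q (c * S a)));
  try lin.
transitivity (optr (fun z => (q 1 : K) *: (h * SS z))); last first.
  by rewrite optrZ mulrC.
apply: (@eq_optr K H) => z; rewrite -Sw_assoc; try lin.
transitivity (Sw (fun x v => eps x *: ((q 1 : K) *: (h * SS v))) z).
  apply: eq_Sw => x v.
  by rewrite (Sw_antir (f := fun t => (q t : K) *: (h * SS v))) //; lin.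
by rewrite (Sw_counitl (f := fun v => (q 1 : K) *: (h * SS v))) //; lin.
Qed.

Lemma lamrP W (f : H -> W) h :
  linear f -> Sw (fun a b => lamr a *: f b) h = lamr h *: f 1.
Proof.
have ll := lamr_lin.
move=> fl; apply: coord_eq => p pl.
rewrite (Sw_linear _ _ pl) (linZ _ _ pl).
pose q x := p (f x); have ql : linear q by rewrite /q; lin.
transitivity (optr (fun y => Sw (fun a b => (q b : K) *: (SS y * a)) h)).
  rewrite optr_Sw; apply: (@eq_Sw _ _ K^o) => a b.
  by rewrite (linZ _ _ pl) optrZ -/(q b) [_ *: _]mulrC.
transitivity (optr (fun y => Sw (fun y1 y2 => Sw (fun c d =>
    (q (S y2 * d) : K) *: c) (SS y1 * h)) y)).
  apply: (@eq_optr K H) => y; symmetry.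
  transitivity (Sw (fun y1 y2 => Sw (fun u v => Sw (fun a b =>
     (q ((S y2 * SS v) * b) : K) *: (SS u * a)) h) y1) y).
    apply: eq_Sw => y1 y2; rewrite SwM; try lin.
    rewrite Sw_SS; try lin.
    by apply: eq_Sw => u v; apply: eq_Sw => a b; rewrite mulrA.
  rewrite Sw_assoc; try lin.
  transitivity (Sw (fun u x => eps x *: Sw (fun a b =>
     (q b : K) *: (SS u * a)) h) y); last first.
    by rewrite (Sw_counitr (f := fun u => Sw (fun a b =>
      (q b : K) *: (SS u * a)) h)) //; lin.
  apply: eq_Sw => u x; rewrite SwC -Sw_scale; apply: eq_Sw => a b.
  transitivity (Sw (fun v y2 => (q (S (S v * y2) * b) : K) *: (SS u * a)) x).
    by apply: eq_Sw => v y2; rewrite antipodeM.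
  rewrite (Sw_antil (f := fun t => (q (S t * b) : K) *: (SS u * a))); last by lin.
  by rewrite antipode1 mul1r.
rewrite (optr_loopl (A := fun z => SS z * h) (F := fun d b => q (S b * d)));
  try lin.
transitivity (optr (fun z => (q 1 : K) *: (SS z * h))); last first.
  by rewrite optrZ mulrC.
apply: (@eq_optr K H) => z; rewrite Sw_assoc; try lin.
transitivity (Sw (fun u x => eps x *: ((q 1 : K) *: (SS u * h))) z).
  apply: eq_Sw => u x.
  by rewrite (Sw_antil (f := fun t => (q t : K) *: (SS u * h))) //; lin.
by rewrite (Sw_counitr (f := fun u => (q 1 : K) *: (SS u * h))) //; lin.
Qed.

Section NormalizedIntegral.
Variable L : H.
Hypothesis HL : normalized_integral L.

Lemma intl h : h * L = eps h *: L.
Proof. by case: HL => /(_ h) []. Qed.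

Lemma intr h : L * h = eps h *: L.
Proof. by case: HL => /(_ h) []. Qed.

Lemma int_eps : eps L = 1.
Proof. by case: HL. Qed.

Lemma laml_L : laml L = 1.
Proof.
transitivity (optr (fun y => (eps y : K^o) *: L)).
  by apply: eq_optr => y; rewrite intr !counit_antipode.
rewrite (optr_rank1 (q := fun y => eps y : K^o)) ?int_eps //.
by move=> k x y; rewrite linearP.
Qed.

Lemma lamr_L : lamr L = 1.
Proof.
transitivity (optr (fun y => (eps y : K^o) *: L)).
  by apply: eq_optr => y; rewrite intl !counit_antipode.
rewrite (optr_rank1 (q := fun y => eps y : K^o)) ?int_eps //.
by move=> k x y; rewrite linearP.
Qed.

(** Since h_2 L = eps(h_2) L, one has S(h) L_1 (x) L_2 = S(h_1) h_2 L_1 (x) h_3 L_2. *)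
Lemma Sw_int_antipodel W (F : H -> H -> W) h :
  (forall b, linear (fun a => F a b)) ->
  (forall a, linear (fun b => F a b)) ->
  Sw (fun a b => F (S h * a) b) L = Sw (fun a b => F a (h * b)) L.
Proof.
move=> F1 F2.
transitivity (Sw (fun u z => Sw (fun a b => F (S u * a) b) (z * L)) h).
  transitivity (Sw (fun u z => eps z *: Sw (fun a b => F (S u * a) b) L) h).
    by rewrite (Sw_counitr (f := fun u => Sw (fun a b => F (S u * a) b) L)) //; lin.
  by apply: eq_Sw => u z; rewrite intl (linZ _ _ (Sw_lin _)).
transitivity (Sw (fun u z => Sw (fun c d => Sw (fun a b =>
    F (S u * c * a) (d * b)) L) z) h).
  apply: eq_Sw => u z; rewrite SwM; try lin.
  by apply: eq_Sw => c d; apply: eq_Sw => a b; rewrite mulrA.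
rewrite -Sw_assoc; try lin.
transitivity (Sw (fun x d => eps x *: Sw (fun a b => F a (d * b)) L) h).
  apply: eq_Sw => x d.
  rewrite (Sw_antil (f := fun t => Sw (fun a b => F (t * a) (d * b)) L));
    last by lin.
  by congr (_ *: _); apply: eq_Sw => a b; rewrite mul1r.
by rewrite (Sw_counitl (f := fun d => Sw (fun a b => F a (d * b)) L)) //; lin.
Qed.

Lemma Sw_int_antipoder W (F : H -> H -> W) h :
  (forall b, linear (fun a => F a b)) ->
  (forall a, linear (fun b => F a b)) ->
  Sw (fun a b => F a (b * S h)) L = Sw (fun a b => F (a * h) b) L.
Proof.
move=> F1 F2.
transitivity (Sw (fun z u => Sw (fun a b => F a (b * S u)) (L * z)) h).
  transitivity (Sw (fun z u => eps z *: Sw (fun a b => F a (b * S u)) L) h).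
    by rewrite (Sw_counitl (f := fun u => Sw (fun a b => F a (b * S u)) L)) //; lin.
  by apply: eq_Sw => z u; rewrite intr (linZ _ _ (Sw_lin _)).
transitivity (Sw (fun z u => Sw (fun c d => Sw (fun a b =>
    F (a * c) (b * (d * S u))) L) z) h).
  apply: eq_Sw => z u; rewrite SwM; try lin.
  by rewrite SwC; apply: eq_Sw => c d; apply: eq_Sw => a b; rewrite mulrA.
rewrite Sw_assoc; try lin.
transitivity (Sw (fun c x => eps x *: Sw (fun a b => F (a * c) b) L) h).
  apply: eq_Sw => c x.
  rewrite (Sw_antir (f := fun t => Sw (fun a b => F (a * c) (b * t)) L));
    last by lin.
  by congr (_ *: _); apply: eq_Sw => a b; rewrite mulr1.
by rewrite (Sw_counitr (f := fun c => Sw (fun a b => F (a * c) b) L)) //; lin.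
Qed.

(** An explicit inverse of h -> lamr(S(h) -): L_1 (x) L_2 serves as a dual basis tensor for a
    Frobenius form. Bijectivity of S and nondegeneracy of [laml] follow from this lemma and its
    companion [laml_dual]. *)
Lemma lamr_dual h : Sw (fun a b => lamr (S h * a) *: b) L = h.
Proof.
have ll := lamr_lin.
rewrite (Sw_int_antipodel (F := fun a b => lamr a *: b)); try lin.
rewrite (lamrP (f := fun b => h * b)); last by lin.
by rewrite lamr_L scale1r mulr1.
Qed.

Lemma laml_dual h : Sw (fun a b => laml (b * S h) *: a) L = h.
Proof.
have ll := laml_lin.
rewrite (Sw_int_antipoder (F := fun a b => laml b *: a)); try lin.
rewrite (lamlP (f := fun a => a * h)); last by lin.
by rewrite laml_L scale1r mul1r.
Qed.

Lemma antipode_inj : injective S.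
Proof. by move=> x y Sxy; rewrite -(lamr_dual x) Sxy lamr_dual. Qed.

Lemma antipode_surj h : exists x, S x = h.
Proof.
have Sker : lker S == 0%VS by apply/lker0P; exact: antipode_inj.
have := memvf h; rewrite -(lker0_limgf Sker) => /memv_imgP[x _ ->].
by exists x.
Qed.

Lemma laml_repr (mu : H -> K^o) :
  linear mu -> exists y, forall h, mu h = laml (h * y).
Proof.
have ll := laml_lin => ml.
(* Apply mu to [laml_dual] at S^-1(h): this gives mu(h) = laml(w h), and [lamlM] moves [w] to the
   right at the price of S^2. *)
pose w := @Sw K H H (fun a b => (mu (S a) : K) *: b) L.
exists (SS w) => h; rewrite -lamlM; have [x <-] := antipode_surj h.
rewrite -{1}(laml_dual x) (Sw_linear (L := fun t : H => mu (S t))); last by lin.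
rewrite /w (Sw_linear (L := fun t : H => laml (t * S x) : K^o)); last by lin.
apply: (@eq_Sw _ _ K^o) => a b; rewrite (linZ (f := fun t : H => mu (S t))); last by lin.
rewrite (linZ (f := fun t : H => laml (t * S x) : K^o)); last by lin.
by rewrite [LHS]mulrC.
Qed.

Lemma laml_inj x y : (forall h, laml (h * x) = laml (h * y)) -> x = y.
Proof.
move=> xy; have [x' x'E] := antipode_surj x; have [y' y'E] := antipode_surj y.
rewrite -x'E -y'E; congr (S _); rewrite -(laml_dual x') -(laml_dual y').
by apply: eq_Sw => a b; rewrite x'E y'E xy.
Qed.

(** If mu = laml(- y), then [laml_dual] at S^-1(y) and the invariance of mu show that y is the
    scalar mu(L). *)
Lemma left_integral_unique (mu : H -> K^o) h :
  linear mu ->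
  (forall h, Sw (fun a b => (mu b : K) *: a) h = (mu h : K) *: 1) ->
  mu h = mu L * laml h.
Proof.
have ll := laml_lin => ml muP; have [y yE] := laml_repr ml.
have [x xE] := antipode_surj y.
have xc : x = (mu L : K) *: 1.
  by rewrite -muP -(laml_dual x); apply: eq_Sw => a b; rewrite yE xE.
have yc : y = (mu L : K) *: 1 by rewrite -xE xc linearZ /= antipode1.
by rewrite yE yc -scalerAr mulr1 (linZ _ _ ll).
Qed.

(** The distinguished group-like element: it measures how far [laml], an integral on one side, is
    from being one on the other side. *)
Definition distg : H := @Sw K H H (fun a b => laml a *: b) L.

(** For each functional p, the map h -> p(laml(h_1) f(h_2)) satisfies the same invariance as [laml],
    so it is a multiple of [laml]; its value at L is the factor. *)
Lemma lamlPr W (f : H -> W) h :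
  linear f -> Sw (fun a b => laml a *: f b) h = laml h *: f distg.
Proof.
have ll := laml_lin.
move=> fl; apply: coord_eq => p pl.
rewrite (Sw_linear _ _ pl) (linZ _ _ pl).
pose mu h : K^o := Sw (fun a b => p (laml a *: f b)) h.
have mul : linear mu by rewrite /mu; lin.
have muP k : Sw (fun a b => (mu b : K) *: a) k = (mu k : K) *: 1.
  transitivity (Sw (fun a x => Sw (fun b c => (p (laml b *: f c) : K) *: a) x) k).
    apply: eq_Sw => a x.
    by rewrite /mu (Sw_linear (L := fun t : K^o => (t : K) *: a)) //; lin.
  rewrite -Sw_assoc; try lin.
  rewrite /mu (Sw_linear (L := fun t : K^o => (t : K) *: (1 : H))); last by lin.
  apply: eq_Sw => x c.
  transitivity (Sw (fun a b => laml b *: ((p (f c) : K) *: a)) x).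
    apply: eq_Sw => a b; rewrite (linZ _ _ pl) scalerA.
    by congr (_ *: _).
  rewrite (lamlP (f := fun a => (p (f c) : K) *: a)); last by lin.
  by rewrite (linZ _ _ pl) scalerA.
rewrite -/(mu h) (left_integral_unique h mul muP) [LHS]mulrC.
congr (_ * _); rewrite /distg (Sw_linear (L := fun t : H => p (f t))); last by lin.
by apply: (@eq_Sw _ _ K^o) => a b; rewrite (linZ _ _ fl).
Qed.

Lemma eps_distg : eps distg = 1.
Proof.
have ll := laml_lin.
rewrite /distg (Sw_linear (L := fun t : H => eps t : K^o)); last by lin.
rewrite -laml_L -[RHS](Sw_counitr (f := laml : H -> K^o) L) //.
by apply: (@eq_Sw _ _ K^o) => a b; rewrite linearZ [LHS]mulrC.
Qed.

Lemma Sw_distg W (F : H -> H -> W) :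
  (forall b, linear (fun a => F a b)) ->
  (forall a, linear (fun b => F a b)) ->
  Sw F distg = F distg distg.
Proof.
have ll := laml_lin; move=> F1 F2.
rewrite -[LHS]scale1r -laml_L -(lamlPr (f := Sw F)); last exact: Sw_lin.
transitivity (Sw (fun a x => Sw (fun b c => laml a *: F b c) x) L).
  by apply: eq_Sw => a x; rewrite Sw_scale.
rewrite -Sw_assoc; try lin.
transitivity (Sw (fun x c => laml x *: F distg c) L).
  by apply: eq_Sw => x c; rewrite (lamlPr (f := fun b => F b c)) //; lin.
by rewrite (lamlPr (f := fun c => F distg c)) ?laml_L ?scale1r //; lin.
Qed.

Lemma antipode_distg : S distg * distg = 1.
Proof.
have := Sw_antil (f := id) distg (@lin_id _ _).
by rewrite Sw_distg ?eps_distg ?scale1r //; lin.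
Qed.

Lemma lamrE h : lamr h = laml (h * distg).
Proof.
have ll := laml_lin; have lr := lamr_lin.
have [y yE] := laml_repr lamr_lin; rewrite yE; congr (laml (_ * _)).
apply: antipode_inj.
have : distg * S y = 1.
  transitivity (Sw (fun a b => laml a *: (b * S y)) L).
    rewrite /distg (Sw_linear (L := fun t : H => t * S y)); last by lin.
    by apply: eq_Sw => a b; rewrite scalerAl.
  rewrite (Sw_int_antipoder (F := fun a b => laml a *: b)); try lin.
  transitivity (Sw (fun a b => lamr a *: b) L).
    by apply: eq_Sw => a b; rewrite yE.
  by rewrite (lamrP _ (@lin_id _ H)) lamr_L scale1r.
by move=> gy; rewrite -[S y]mul1r -antipode_distg -mulrA gy mulr1.
Qed.

(** Radford's formula: [laml] and [lamr] have Nakayama automorphisms S^2 and S^-2, and they differ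
    by the factor [distg]. *)
Lemma antipode4 b : b * distg = distg * SS (SS b).
Proof.
apply: laml_inj => a; rewrite mulrA -lamrE lamrM lamrE -mulrA lamlM.
by rewrite mulrA.
Qed.

End NormalizedIntegral.
End Integrals.

(** * Rank factorizations and linear relations as polynomials *)

Section LinearAlgebra.
Variable K : fieldType.

(** With A = C R a rank factorization, C (R C) R = C R, where C and R can be cancelled. *)
Lemma base_mul1 n (A : 'M[K]_n) :
  A *m A = A -> row_base A *m col_base A = 1%:M.
Proof.
move=> AA; have CR := mulmx_base A.
apply: (row_free_inj (row_base_free A)); apply: (row_full_inj (col_base_full A)).
by rewrite /= mul1mx CR mulmxA mulmxA CR -mulmxA CR.
Qed.

Lemma mxtrace_idempotent n (A : 'M[K]_n) :
  A *m A = A -> \tr A = (\rank A)%:R.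
Proof.
by move=> AA; rewrite -{1}(mulmx_base A) mxtrace_mulC base_mul1 // mxtrace1.
Qed.

Lemma mxtrace_sqr0 n (A : 'M[K]_n) : A *m A = 0 -> \tr A = 0.
Proof.
move=> AA; suff RC : row_base A *m col_base A = 0.
  by rewrite -(mulmx_base A) mxtrace_mulC RC linear0.
have CR := mulmx_base A.
apply: (row_free_inj (row_base_free A)); apply: (row_full_inj (col_base_full A)).
by rewrite /= mul0mx mulmx0 mulmxA mulmxA CR -mulmxA CR.
Qed.

(** There are more vectors than the dimension. The coefficients are packed into a polynomial because
    its roots will be counted and bounded. *)
Lemma lin_dependence (V : vectType K) (f : nat -> V) :
  exists N (Q : {poly K}),
    [/\ Q != 0, (size Q <= N)%N & \sum_(k < N) Q`_k *: f k = 0].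
Proof.
pose d := \dim {:V}.
pose A : 'M[K]_(d.+1, d) := \matrix_(k, i) coord (vbasis {:V}) i (f k).
have /rowV0Pn[v /sub_kermxP vA v0] : kermx A != 0.
  rewrite kermx_eq0 /row_free; apply/eqP => rA.
  by have := rank_leq_col A; rewrite rA ltnn.
exists d.+1, (rVpoly v); split.
- by apply: contra_neq v0 => Q0; rewrite -(rVpolyK v) Q0 linear0.
- exact: size_poly.
transitivity (\sum_(k < d.+1) v 0 k *: f k).
  by apply: eq_bigr => k _; rewrite coef_rVpoly_ord.
under eq_bigr => k _ do
  rewrite [f k](coord_vbasis (memvf _)) scaler_sumr.
rewrite exchange_big big1 // => i _ /=.
under eq_bigr => k _ do rewrite scalerA.
rewrite -scaler_suml; have /rowP/(_ i) := vA; rewrite !mxE => E.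
rewrite -[X in X *: _ = _](_ : 0 = _) ?scale0r // -[LHS]E.
by apply: eq_bigr => k _; rewrite mxE.
Qed.

Fixpoint mxexp n (A : 'M[K]_n) k : 'M[K]_n :=
  if k is k'.+1 then A *m mxexp A k' else 1%:M.

Lemma mxexpSr n (A : 'M[K]_n) k : mxexp A k.+1 = mxexp A k *m A.
Proof.
by elim: k => [|k IH] /=; rewrite ?mulmx1 ?mul1mx // -mulmxA -IH.
Qed.

Definition annihilates n (Q : {poly K}) (A : 'M[K]_n) :=
  exists2 N, (size Q <= N)%N & \sum_(k < N) Q`_k *: mxexp A k = 0.

Lemma sum_tensl I (r : seq I) m n p q (A : I -> 'M[K]_(m, n)) (B : 'M[K]_(p, q)) :
  (\sum_(i <- r) A i) *t B = \sum_(i <- r) A i *t B.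
Proof.
by rewrite (lin_sumE (f := fun X : 'M[K]_(m, n) => X *t B)) //; lin.
Qed.

Lemma sum_tensr I (r : seq I) m n p q (A : 'M[K]_(m, n)) (B : I -> 'M[K]_(p, q)) :
  A *t (\sum_(i <- r) B i) = \sum_(i <- r) A *t B i.
Proof.
by rewrite (lin_sumE (f := fun X : 'M[K]_(p, q) => A *t X)) //; lin.
Qed.

End LinearAlgebra.

(** * Triangular form and eigenvalues *)

Section Spectral.
Variable C : numClosedFieldType.

(* Schur's theorem also in dimension 0 *)
Lemma trigonalizable n (A : 'M[C]_n) :
  exists P U : 'M[C]_n,
    [/\ P \in unitmx, is_trig_mx U & A = invmx P *m U *m P].
Proof.
case: n A => [|n] A.
  exists 1%:M, A; split; rewrite ?unitmx1 //; last by rewrite invmx1 mul1mx mulmx1.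
  by apply/is_trig_mxP => -[].
have [P /unitarymx_unit Pu] := @Schur C n.+1 A isT.
rewrite /similar_to conjumx // => PA; exists P, (P *m A *m invmx P); split=> //.
by rewrite !mulmxA mulVmx // mul1mx mulmxKV.
Qed.

Lemma mxexp_conj n (P U : 'M[C]_n) k :
  P \in unitmx -> mxexp (invmx P *m U *m P) k = invmx P *m mxexp U k *m P.
Proof.
move=> Pu; elim: k => [|k IH] /=; first by rewrite mulmx1 mulVmx.
by rewrite IH !mulmxA mulmxK.
Qed.

Lemma trig_mul n (A B : 'M[C]_n) :
  is_trig_mx A -> is_trig_mx B ->
  is_trig_mx (A *m B) /\ forall i, (A *m B) i i = A i i * B i i.
Proof.
move=> /is_trig_mxP tA /is_trig_mxP tB; split.
  apply/is_trig_mxP => i j ij; rewrite mxE big1 // => k _.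
  have [ik|ki] := ltnP i k; first by rewrite tA ?mul0r.
  by rewrite tB ?mulr0 // (leq_ltn_trans ki).
move=> i; rewrite mxE (bigD1 i) //= big1 ?addr0 // => k ki.
have [ik|ki'] := ltnP i k; first by rewrite tA ?mul0r.
by rewrite tB ?mulr0 // ltn_neqAle ki' andbT.
Qed.

Lemma trig_exp n (U : 'M[C]_n) k :
  is_trig_mx U -> is_trig_mx (mxexp U k) /\
  forall i, mxexp U k i i = U i i ^+ k.
Proof.
move=> tU; elim: k => [|k [IH1 IH2]] /=.
  by split=> [|i]; rewrite ?scalar_mx_is_trig // mxE eqxx.
by have [tM dM] := trig_mul tU IH1; split=> // i; rewrite dM IH2 exprS.
Qed.

(** U - U_ii is triangular with a zero on its diagonal, hence singular. *)
Lemma trig_eigenvalue n (P U : 'M[C]_n) i :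
  P \in unitmx -> is_trig_mx U ->
  exists2 v : 'cV[C]_n, v != 0 & (invmx P *m U *m P) *m v = U i i *: v.
Proof.
move=> Pu tU; pose B := U - (U i i)%:M.
have dB : \det B^T = 0.
  rewrite det_tr det_trig.
    by rewrite (bigD1 i) //= !mxE eqxx mulr1n subrr mul0r.
  apply/is_trig_mxP => k l kl; have /is_trig_mxP tU' := tU.
  by rewrite !mxE tU' // -val_eqE ltn_eqF // subrr.
have : ~~ row_free B^T by rewrite row_free_unit unitmxE dB unitr0.
rewrite -kermx_eq0 => /rowV0Pn[w /sub_kermxP wB w0].
have Bw : B *m w^T = 0 by rewrite -[B]trmxK -trmx_mul wB trmx0.
exists (invmx P *m w^T).
  apply: contra_neq w0 => E; apply: trmx_inj; rewrite trmx0.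
  by rewrite -[w^T]mul1mx -(mulmxV Pu) -mulmxA E mulmx0.
rewrite -!mulmxA mulKVmx // scalemxAr; congr (_ *m _).
by apply/eqP; rewrite -subr_eq0 -mul_scalar_mx -mulmxBl Bw.
Qed.

Lemma mxexp_eigen n (A : 'M[C]_n) (v : 'cV[C]_n) mu k :
  A *m v = mu *: v -> mxexp A k *m v = mu ^+ k *: v.
Proof.
move=> Av; elim: k => [|k IH] /=; first by rewrite mul1mx scale1r.
by rewrite -mulmxA IH -scalemxAr Av scalerA exprSr.
Qed.

Lemma annihilates_root n Q (A : 'M[C]_n) (v : 'cV[C]_n) mu :
  annihilates Q A -> v != 0 -> A *m v = mu *: v -> Q.[mu] = 0.
Proof.
move=> [N sQ QA] v0 Av.
have : Q.[mu] *: v = 0.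
  rewrite (horner_coef_wide _ sQ) scaler_suml -[RHS](mul0mx _ v) -QA mulmx_suml.
  by apply: eq_bigr => k _; rewrite -scalemxAl (mxexp_eigen _ Av) scalerA.
by move=> /eqP; rewrite scaler_eq0 (negPf v0) orbF => /eqP.
Qed.

End Spectral.

(** * The square of the antipode *)

Section RegularCharacter.
Variables (K : fieldType) (H : hopfAlgebra K).
Implicit Types (g h x : H).
Local Notation S := (antipode H).
Local Notation SS x := (S (S x)).

Definition regchar h : K := optr (fun y : H => h * y).

Lemma regchar_lin : linear (regchar : H -> K^o).
Proof. by apply: optr_lin => u; lin. Qed.

Lemma regcharC g h : regchar (g * h) = regchar (h * g).
Proof.
transitivity (optr (fun y : H => g * (h * y))).
  by apply: eq_optr => y; rewrite mulrA.
rewrite (optrC (f := fun y => h * y) (g := fun y => g * y)); try lin.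
by apply: eq_optr => y; rewrite mulrA.
Qed.

Lemma opmx_mul g h :
  opmx (fun y : H => g * h * y) = opmx (fun y => g * y) *m opmx (fun y : H => h * y).
Proof.
rewrite -opmx_comp; last by lin.
by apply: eq_opmx => y; rewrite mulrA.
Qed.

Lemma opmx_mul_inj x : opmx (fun y : H => x * y) = 0 -> x = 0.
Proof.
have -> : 0 = opmx (fun y : H => 0 : H).
  by apply/matrixP=> i j; rewrite !mxE linear0.
move=> E; have l0 : linear (fun _ : H => 0 : H).
  by move=> k u v; rewrite scaler0 addr0.
have xl : linear (fun y : H => x * y) by lin.
by have := opmx_inj xl l0 E 1; rewrite mulr1.
Qed.

Lemma regchar_idem x : x * x = x ->
  regchar x = (\rank (opmx (fun y : H => x * y)))%:R.
Proof.
move=> xx; rewrite /regchar /optr mxtrace_idempotent // -opmx_mul.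
by apply: eq_opmx => y; rewrite xx.
Qed.

Lemma regchar_sqr0 x : x * x = 0 -> regchar x = 0.
Proof.
move=> xx; rewrite /regchar /optr mxtrace_sqr0 // -opmx_mul xx.
by apply/matrixP=> i j; rewrite !mxE mul0r linear0.
Qed.

(** The tensor square of the regular representation is free of rank dim H. In trace form,
    regchar(h_2) h_1 x is rewritten as regchar(h_2 x_2 S(x_3)) h_1 x_1 before the loop is cut
    elsewhere. *)
Lemma Sw_regchar2 h :
  Sw (fun a b => regchar a * regchar b : K^o) h = (\dim {:H})%:R * regchar h.
Proof.
have cl := regchar_lin; have bl x : linear (fun t : H => t * x) by lin.
transitivity (optr (fun x => Sw (fun a b => regchar b *: (a * x)) h)).
  rewrite optr_Sw; apply: (@eq_Sw _ _ K^o) => a b.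
  by rewrite optrZ mulrC.
transitivity (optr (fun x => Sw (fun x1 x2 => Sw (fun c d =>
    regchar (d * S x2) *: c) (h * x1)) x)).
  apply: (@eq_optr K H) => x; symmetry.
  transitivity (Sw (fun x1 x2 => Sw (fun u v => Sw (fun a b =>
      regchar (b * (v * S x2)) *: (a * u)) h) x1) x).
    apply: eq_Sw => x1 x2; rewrite SwM; try lin.
    rewrite SwC; apply: eq_Sw => a b; apply: eq_Sw => c d.
    by rewrite mulrA.
  rewrite Sw_assoc; try lin.
  transitivity (Sw (fun u y => counit H y *: Sw (fun a b =>
      regchar b *: (a * u)) h) x).
    apply: eq_Sw => u y.
    rewrite (Sw_antir (f := fun t : H => Sw (fun a b => regchar (b * t) *: (a * u)) h));
      last by lin.
    by congr (_ *: _); apply: eq_Sw => a b; rewrite mulr1.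
  by rewrite (Sw_counitr (f := fun u => Sw (fun a b =>
      regchar b *: (a * u)) h)) //; lin.
rewrite (optr_loopl (A := fun z => h * z) (F := fun d b => regchar (d * S b)));
  try lin.
transitivity (optr (fun z => regchar 1 *: (h * z))); last first.
  rewrite optrZ; congr (_ * _); rewrite -(@optr_id K H).
  by apply: (@eq_optr K H) => y; rewrite /= mul1r.
apply: (@eq_optr K H) => z; rewrite Sw_assoc; try lin.
(* Since [regchar] is a trace, z_3 S(z_2) may be replaced by S(z_2) z_3, which collapses. *)
transitivity (Sw (fun u x => counit H x *: (regchar 1 *: (h * u))) z).
  apply: eq_Sw => u x.
  rewrite -(Sw_antil (f := fun t : H => regchar t *: (h * u))); last by lin.
  by apply: eq_Sw => a b; rewrite regcharC.
by rewrite (Sw_counitr (f := fun u : H => regchar 1 *: (h * u))) //; lin.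
Qed.

Section Integral.
Variable L : H.
Hypothesis HL : normalized_integral L.

Lemma regchar_int : regchar L = 1.
Proof.
transitivity (optr (fun y : H => (counit H y : K^o) *: L)).
  by apply: eq_optr => y; rewrite (intr HL).
rewrite (optr_rank1 (q := fun y => counit H y : K^o)) ?(int_eps HL) //.
by move=> k x y; rewrite linearP.
Qed.

(* The trace of p acting on the dual, twisted by S^2, is an integral of H. *)
Lemma optr_dual_int (p : H -> K^o) : linear p ->
  optr (fun y => Sw (fun a b => (p b : K) *: SS a) y) =
  optr (fun y : H => SS y) * p L.
Proof.
move=> pl; pose e (i : 'I_(\dim {:H})) := (vbasis {:H})`_i.
pose c i := coord (vbasis {:H}) i.
(* [l] represents the functional sending q to the left trace. It satisfies l h = eps(h) l, so l = l
   L = eps(l) L. *)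
pose l : H := \sum_i @Sw K H H (fun a b => c i (SS a) *: b) (e i).
have lE (q : H -> K^o) : linear q ->
    optr (fun y => Sw (fun a b => (q b : K) *: SS a) y) = q l.
  move=> ql; pose q' : {linear H -> K^o} :=
    HB.pack q (GRing.isLinear.Build _ _ _ _ _ ql).
  rewrite -[q]/(GRing.Linear.sort q') linear_sum; apply: eq_bigr => i _.
  rewrite -[GRing.Linear.sort q' _]/(q _) mxE (Sw_linear _ _ ql) -/(c i _).
  have cl : linear (c i : H -> K^o) by move=> k u v; rewrite /c linearP.
  rewrite (Sw_linear _ _ cl); apply: (@eq_Sw _ _ K^o) => a b.
  by rewrite (linZ _ _ cl) (linZ _ _ ql) [LHS]mulrC.
have lint h : l * h = counit H h *: l.
  apply: coord_eq => q ql; rewrite (linZ _ _ ql).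
  rewrite -(lE (fun t => q (t * h))); last by lin.
  rewrite -lE //.
  pose A g z : H := Sw (fun a b => (q b : K) *: (SS a * S g)) z.
  transitivity (optr (fun y : H => Sw (fun h1 h2 => A h1 (y * h2)) h)).
    apply: (@eq_optr K H) => y; symmetry; rewrite /A.
    transitivity (Sw (fun h1 h2 => Sw (fun u v => Sw (fun a b =>
        (q (b * v) : K) *: (SS a * S (h1 * S u))) y) h2) h).
      apply: eq_Sw => h1 h2; rewrite SwM; try lin.
      rewrite SwC; apply: eq_Sw => u v; apply: eq_Sw => a b.
      by rewrite !antipodeM mulrA.
    rewrite -Sw_assoc; try lin.
    transitivity (Sw (fun x v => counit H x *: Sw (fun a b =>
        (q (b * v) : K) *: SS a) y) h).
      apply: eq_Sw => x v.
      rewrite (Sw_antir (f := fun t : H => Sw (fun a b =>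
        (q (b * v) : K) *: (SS a * S t)) y)); last by lin.
      by congr (_ *: _); apply: eq_Sw => a b; rewrite antipode1 mulr1.
    by rewrite (Sw_counitl (f := fun v => Sw (fun a b =>
        (q (b * v) : K) *: SS a) y)) //; lin.
  transitivity (optr (fun y : H => counit H h *: A 1 y)); last first.
    rewrite optrZ; congr (_ * _); apply: (@eq_optr K H) => y; rewrite /A.
    by apply: eq_Sw => a b; rewrite antipode1 mulr1.
  rewrite optr_Sw.
  transitivity (Sw (fun h1 h2 => optr (fun y => A h1 y * h2) : K^o) h).
    apply: (@eq_Sw _ _ K^o) => h1 h2.
    by rewrite (optrC (f := fun y => y * h2) (g := A h1)) // /A; lin.
  rewrite -optr_Sw; apply: (@eq_optr K H) => y; rewrite /A.
  transitivity (Sw (fun h1 h2 => Sw (fun a b =>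
     (q b : K) *: (SS a * (S h1 * h2))) y) h).
    apply: eq_Sw => h1 h2; rewrite (Sw_linear (L := fun t : H => t * h2));
      last by lin.
    by apply: eq_Sw => a b; rewrite -scalerAl mulrA.
  rewrite (Sw_antil (f := fun t : H => Sw (fun a b =>
     (q b : K) *: (SS a * t)) y)); last by lin.
  by congr (_ *: _); apply: eq_Sw => a b; rewrite antipode1.
have el : linear (counit H : H -> K^o) := lin_scalar _ (@lin_id _ H).
have -> : optr (fun y : H => SS y) = counit H l.
  rewrite -(lE _ el); apply: (@eq_optr K H) => y.
  by rewrite (Sw_counitr (f := fun a => SS a)) //; lin.
rewrite lE // -[l]scale1r -(int_eps HL) -lint (intl HL) (linZ _ _ pl).
by rewrite linearZ /= (int_eps HL) mulr1.
Qed.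

End Integral.
End RegularCharacter.

(** * Minimal left ideals and the blocks of a semisimple algebra *)

Section Blocks.
Variables (C : numClosedFieldType) (H : hopfAlgebra C).
Hypothesis Hss : semisimple H.
Implicit Types (g h x y z v w : H) (U V I J : {vspace H}).

Local Notation chi := (@regchar C H).
Let chi_lin : linear (chi : H -> C^o) := @regchar_lin C H.

Lemma left_idealM I h v : left_ideal I -> v \in I -> h * v \in I.
Proof. by move=> lI vI; apply: (subvP lI); rewrite memv_mul ?memvf. Qed.

Lemma left_ideal_mulr x : left_ideal (amulr x @: fullv)%VS.
Proof.
apply/prodvP => h v _ /memv_imgP[y _ ->].
by apply/memv_imgP; exists (h * y); rewrite ?memvf // !lfunE /= mulrA.
Qed.

(** By semisimplicity H x is generated by an idempotent j. Its regular trace is the rank of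
    multiplication by j, and it vanishes by assumption; so j = 0 and H x = 0. *)
Lemma regchar_nondeg x : (forall h, regchar (h * x) = 0) -> x = 0.
Proof.
move=> x0; have lI := left_ideal_mulr x.
set I := (amulr x @: fullv)%VS in lI.
have [J [lJ IJ IJ0]] := Hss lI.
have memI y : y * x \in I.
  by apply/memv_imgP; exists y; rewrite ?memvf // !lfunE.
have capI y : y \in I -> y \in J -> y = 0.
  by move=> yI yJ; apply/eqP; rewrite -memv0 -IJ0 memv_cap yI.
have : 1 \in (I + J)%VS by rewrite IJ memvf.
move=> /memv_addP[j jI [k kJ jk]].
have jj : j * j = j.
  have : j * k = 0.
    apply: capI; last exact: left_idealM lJ kJ.
    have -> : j * k = j - j * j by rewrite -{2}[j]mulr1 jk mulrDr addrAC subrr add0r.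
    by rewrite memvB // left_idealM.
  by move=> jk0; rewrite -[RHS]mulr1 jk mulrDr jk0 addr0.
have j0 : j = 0.
  apply: opmx_mul_inj; apply/eqP; rewrite -mxrank_eq0 -(pnatr_eq0 C).
  rewrite -regchar_idem //; case/memv_imgP: (jI) => y _ ->.
  by rewrite lfunE /= x0.
rewrite j0 add0r in jk; apply: capI; first by rewrite -[x]mul1r.
by rewrite -[x]mulr1 jk left_idealM.
Qed.

Lemma ex_minimal_left_ideal I : left_ideal I -> I != 0%VS ->
  exists V, [/\ left_ideal V, (V <= I)%VS, V != 0%VS &
    forall U, left_ideal U -> (U <= V)%VS -> U != 0%VS -> U = V].
Proof.
have [n] := ubnP (\dim I); elim: n I => // n IH I dI lI I0.
have [[U [lU UI U0 nUI]]|min] := boolp.EM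
  (exists U, [/\ left_ideal U, (U <= I)%VS, U != 0%VS & U != I]).
  have dU : (\dim U < n)%N.
    apply: leq_trans (_ : \dim I <= n)%N => //.
    rewrite ltn_neqAle dimvS // andbT; apply: contra_neq nUI => dUI.
    by apply/eqP; rewrite eqEdim UI dUI /=.
  have [V [lV VU V0 minV]] := IH U dU lU U0.
  by exists V; split=> //; apply: subv_trans UI.
exists I; split=> // U lU UI U0; apply/eqP; apply/negP => /negP nUI.
by apply: min; exists U.
Qed.

Section Minimal.
Variable V : {vspace H}.
Hypotheses (lV : left_ideal V) (V0 : V != 0%VS).
Hypothesis minV :
  forall U, left_ideal U -> (U <= V)%VS -> U != 0%VS -> U = V.

Let d := \dim V.
Let v_ (i : 'I_d) : H := (vbasis V)`_i.

Let vV i : v_ i \in V.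
Proof. by apply: vbasis_mem; rewrite mem_nth // size_tuple. Qed.

Let d_gt0 : (0 < d)%N.
Proof. by rewrite lt0n dimv_eq0. Qed.

(** Schur's lemma: right multiplication by [w] is a module endomorphism of V, and its eigenspace [U]
    is a nonzero left ideal inside V. *)
Lemma schur_mulr w :
  (forall v, v \in V -> v * w \in V) ->
  exists c : C, forall v, v \in V -> v * w = c *: v.
Proof.
move=> Vw; pose A : 'M[C]_d := \matrix_(i, j) coord (vbasis V) j (v_ i * w).
have [c /eigenvalueP[u uA u0]] := eigenvalue_closed A d_gt0.
exists c; pose U := (V :&: lker (amulr w - c *: \1%VF))%VS.
have memU v : (v \in U) = (v \in V) && (v * w == c *: v).
  rewrite memv_cap memv_ker; congr (_ && _).
  by rewrite add_lfunE opp_lfunE scale_lfunE id_lfunE lfunE subr_eq0.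
suff UV : U = V by move=> v; rewrite -{1}UV memU => /andP[_ /eqP].
apply: minV; last 2 first.
- by apply/subvP => v; rewrite memU => /andP[].
- have uv : \sum_i u 0 i *: v_ i \in U.
    rewrite memU; apply/andP; split.
      by apply: memv_suml => i _; rewrite memvZ.
    apply/eqP; rewrite mulr_suml scaler_sumr.
    transitivity (\sum_j (u *m A) 0 j *: v_ j); last first.
      by apply: eq_bigr => j _; rewrite uA mxE scalerA.
    under [RHS]eq_bigr => j _ do rewrite mxE scaler_suml.
    rewrite exchange_big; apply: eq_bigr => i _ /=.
    rewrite -scalerAl {1}(coord_vbasis (Vw _ (vV i))) scaler_sumr.
    by apply: eq_bigr => j _; rewrite mxE scalerA.
  apply: contraNneq u0 => U0; move: uv; rewrite U0 memv0 => /eqP E.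
  apply/eqP/rowP => i; rewrite mxE.
  have := congr1 (coord (vbasis V) i) E; rewrite linear0 => <-.
  by rewrite coord_sum_free // (basis_free (vbasisP V)).
apply/prodvP => h v _; rewrite !memU => /andP[vV' /eqP vw].
by rewrite left_idealM //= -mulrA vw scalerAr.
Qed.

Lemma ex_dual_basis : exists y_ : 'I_d -> H,
  forall i j, chi (v_ i * y_ j) = (i == j)%:R.
Proof.
pose M : 'M[C]_(d, \dim {:H}) := \matrix_(i, k) chi (v_ i * (vbasis {:H})`_k).
have Mfree : row_free M.
  apply: inj_row_free => u uM; pose x := \sum_i u 0 i *: v_ i.
  have x0 : x = 0.
    apply: regchar_nondeg => h; rewrite regcharC.
    rewrite (coord_vbasis (memvf h)) mulr_sumr.
    rewrite (lin_sumE _ _ _ chi_lin) big1 // => k _.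
    rewrite -scalerAr (linZ _ _ chi_lin) /x mulr_suml (lin_sumE _ _ _ chi_lin).
    have /rowP/(_ k) := uM; rewrite !mxE => E.
    rewrite -[RHS](scaler0 _ (coord (vbasis {:H}) k h)) -[in RHS]E.
    congr (_ *: _); apply: eq_bigr => i _.
    by rewrite -scalerAl (linZ _ _ chi_lin) mxE.
  apply/rowP => i; rewrite mxE.
  have := congr1 (coord (vbasis V) i) x0; rewrite linear0 => <-.
  by rewrite coord_sum_free // (basis_free (vbasisP V)).
have [B MB] : exists B, M *m B = 1%:M by apply/row_freeP.
exists (fun j => \sum_k B k j *: (vbasis {:H})`_k) => i j.
rewrite mulr_sumr (lin_sumE _ _ _ chi_lin).
have /matrixP/(_ i j) := MB; rewrite !mxE => <-; apply: eq_bigr => k _.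
by rewrite -scalerAr (linZ _ _ chi_lin) mxE [LHS]mulrC.
Qed.

(** The elements c^-1 v_i y_j are matrix units of the block of V, with c the inverse of dim V, and E
    is its unit. On a full matrix algebra h -> a h b has trace tr(a) tr(b), and c chi(E -) is the
    matrix trace. *)
Lemma minimal_block (y_ : 'I_d -> H) :
  (forall i j, chi (v_ i * y_ j) = (i == j)%:R) ->
  exists (c : C) (E : H),
    [/\ [/\ E * E = E, E != 0 & forall h, h * E = E * h],
        forall v, v \in V -> E * v = v,
        forall x, x * E = 0 <-> (forall v, v \in V -> x * v = 0),
        forall a b, optr (fun h => E * (a * h * b)) =
                    c ^+ 2 * chi (E * a) * chi (E * b) &
        forall z, (forall h, z * h = h * z) -> exists k : C, z * E = k *: E].
Proof.
move=> vy; pose i0 := Ordinal d_gt0.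
have chil := chi_lin.
have chiM x y : chi (x * y) = chi (y * x) := regcharC x y.
have vexp v : v \in V -> v = \sum_k chi (v * y_ k) *: v_ k.
  move=> vV'; rewrite {1}(coord_vbasis vV'); apply: eq_bigr => k _.
  congr (_ *: _); rewrite {2}(coord_vbasis vV') mulr_suml (lin_sumE _ _ _ chil).
  rewrite (bigD1 k) //= big1 => [|i ik].
    by rewrite addr0 -scalerAl (linZ _ _ chil) vy eqxx [_ *: _]mulr1.
  by rewrite -scalerAl (linZ _ _ chil) vy (negPf ik) scaler0.
have yexp v y : v \in V -> v * y = \sum_k chi (v_ k * y) *: (v * y_ k).
  move=> vV'; apply/eqP; rewrite -subr_eq0; apply/eqP.
  pose w := y - \sum_k chi (v_ k * y) *: y_ k.
  have vw : v * y - \sum_k chi (v_ k * y) *: (v * y_ k) = v * w.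
    rewrite mulrBr mulr_sumr; congr (_ - _); apply: eq_bigr => k _.
    by rewrite scalerAr.
  rewrite vw; apply: regchar_nondeg => h; rewrite mulrA.
  have : h * v \in V by apply: left_idealM.
  move: (h * v) => u uV; rewrite (vexp _ uV) mulr_suml (lin_sumE _ _ _ chil).
  apply: big1 => k _; rewrite -scalerAl (linZ _ _ chil) /w mulrBr (linB _ _ chil).
  rewrite mulr_sumr (lin_sumE _ _ _ chil) (bigD1 k) //= big1 => [|i ik].
    by rewrite -scalerAr (linZ _ _ chil) vy eqxx addr0 [_ *: 1]mulr1 subrr scaler0.
  by rewrite -scalerAr (linZ _ _ chil) vy eq_sym (negPf ik) scaler0.
have actV j x k v : v \in V -> v * (y_ j * x * v_ k) \in V.
  by move=> _; rewrite mulrA left_idealM.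
(* The inserted factor 1 makes y_i0 v_i0 an instance of [actV]; the scalar [c] is the one by which
   it acts on V from the right. *)
have [c cE] := schur_mulr (w := y_ i0 * v_ i0) (fun v vV' =>
  eq_ind _ (fun t => v * (t * _) \in V) (actV i0 1 i0 v vV') _ (mulr1 _)).
have vyv j x k v : v \in V ->
    v * (y_ j * x * v_ k) = (c * chi (x * v_ k * y_ j)) *: v.
  move=> vV'; have [c1 c1E] := schur_mulr (actV j x k).
  rewrite c1E //; congr (_ *: _).
  (* chi(v_i0 y_i0) = 1, so chi reads off the Schur scalar. *)
  have : chi (c1 *: (v_ i0 * y_ i0)) = c1.
    by rewrite (linZ _ _ chil) vy eqxx [_ *: _]mulr1.
  rewrite scalerAl -c1E // => <-.
  transitivity (chi (y_ j * x * (v_ k * (y_ i0 * v_ i0)))).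
    by rewrite -(mulrA (v_ i0)) [LHS]chiM !mulrA.
  rewrite cE // -scalerAr (linZ _ _ chil); apply: (congr1 ( *%R c)).
  by rewrite [RHS]chiM mulrA.
have vyv1 j k v : v \in V -> v * (y_ j * v_ k) = (c * (j == k)%:R) *: v.
  by move=> vV'; rewrite -[y_ j]mulr1 vyv // mul1r vy eq_sym.
have c0 : c != 0.
  apply/eqP => c0; have := vy i0 i0; rewrite eqxx regchar_sqr0 => [/eqP|].
    by rewrite eq_sym oner_eq0.
  by rewrite -mulrA [y_ i0 * _]mulrA [v_ i0 * _]mulrA vyv1 // c0 mul0r scale0r mul0r.
pose E := c^-1 *: \sum_i v_ i * y_ i.
have Ev v : v \in V -> E * v = v.
  move=> vV'; rewrite {2}(vexp _ vV') {1}(vexp _ vV') /E -scalerAl mulr_sumr.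
  rewrite scaler_sumr; apply: eq_bigr => k _; rewrite -scalerAr mulr_suml.
  rewrite (bigD1 k) //= big1 => [|i ik].
    by rewrite -mulrA vyv1 // eqxx mulr1 addr0 !scalerA -mulrA mulrCA
      mulVf // mulr1.
  by rewrite -mulrA vyv1 // (negPf ik) mulr0 scale0r.
have EE : E * E = E.
  rewrite {2 3}/E -scalerAr mulr_sumr; congr (_ *: _); apply: eq_bigr => i _.
  by rewrite mulrA Ev.
have Ec h : h * E = E * h.
  rewrite /E -scalerAl -scalerAr; congr (_ *: _); rewrite mulr_sumr mulr_suml.
  transitivity (\sum_i \sum_k chi (h * v_ i * y_ k) *: (v_ k * y_ i)).
    apply: eq_bigr => i _; rewrite mulrA {1}(vexp (h * v_ i)) ?left_idealM //.
    by rewrite mulr_suml; apply: eq_bigr => k _; rewrite scalerAl.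
  rewrite exchange_big; apply: eq_bigr => i _ /=.
  rewrite -mulrA [RHS](yexp _ _ (vV i)); apply: eq_bigr => k _.
  by rewrite -mulrA [in LHS]chiM !mulrA.
have chiE x : chi (E * x) = c^-1 * \sum_i chi (x * v_ i * y_ i).
  rewrite chiM /E -scalerAr (linZ _ _ chil); congr (_ * _).
  rewrite mulr_sumr (lin_sumE _ _ _ chil); apply: eq_bigr => i _.
  by rewrite mulrA.
exists c, E; split; first split=> //.
- apply/eqP => E0; have := vy i0 i0; rewrite eqxx -(Ev _ (vV i0)) E0 !mul0r.
  rewrite (_ : chi 0 = 0) => [/eqP|]; first by rewrite eq_sym oner_eq0.
  by rewrite -(scale0r 0) (linZ _ _ chil) scale0r.
- by [].
- move=> x; split=> [xE v vV'|xv]; first by rewrite -(Ev _ vV') mulrA xE mul0r.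
  rewrite /E -scalerAr mulr_sumr big1 ?scaler0 // => i _.
  by rewrite mulrA xv ?mul0r.
- move=> a b.
  transitivity (optr (fun h => \sum_i \sum_k
      (c^-1 * chi (v_ k * y_ i * (a * h * b))) *: (v_ i * y_ k))).
    apply: eq_optr => h; rewrite {1}/E -scalerAl mulr_suml scaler_sumr.
    apply: eq_bigr => i _; rewrite -(mulrA (v_ i)) (yexp _ _ (vV i)) scaler_sumr.
    by apply: eq_bigr => k _; rewrite scalerA mulrA.
  rewrite optr_sum.
  transitivity (\sum_i \sum_k c^-1 * chi (v_ k * y_ i * (a * (v_ i * y_ k) * b))).
    apply: eq_bigr => i _; rewrite optr_sum; apply: eq_bigr => k _.
    rewrite (optr_rank1 (q := fun h => c^-1 * chi (v_ k * y_ i * (a * h * b)) : C^o)) //.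
    apply: (lin_scale c^-1 (g := fun h => chi (v_ k * y_ i * (a * h * b)) : C^o)).
    by lin.
  transitivity ((\sum_i chi (a * v_ i * y_ i)) * (\sum_k chi (b * v_ k * y_ k))).
    rewrite mulr_suml; apply: eq_bigr => i _; rewrite mulr_sumr.
    apply: eq_bigr => k _.
    transitivity (c^-1 * chi (v_ k * (y_ i * a * v_ i) * (y_ k * b))).
      by rewrite !mulrA.
    rewrite vyv // -scalerAl (linZ _ _ chil).
    transitivity
      (c^-1 * (c * chi (a * v_ i * y_ i) * chi (v_ k * (y_ k * b)))) => //.
    by rewrite -(mulrA c) mulKf // [X in _ * X]chiM -(mulrA (y_ k)) [X in _ * X]chiM.
  by rewrite !chiE expr2; field.
move=> z zc; have [k kE] : exists k : C, forall v, v \in V -> v * z = k *: v.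
  by apply: schur_mulr => v vV'; rewrite -zc left_idealM.
exists k; rewrite /E -scalerAr scalerA mulrC -scalerA; congr (_ *: _).
rewrite mulr_sumr scaler_sumr; apply: eq_bigr => i _.
by rewrite mulrA zc kE // scalerAl.
Qed.

End Minimal.

Lemma ex_block e : (forall h, h * e = e * h) -> e * e = e -> e != 0 ->
  exists (c : C) (E : H),
    [/\ [/\ E * E = E, E != 0 & forall h, h * E = E * h],
        e * E = E,
        forall a b, optr (fun h => E * (a * h * b)) =
                    c ^+ 2 * chi (E * a) * chi (E * b) &
        forall z, (forall h, z * h = h * z) -> exists k : C, z * E = k *: E].
Proof.
move=> ec ee e0; have lI := left_ideal_mulr e.
have I0 : (amulr e @: fullv)%VS != 0%VS.
  apply: contraNneq e0 => I0; rewrite -memv0 -I0.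
  by apply/memv_imgP; exists 1; rewrite ?memvf // lfunE /= mul1r.
have [V [lV VI V0 minV]] := ex_minimal_left_ideal lI I0.
have [y_ vy] := ex_dual_basis V.
have [c [E [[EE E0 Ec] Ev E_eq0 Etr Ez]]] := minimal_block lV V0 minV vy.
exists c, E; split=> //; apply/eqP; rewrite -subr_eq0 -{2}[E]mul1r -mulrBl.
apply/eqP/E_eq0 => v /(subvP VI) /memv_imgP[x _ ->].
by rewrite lfunE /= mulrBl mul1r mulrA -ec -mulrA ee subrr.
Qed.

End Blocks.

(** * The theorem of Larson and Radford *)

Section LarsonRadford.
Variables (C : numClosedFieldType) (H : hopfAlgebra C) (L : H).
Hypotheses (Hss : semisimple H) (HL : normalized_integral L).
Implicit Types (g h x y z v w : H).
Local Notation S := (antipode H).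
Local Notation SS x := (S (S x)).
Local Notation chi := (@regchar C H).
Local Notation G := (distg L).
Local Notation n := (\dim {:H}).

(** Write chi = laml(- t). As chi is a trace and [laml] is a trace twisted by S^2, t S^2(a) = a t;
    nondegeneracy of chi makes t invertible. *)
Lemma antipode2_inner : exists t t' : H,
  [/\ t * t' = 1, t' * t = 1 & forall a, SS a = t' * a * t].
Proof.
have ll : linear (@laml C H : H -> C^o) := @laml_lin C H.
have [t tE] := laml_repr HL (@regchar_lin C H).
have t_inj x : x * t = 0 -> x = 0.
  move=> xt; apply: (regchar_nondeg Hss) => h.
  by rewrite tE -mulrA xt mulr0 -(scale0r 0) (linZ _ _ ll) scale0r.
have tS a : t * SS a = a * t.
  apply: (laml_inj HL) => h; rewrite mulrA -lamlM mulrA -tE regcharC tE.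
  by rewrite mulrA.
have [t' tt'] : exists t', t' * t = 1.
  have ker0 : lker (amulr t) == 0%VS.
    apply/eqP/vspaceP => x; rewrite memv_ker lfunE memv0 /=.
    by apply/eqP/eqP => [/t_inj|->]; rewrite ?mul0r.
  have := memvf (1 : H); rewrite -(lker0_limgf ker0) => /memv_imgP[x _ E].
  by exists x; rewrite E lfunE.
exists t, t'; split=> // [|a].
  by apply/eqP; rewrite -subr_eq0; apply/eqP/t_inj; rewrite mulrBl -mulrA tt' mulr1 mul1r subrr.
by rewrite -mulrA -tS mulrA tt' mul1r.
Qed.

Lemma Sw_distgX (W : vectType C) (F : H -> H -> W) k :
  (forall b, linear (fun a => F a b)) ->
  (forall a, linear (fun b => F a b)) ->
  Sw F (G ^+ k) = F (G ^+ k) (G ^+ k).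
Proof.
elim: k F => [|k IH] F F1 F2; first by rewrite !expr0 Sw1.
rewrite !exprS SwM // (Sw_distg HL); try lin.
by rewrite IH; try lin.
Qed.

(* Powers of a group-like element stay in the span of its first powers, also
   when acting on tensor powers: all powers of mu are roots of one polynomial. *)
Lemma distg_eigen_norm x mu : x != 0 -> G * x = mu *: x -> `|mu| = 1.
Proof.
move=> x0 Gx; have [i xi] : exists i, coord (vbasis {:H}) i x != 0.
  apply/existsP; apply: contraNT x0 => /existsPn xE.
  rewrite (coord_vbasis (memvf x)) big1 // => i _.
  by have /negbNE/eqP-> := xE i; rewrite scale0r.
have Gkx k : G ^+ k * x = mu ^+ k *: x.
  elim: k => [|k IH]; first by rewrite !expr0 mul1r scale1r.
  by rewrite exprS -mulrA IH -scalerAr Gx scalerA -exprSr.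
(* Convolution powers of functionals multiply their values at the group-like elements G^k. *)
have phiE m : exists2 phi : H -> C^o,
    linear phi & forall k, phi (G ^+ k) = (mu ^+ m) ^+ k.
  elim: m => [|m [phi pl phiE]].
    exists (counit H : H -> C^o) => [|k]; first exact: (lin_scalar _ (@lin_id _ H)).
    rewrite expr0 expr1n; elim: k => [|k IH]; first by rewrite expr0 counit1.
    by rewrite exprS counitM IH (eps_distg HL) mulr1.
  pose psi h : C^o :=
    (coord (vbasis {:H}) i x)^-1 *: (coord (vbasis {:H}) i (h * x) : C^o).
  have psil : linear psi by rewrite /psi; lin.
  have psiE k : psi (G ^+ k) = mu ^+ k.
    by rewrite /psi Gkx linearZ -[LHS]/(_ * (_ * _)) mulrCA mulVf // mulr1.
  exists (Sw (fun a b => (phi a : C) *: psi b)) => [|k]; first exact: Sw_lin.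
  rewrite Sw_distgX; try lin.
  by rewrite phiE psiE -[LHS]/(_ * _) -exprMn -exprSr.
have [N [Q [Q0 sQ QG]]] := lin_dependence (fun k => G ^+ k : H).
have Qroot m : root Q (mu ^+ m).
  have [phi pl phiE'] := phiE m; apply/eqP; rewrite (horner_coef_wide _ sQ).
  have phi0 : phi 0 = 0 by rewrite -(scale0r 0) (linZ _ _ pl) scale0r.
  rewrite -[RHS]phi0 -QG (lin_sumE _ _ _ pl); apply: eq_bigr => k _.
  by rewrite (linZ _ _ pl) phiE'.
(* [Q] has fewer than [size Q] roots, so two of these powers of [mu] coincide. *)
have /(uniqPn 0)[k [l [kl]]] : ~~ uniq (mkseq (fun m => mu ^+ m) (size Q)).
  apply: contraTN isT => U; have : all (root Q) (mkseq (fun m => mu ^+ m) (size Q)).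
    by apply/allP => _ /mapP[m _ ->].
  by move/(max_poly_roots Q0)/(_ U); rewrite size_mkseq ltnn.
rewrite size_mkseq => lQ; rewrite !nth_mkseq ?(ltn_trans kl) // => mukl.
have mu0 : mu != 0.
  apply: contraNneq x0 => mu0; rewrite -[x]mul1r -(antipode_distg HL) -mulrA Gx.
  by rewrite mu0 scale0r mulr0.
have /(congr1 Num.norm) : mu ^+ (l - k) = 1.
  by rewrite expfB // -mukl divff // expf_neq0.
rewrite normrX normr1 => /eqP; rewrite pexpr_eq1 ?subn_gt0 //.
by move/eqP.
Qed.

Lemma block_trace_ge0 (c : C) (E : H) :
  E * E = E -> E != 0 -> (forall h, h * E = E * h) ->
  (forall a b, optr (fun h => E * (a * h * b)) = c ^+ 2 * chi (E * a) * chi (E * b)) ->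
  (forall z, (forall h, z * h = h * z) -> exists k : C, z * E = k *: E) ->
  0 <= optr (fun h : H => E * SS h).
Proof.
move=> EE E0 Ec Etr Ez; have [t [t' [tt' t't SSE]]] := antipode2_inner.
have chil : linear (chi : H -> C^o) := @regchar_lin C H.
have -> : optr (fun h : H => E * SS h) = c ^+ 2 * chi (E * t') * chi (E * t).
  by rewrite -Etr; apply: eq_optr => h; rewrite SSE.
(* With a = b = 1 the trace formula reads chi(E) = c^2 chi(E)^2, where chi(E) > 0. *)
have c2 : 0 <= c ^+ 2.
  have chiE : 0 < chi E.
    by rewrite regchar_idem // ltr0n lt0n mxrank_eq0; apply: contra_neq E0 => /opmx_mul_inj.
  have : chi E = c ^+ 2 * chi E * chi E.
    rewrite -[in RHS](mulr1 E) -Etr; apply: eq_optr => h.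
    by rewrite mul1r mulr1.
  rewrite -{1}[chi E]mul1r => /(mulIf (lt0r_neq0 chiE)) E1.
  by rewrite -(pmulr_lge0 _ chiE) -E1 ler01.
rewrite -mulrA mulr_ge0 // {c Etr c2}.
(* z = G t^-2 is central by Radford's formula, hence a scalar k on the block; so G = k t^2 there. *)
have [z zE'] : exists z, z = G * t' * t' by exists (G * t' * t').
have tt'K x : x * t * t' = x by rewrite -mulrA tt' mulr1.
have t'tK x : x * t' * t = x by rewrite -mulrA t't mulr1.
have zc h : z * h = h * z.
  by have := antipode4 HL h; rewrite !SSE zE' !mulrA => ->; rewrite !tt'K.
have zt : z * t * t = G by rewrite zE' !t'tK.
have [k zE] := Ez z zc.
have k0 : k != 0.
  apply: contraNneq E0 => k0; rewrite k0 scale0r in zE.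
  have GE : G * E = 0 by rewrite -zt Ec !mulrA -(Ec z) zE !mul0r.
  by rewrite -[E]mul1r -(antipode_distg HL) -mulrA GE mulr0.
(* With tau^2 = k, the element [u] is a square root of [G] on the block. *)
pose tau := sqrtC k.
have tau2 : tau * tau = k by rewrite -expr2 sqrtCK.
have tau0 : tau != 0 by rewrite sqrtC_eq0.
pose u := tau *: t; pose u' := tau^-1 *: t'.
have uu' : u * u' = 1 by rewrite /u /u' -scalerAl -scalerAr scalerA mulfV // scale1r.
have u'u : u' * u = 1 by rewrite /u /u' -scalerAl -scalerAr scalerA mulVf // scale1r.
have -> : chi (E * t') * chi (E * t) = chi (E * u') * chi (E * u).
  rewrite /u /u' -!scalerAr !(linZ _ _ chil).
  by rewrite -[X in _ = X]/(_ * chi (E * t') * (_ * chi (E * t))) mulrACA mulVf // mul1r.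
have [F FE] : exists F, F = 1 - E by exists (1 - E).
have EF : E * F = 0 by rewrite FE mulrBr mulr1 EE subrr.
have F0E : F * E = 0 by rewrite FE mulrBl mul1r EE subrr.
have FF : F * F = F by rewrite {2}FE mulrBr mulr1 F0E subr0.
(* [X w] acts as [w] on the block and as 1 on its complement, so that [X u] is invertible on all of
   H. *)
pose X w := E * w + F.
have XM w w' : X w * X w' = X (w * w').
  have e1 : E * w * (E * w') = E * (w * w').
    by rewrite !mulrA -(mulrA E w E) Ec !mulrA EE.
  have e2 : E * w * F = 0 by rewrite -(Ec w) -mulrA EF mulr0.
  have e3 : F * (E * w') = 0 by rewrite mulrA F0E mul0r.
  by rewrite /X mulrDl !mulrDr FF e1 e2 e3 addr0 add0r.
have X1 : X 1 = 1 by rewrite /X FE mulr1 addrC subrK.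
pose A w := opmx (fun h : H => X w * h).
have AM w w' : A w *m A w' = A (w * w') by rewrite /A -opmx_mul XM.
have A1 : A 1 = 1%:M.
  by rewrite /A -opmx_id; apply: eq_opmx => h; rewrite X1 mul1r.
have trA w : \tr (A w) = chi (E * w) + chi F.
  exact: (linD _ _ chil).
have AA : A u *m A u' = 1%:M by rewrite AM uu' A1.
have AA' : A u' *m A u = 1%:M by rewrite AM u'u A1.
have [P /unitarymx_unit Pu /andP[]] := cotrigonalization2 (etrans AA (esym AA')).
rewrite /similar_to !conjumx //; set U := P *m _ *m _; set U' := P *m _ *m _.
move=> tU tU'.
have AE : A u = invmx P *m U *m P by rewrite !mulmxA mulVmx // mul1mx mulmxKV.
have UU' : U *m U' = 1%:M.
  by rewrite /U /U' !mulmxA mulmxKV // -[P *m _ *m _]mulmxA AA mulmx1 mulmxV.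
have [_ UUii] := trig_mul tU tU'.
have Unorm i : `|U i i| = 1.
  have [v v0] := trig_eigenvalue i Pu tU; rewrite -AE => Av.
  pose x : H := \sum_j v j 0 *: (vbasis {:H})`_j.
  have x0 : x != 0.
    apply: contraNneq v0 => x0; apply/eqP/colP => j; rewrite mxE.
    have := congr1 (coord (vbasis {:H}) j) x0; rewrite linear0 => <-.
    by rewrite coord_sum_free // (basis_free (vbasisP _)).
  have Xx : X u * x = U i i *: x.
    rewrite (coord_vbasis (memvf (X u * x))) /x scaler_sumr.
    apply: eq_bigr => j _; rewrite scalerA; congr (_ *: _).
    have /colP/(_ j) := Av; rewrite !mxE => <-.
    rewrite mulr_sumr linear_sum; apply: eq_bigr => l _.
    by rewrite -scalerAr linearZ mxE [LHS]mulrC.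
  have [Ex0|Ex0] := eqVneq (E * x) 0.
    have : X u * x = x.
      by rewrite /X mulrDl -(Ec u) -mulrA Ex0 mulr0 add0r FE mulrBl mul1r Ex0 subr0.
    rewrite Xx => /eqP; rewrite -{2}[x]scale1r -subr_eq0 -scalerBl scaler_eq0.
    by rewrite (negPf x0) orbF subr_eq0 => /eqP->; rewrite normr1.
  have uEx : u * (E * x) = U i i *: (E * x).
    rewrite scalerAr -Xx /X [RHS]mulrA mulrDr EF addr0 [E * (E * u)]mulrA EE.
    by rewrite mulrA Ec.
  have : G * (E * x) = (U i i ^+ 2) *: (E * x).
    have tEx : t * (E * x) = (tau^-1 * U i i) *: (E * x).
      by rewrite -scalerA -uEx -scalerAl scalerA mulVf // scale1r.
    rewrite -zt -[z * t * t * _]mulrA tEx -scalerAr -[z * t * _]mulrA tEx -scalerAr.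
    rewrite [z * (E * x)]mulrA zE -scalerAl !scalerA; congr (_ *: _).
    by rewrite -tau2; field.
  move/(distg_eigen_norm Ex0)/eqP; rewrite normrX pexpr_eq1 //.
  by move/eqP.
have trP w : \tr (P *m A w *m invmx P) = \tr (A w).
  by rewrite mxtrace_mulC mulmxA mulVmx // mul1mx.
(* [A u] and [A u'] are triangularized together, so their diagonals are mutually inverse, and the
   inverse of a number of modulus 1 is its conjugate. *)
have conjtr : (\tr (A u))^* = \tr (A u').
  rewrite -!trP rmorph_sum; apply: eq_bigr => i _.
  have := UUii i; rewrite UU' mxE eqxx mulr1n => E1.
  have U0 : U i i != 0 by rewrite -normr_eq0 Unorm oner_eq0.
  by apply: (mulfI U0); rewrite -E1 -normCK Unorm expr1n.
have F_real : (chi F)^* = chi F.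
  by rewrite regchar_idem // rmorph_nat.
move: conjtr; rewrite !trA rmorphD /= F_real => /addIr <-.
by rewrite mulrC mul_conjC_ge0.
Qed.

(** Induction on the rank of e: a block E below e is split off, and e - E is a smaller central
    idempotent. *)
Lemma central_trace_ge0 (e : H) :
  (forall h, h * e = e * h) -> e * e = e -> 0 <= optr (fun h : H => e * SS h).
Proof.
pose rk (e : H) := \rank (opmx (fun y : H => e * y)).
have [m] := ubnP (rk e); elim: m e => // m IH e rke ec ee.
have chil : linear (chi : H -> C^o) := @regchar_lin C H.
have [->|e0] := eqVneq e 0.
  rewrite (eq_optr (g := fun h : H => 0 *: h)) => [|h]; last by rewrite mul0r scale0r.
  by rewrite optrZ mul0r.
have [c [E [[EE E0 Ec] eE Etr Ez]]] := ex_block Hss ec ee e0.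
have Fc h : h * (e - E) = (e - E) * h by rewrite mulrBl mulrBr ec Ec.
have FF : (e - E) * (e - E) = e - E.
  by rewrite mulrBl !mulrBr ee eE EE (ec E) eE subrr subr0.
have rkE : rk e = (rk E + rk (e - E)%R)%N.
  apply/eqP; rewrite -(eqr_nat C) natrD -!regchar_idem //.
  by rewrite -(linD _ _ chil) addrC subrK.
have rE : (0 < rk E)%N by rewrite lt0n mxrank_eq0; apply: contra_neq E0 => /opmx_mul_inj.
have ol : linear (fun e => optr (fun h : H => e * SS h) : C^o).
  by apply: optr_lin => h; lin.
have -> : optr (fun h : H => e * SS h) =
    optr (fun h : H => E * SS h) + optr (fun h : H => (e - E) * SS h).
  by rewrite -(linD _ _ ol) addrC subrK.
rewrite addr_ge0 //; first exact: (block_trace_ge0 EE E0 Ec Etr Ez).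
apply: IH => //; apply: leq_trans (_ : rk e <= m)%N; last by rewrite -ltnS.
by rewrite rkE -[X in (X < _)%N]add0n ltn_add2r.
Qed.

(** L is the central idempotent of the trivial representation and contributes laml(L) = 1; the
    complement 1 - L contributes a nonnegative amount. *)
Lemma optr_antipode2_gt0 : 0 < optr (fun h : H => SS h).
Proof.
have Lc h : h * L = L * h by rewrite (intl HL) (intr HL).
have LL : L * L = L by rewrite (intl HL) (int_eps HL) scale1r.
have ol : linear (fun e => optr (fun h : H => e * SS h) : C^o).
  by apply: optr_lin => h; lin.
rewrite (eq_optr (g := fun h : H => (L + (1 - L)) * SS h)) => [|h]; last first.
  by rewrite addrC subrK mul1r.
rewrite (linD _ _ ol) -/(laml L) (laml_L HL).
apply: lt_le_trans ltr01 _; rewrite lerDl; apply: central_trace_ge0.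
  by move=> h; rewrite mulrBr mulrBl mul1r mulr1 Lc.
by rewrite mulrBl !mulrBr !mul1r mulr1 LL subrr subr0.
Qed.

(** laml(1) = tr(S^2) is nonzero, while [lamlPr] at 1 says that laml(1) 1 = laml(1) G. *)
Lemma antipode4_id b : SS (SS b) = b.
Proof.
have ll : linear (@laml C H : H -> C^o) := @laml_lin C H.
have l1 : laml (1 : H) != 0.
  rewrite gt_eqF // (_ : laml 1 = optr (fun h : H => SS h)) ?optr_antipode2_gt0 //.
  by apply: eq_optr => h; rewrite mul1r.
have G1 : G = 1.
  have := lamlPr HL 1 (@lin_id _ H); rewrite Sw1; last by lin.
  by move/(scalerI l1).
by have := antipode4 HL b; rewrite G1 mulr1 mul1r.
Qed.

(** P = (1 - A)/2 and Q = B/m are commuting projections, and the trace condition becomes m (rank Q -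
    2 rank PQ) = m - 2 rank P. The right side is then a multiple of m that is positive and at most
    m, so rank P = 0. *)
Lemma involution_trace m (A B : 'M[C]_m) :
  A *m A = 1%:M -> B *m B = m%:R *: B -> A *m B = B *m A ->
  \tr (A *m B) = \tr A -> 0 < \tr A -> A = 1%:M.
Proof.
case: (posnP m) => [m0|m_gt0] AA BB AB trAB trA.
  by apply/matrixP => i; move: (ltn_ord i); rewrite {2}m0.
have m0 : m%:R != 0 :> C by rewrite pnatr_eq0 -lt0n.
have two0 : 2%:R != 0 :> C by rewrite pnatr_eq0.
have [P PE] : exists P, P = 2%:R^-1 *: (1%:M - A).
  by exists (2%:R^-1 *: (1%:M - A)).
have [Q QE] : exists Q, Q = m%:R^-1 *: B by exists (m%:R^-1 *: B).
have PP : P *m P = P.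
  rewrite PE -scalemxAl -scalemxAr mulmxBl !mulmxBr !mul1mx mulmx1 AA.
  rewrite opprB -mulr2n -scaler_nat !scalerA.
  by rewrite -mulrA mulVf // mulr1.
have QQ : Q *m Q = Q.
  by rewrite QE -scalemxAl -scalemxAr BB !scalerA -mulrA mulVf // mulr1.
have PQ : P *m Q = Q *m P.
  rewrite PE QE -!scalemxAl -!scalemxAr scalerA mulrC -scalerA; congr (_ *: (_ *: _)).
  by rewrite mulmxBl mulmxBr mul1mx mulmx1 AB.
have PQPQ : (P *m Q) *m (P *m Q) = P *m Q.
  by rewrite mulmxA -(mulmxA P) -PQ mulmxA PP -mulmxA QQ.
have AP : A = 1%:M - 2%:R *: P by rewrite PE scalerA mulfV // scale1r opprB addrC subrK.
have trA' : \tr A = m%:R - 2%:R * (\rank P)%:R.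
  by rewrite {1}AP linearB linearZ /= mxtrace1 mxtrace_idempotent.
have trAQ : \tr (A *m Q) = (\rank Q)%:R - 2%:R * (\rank (P *m Q))%:R.
  rewrite {1}AP mulmxBl mul1mx -scalemxAl linearB linearZ /=.
  by rewrite (mxtrace_idempotent QQ) (mxtrace_idempotent PQPQ).
have trE : m%:R * \tr (A *m Q) = \tr A.
  by rewrite QE -scalemxAr linearZ /= mulrA mulfV // mul1r trAB.
have rP : \rank P = 0%N.
  move: trE trA; rewrite trA' trAQ => trE.
  rewrite subr_gt0 -natrM ltr_nat => ltP.
  have : (m * \rank Q + 2 * \rank P = m + 2 * m * \rank (P *m Q))%N.
    apply/eqP; rewrite -(eqr_nat C) !natrD !natrM -subr_eq0; apply/eqP.
    by rewrite -[RHS](subrr (m%:R - 2%:R * (\rank P)%:R)) -{1}trE; ring.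
  have [le_q|lt_q] := leqP (\rank Q) (2 * \rank (P *m Q)).
    by have := leq_mul (leqnn m) le_q; lia.
  by have := leq_mul (leqnn m) lt_q; lia.
by rewrite AP (_ : P = 0) ?scaler0 ?subr0 //; apply/eqP; rewrite -mxrank_eq0 rP.
Qed.

(** [involution_trace] applies to S^2 and to the action [E] of the regular character: chi chi = n
    chi in the dual gives E^2 = n E, and tr(S^2 E) = tr(S^2) chi(L) with chi(L) = 1. *)
Theorem antipode_involutive : involutive S.
Proof.
have chil : linear (chi : H -> C^o) := @regchar_lin C H.
pose E y := @Sw C H H (fun a b => chi b *: a) y.
have El : linear E by exact: Sw_lin.
have SSl : linear (fun h : H => SS h) by lin.
pose A := opmx (fun h : H => SS h); pose B := opmx E.
have chiSS a : chi (SS a) = chi a.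
  by have [t [t' [tt' _ ->]]] := antipode2_inner; rewrite regcharC mulrA tt' mul1r.
have AA : A *m A = 1%:M.
  rewrite -opmx_comp // -opmx_id; apply: eq_opmx => h.
  exact: antipode4_id.
have BB : B *m B = n%:R *: B.
  rewrite -opmx_comp //; transitivity (opmx (fun h => n%:R *: E h)); last first.
    by apply/matrixP => i j; rewrite !mxE linearZ.
  apply: eq_opmx => y; rewrite {2}/E (Sw_linear _ _ El).
  transitivity (Sw (fun x b => Sw (fun c d => (chi d * chi b) *: c) x) y).
    apply: eq_Sw => x b; rewrite (linZ _ _ El) /E -Sw_scale.
    by apply: eq_Sw => c d; rewrite scalerA mulrC.
  rewrite (Sw_assoc (F := fun c d b => (chi d * chi b) *: c)).
  - rewrite /E -Sw_scale; apply: eq_Sw => c x.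
    rewrite -(Sw_linear (L := fun k : C^o => (k : C) *: c)) /=.
      by rewrite Sw_regchar2 scalerA.
    by lin.
  - by lin.
  - by move=> c d k u v; rewrite chil mulrDl -mulrA scalerDl scalerA.
  - by move=> c d k u v; rewrite chil mulrDr mulrCA scalerDl scalerA.
have AB : A *m B = B *m A.
  rewrite -!opmx_comp //; apply: eq_opmx => y; rewrite /E (Sw_linear _ _ SSl).
  rewrite Sw_SS; try lin.
  by apply: eq_Sw => a b; rewrite (linZ _ _ SSl) chiSS.
have trAB : \tr (A *m B) = \tr A.
  rewrite -opmx_comp // -[RHS]mulr1 -(regchar_int HL) -(optr_dual_int HL chil).
  by apply: (@eq_optr C H) => y; rewrite /E (Sw_linear _ _ SSl); apply: eq_Sw => a b; rewrite (linZ _ _ SSl).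
have A1 := involution_trace AA BB AB trAB optr_antipode2_gt0.
apply: (opmx_inj SSl (@lin_id _ H)).
by rewrite -[LHS]/A A1 -opmx_id.
Qed.

End LarsonRadford.

(** * Yetter-Drinfeld modules and the eigenvalues of the twist *)

Section TensorDet.
Variable C : numClosedFieldType.

(** The same permutation acts on rows and on columns, so its sign enters twice. *)
Lemma det_mxsub_bij (R : comNzRingType) m n (f : 'I_m -> 'I_n) (B : 'M[R]_n) :
  bijective f -> \det (mxsub f f B) = \det B.
Proof.
move=> bf; have mn : m = n by have := bij_eq_card bf; rewrite !card_ord.
case: _ / mn B f bf => B f /bij_inj fi.
have -> : mxsub f f B = row_perm (perm fi) (col_perm (perm fi) B).
  by apply/matrixP => i j; rewrite !mxE !permE.
rewrite row_permE col_permE !det_mulmx det_perm mulrC -mulrA det_perm odd_permV.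
by rewrite -signr_addb addbb mulr1.
Qed.

Lemma det_tens_flip I (r : seq I) m n (A : I -> 'M[C]_m) (B : I -> 'M[C]_n) :
  \det (\sum_(i <- r) A i *t B i) = \det (\sum_(i <- r) B i *t A i).
Proof.
pose f (i : 'I_(m * n)) : 'I_(n * m) :=
  mxtens_index ((mxtens_unindex i).2, (mxtens_unindex i).1).
pose g (i : 'I_(n * m)) : 'I_(m * n) :=
  mxtens_index ((mxtens_unindex i).2, (mxtens_unindex i).1).
have fE a b : f (mxtens_index (a, b)) = mxtens_index (b, a).
  by rewrite /f mxtens_indexK.
have gE a b : g (mxtens_index (a, b)) = mxtens_index (b, a).
  by rewrite /g mxtens_indexK.
rewrite -(det_mxsub_bij (f := f)); last first.
  by exists g => i; case: (mxtens_indexP i) => a b; rewrite ?(fE, gE).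
congr (\det _); apply/matrixP => i j; rewrite [RHS]mxE !summxE.
apply: eq_bigr => k _; case: (mxtens_indexP i) => a b; case: (mxtens_indexP j) => c d.
by rewrite !fE !tensmxE mulrC.
Qed.

Lemma det_tens_assoc I (r : seq I) m n p
    (A : I -> 'M[C]_m) (B : I -> 'M[C]_n) (D : I -> 'M[C]_p) :
  \det (\sum_(i <- r) A i *t (B i *t D i)) = \det (\sum_(i <- r) (A i *t B i) *t D i).
Proof.
pose f (i : 'I_(m * (n * p))) : 'I_(m * n * p) :=
  let jk := mxtens_unindex (mxtens_unindex i).2 in
  mxtens_index (mxtens_index ((mxtens_unindex i).1, jk.1), jk.2).
pose g (i : 'I_(m * n * p)) : 'I_(m * (n * p)) :=
  let jk := mxtens_unindex (mxtens_unindex i).1 in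
  mxtens_index (jk.1, mxtens_index (jk.2, (mxtens_unindex i).2)).
have fE a b c :
    f (mxtens_index (a, mxtens_index (b, c))) = mxtens_index (mxtens_index (a, b), c).
  by rewrite /f mxtens_indexK mxtens_indexK.
have gE a b c :
    g (mxtens_index (mxtens_index (a, b), c)) = mxtens_index (a, mxtens_index (b, c)).
  by rewrite /g mxtens_indexK mxtens_indexK.
rewrite -(det_mxsub_bij (f := f)); last first.
  exists g => i; case: (mxtens_indexP i) => a b.
    by case: (mxtens_indexP b) => c d; rewrite fE gE.
  by case: (mxtens_indexP a) => c d; rewrite gE fE.
congr (\det _); apply/matrixP => i j; rewrite [RHS]mxE !summxE.
apply: eq_bigr => k _; case: (mxtens_indexP i) => a b; case: (mxtens_indexP j) => a' b'.
case: (mxtens_indexP b) => c d; case: (mxtens_indexP b') => c' d'.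
by rewrite !fE !tensmxE mulrA.
Qed.

Lemma tens1mx (R : comNzRingType) m n :
  (1%:M : 'M[R]_m) *t (1%:M : 'M[R]_n) = 1%:M.
Proof.
apply/matrixP => i j; case: (mxtens_indexP i) => a b.
case: (mxtens_indexP j) => c d; rewrite tensmxE !mxE -natrM mulnb.
by rewrite (can_eq (@mxtens_indexK m n)) xpair_eqE.
Qed.

(** When both factors are triangularized, the Kronecker product is triangular for the lexicographic
    order of index pairs. *)
Lemma det_tens m n (A : 'M[C]_m) (B : 'M[C]_n) :
  \det (A *t B) = \det A ^+ n * \det B ^+ m.
Proof.
have [P [U [Pu tU ->]]] := trigonalizable A.
have [Q [V [Qu tV ->]]] := trigonalizable B.
rewrite -!tensmx_mul !det_mulmx.
have inv : \det (invmx P *t invmx Q) * \det (P *t Q) = 1.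
  by rewrite -det_mulmx tensmx_mul !mulVmx // tens1mx det1.
rewrite mulrAC inv mul1r.
have -> : \det (invmx P) * \det U * \det P = \det U.
  by rewrite mulrAC -det_mulmx mulVmx // det1 mul1r.
have -> : \det (invmx Q) * \det V * \det Q = \det V.
  by rewrite mulrAC -det_mulmx mulVmx // det1 mul1r.
have tUV : is_trig_mx (U *t V).
  have /is_trig_mxP tU' := tU; have /is_trig_mxP tV' := tV.
  apply/is_trig_mxP => i j; case: (mxtens_indexP i) => a b.
  case: (mxtens_indexP j) => c d; rewrite tensmxE /= => lt_ij.
  have [ac|] := ltnP a c; first by rewrite tU' // mul0r.
  rewrite leq_eqVlt => /orP[/eqP ca|ca].
    rewrite (tV' b d) ?mulr0 //; move: lt_ij; rewrite ca ltn_add2l //.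
  have := leq_mul ca (leqnn n); have := ltn_ord d; rewrite mulSn; lia.
rewrite !det_trig // -[X in _ * X]prodrXl -prodrXl.
rewrite (reindex (@mxtens_index m n)) /=; last first.
  by exists (@mxtens_unindex m n) => i _; rewrite ?mxtens_indexK ?mxtens_unindexK.
transitivity (\prod_(p : 'I_m * 'I_n) (U p.1 p.1 * V p.2 p.2)).
  by apply: eq_bigr => -[i j] _; rewrite tensmxE.
rewrite big_split /=; congr (_ * _).
  rewrite -(pair_bigA _ (fun i j => U i i)); apply: eq_bigr => i _ /=.
  by rewrite prodr_const card_ord.
rewrite -(pair_bigA _ (fun i j => V j j)) exchange_big; apply: eq_bigr => i _ /=.
by rewrite prodr_const card_ord.
Qed.

End TensorDet.

(** * Determinants of matrices annihilated by a fixed polynomial *)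

Section DetBounds.
Variable C : numClosedFieldType.

(** All eigenvalues are roots of [Q]; [M] bounds the modulus of each root and of its inverse, the
    inverse of 0 being 0. *)
Lemma annihilated_det_bound (Q : {poly C}) : Q != 0 ->
  exists2 M : C, 1 <= M & forall n (A : 'M[C]_n),
    A \in unitmx -> annihilates Q A ->
    `|\det A| <= M ^+ n /\ `|\det A|^-1 <= M ^+ n.
Proof.
move=> Q0; have [rs QE] := closed_field_poly_normal Q.
pose M := 1 + \sum_(z <- rs) (`|z| + `|z|^-1).
have M1 : 1 <= M.
  by rewrite lerDl sumr_ge0 // => z _; rewrite addr_ge0 ?invr_ge0.
have Mroot mu : Q.[mu] = 0 -> `|mu| <= M /\ `|mu|^-1 <= M.
  move=> /eqP Qmu; have murs : mu \in rs.
    move: Qmu; rewrite -rootE QE rootZ ?lead_coef_eq0 //.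
    by rewrite root_prod_XsubC.
  have : `|mu| + `|mu|^-1 <= M.
    rewrite /M (big_rem _ murs) /= addrCA lerDl addr_ge0 ?ler01 //.
    by apply: sumr_ge0 => z _; rewrite addr_ge0 ?invr_ge0.
  by move=> le; split; apply: le_trans le; rewrite ?lerDl ?lerDr ?invr_ge0.
exists M => // n A Au QA; have [P [U [Pu tU AE]]] := trigonalizable A.
have Uroot i : Q.[U i i] = 0.
  have [v v0] := trig_eigenvalue i Pu tU; rewrite -AE.
  exact: annihilates_root QA v0.
have -> : \det A = \prod_i U i i.
  rewrite AE !det_mulmx mulrAC -det_mulmx mulVmx // det1 mul1r.
  exact: det_trig.
rewrite normr_prod -prodfV; have -> : M ^+ n = \prod_(i < n) M.
  by rewrite prodr_const card_ord.
split; apply: ler_prod => i _; have [le1 le2] := Mroot _ (Uroot i).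
  by rewrite normr_ge0.
by rewrite invr_ge0 normr_ge0.
Qed.

Hypothesis arch : forall x : C, 0 <= x -> exists m : nat, x <= m%:R.

(** If q > 1, Bernoulli's inequality makes q^(2^m) exceed m (q - 1), and [arch] gives an m for which
    this is at least B. *)
Lemma bounded_powers_le1 (q B : C) :
  0 <= q -> 0 <= B -> (forall k, q ^+ (2 ^ k) <= B) -> q <= 1.
Proof.
move=> q0 B0 qB; rewrite real_leNgt ?ger0_real ?ler01 //; apply/negP => q1.
have q1' : 0 < q - 1 by rewrite subr_gt0.
have [m mB] := arch (divr_ge0 B0 (ltW q1')).
have bern j : 1 + j%:R * (q - 1) <= q ^+ j.
  elim: j => [|j IH]; first by rewrite mul0r addr0 expr0.
  rewrite exprS; apply: le_trans (ler_wpM2l q0 IH).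
  rewrite -subr_ge0; have -> : q * (1 + j%:R * (q - 1)) - (1 + j.+1%:R * (q - 1)) =
      j%:R * (q - 1) ^+ 2 by rewrite -natr1; ring.
  by rewrite mulr_ge0 ?ler0n // exprn_ge0 // ltW.
have := le_trans (bern (2 ^ m)%N) (qB m).
rewrite ler_pdivrMr // in mB => /le_trans/(_ mB).
have : m%:R * (q - 1) <= (2 ^ m)%:R * (q - 1).
  by apply: ler_wpM2r; [exact: ltW | rewrite ler_nat ltnW // ltn_expl].
move=> le1 /le_trans/(_ le1); rewrite -{2}[_ * _]add0r lerD2r.
by rewrite ler10.
Qed.

End DetBounds.

(** * Representations, coactions, braiding and twist *)

Section Representations.
Variables (K : fieldType) (H : hopfAlgebra K).
Implicit Types (W : vectType K) (g h : H).
Local Notation S := (antipode H).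
Local Notation eps := (counit H).
Local Notation n := (\dim {:H}).
Local Notation e i := ((vbasis {:H})`_i).
Local Notation psi k := (fun h : H => sweedler_pow h k).

Lemma sweedler_powS h k : sweedler_pow h k.+1 = Sw (fun a b => a * psi k b) h.
Proof.
case: k => [|k]; last exact: sweedler_powSS.
rewrite -[LHS](Sw_counitr (f := id)); last exact: lin_id.
by apply: eq_Sw => a b; rewrite /= -scalerAr mulr1.
Qed.

Lemma sweedler_pow_lin k : linear (psi k).
Proof.
case: k => [|k] a x y; first by rewrite /= linearP scalerDl scalerA.
by rewrite !sweedler_powS Sw_lin.
Qed.

Definition is_rep d (rho : H -> 'M[K]_d) :=
  [/\ linear rho, rho 1 = 1%:M & forall g h, rho (g * h) = rho g *m rho h].

(* A left comodule x |-> sum_i e_i (x) del_i x, where e_i is the chosen basis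
   of H; identities in H (x) H (x) End X are expressed through arbitrary
   multilinear maps F. *)
Definition is_corep d (del : 'I_n -> 'M[K]_d) :=
  (forall W (F : H -> H -> 'M[K]_d -> W),
     (forall b M, linear (fun a => F a b M)) ->
     (forall a M, linear (fun b => F a b M)) ->
     (forall a b, linear (fun M => F a b M)) ->
     \sum_(i < n) Sw (fun a b => F a b (del i)) (e i) =
     \sum_(i < n) \sum_(j < n) F (e i) (e j) (del j *m del i)) /\
  \sum_(i < n) eps (e i) *: del i = 1%:M.

Definition rep_tens d d' (rho : H -> 'M[K]_d) (sig : H -> 'M[K]_d') h :=
  Sw (fun a b => rho a *t sig b) h.

Lemma rep_tensP d d' (rho : H -> 'M[K]_d) (sig : H -> 'M[K]_d') :
  is_rep rho -> is_rep sig -> is_rep (rep_tens rho sig).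
Proof.
move=> [rl r1 rM] [sl s1 sM]; split; first exact: Sw_lin.
  rewrite /rep_tens Sw1; last by lin.
  by rewrite r1 s1 tens1mx.
move=> g h; rewrite /rep_tens SwM; try lin.
rewrite (Sw_linear (L := fun M => M *m _)); last by lin.
apply: eq_Sw => a b.
rewrite (Sw_linear (L := fun M => _ *m M)); last by lin.
by apply: eq_Sw => c k; rewrite tensmx_mul rM sM.
Qed.

(** The braiding x (x) y -> x_(-1) y (x) x_(0) followed by the flip of the factors, which makes it
    an endomorphism of X (x) Y. *)
Definition bmx d d' (del : 'I_n -> 'M[K]_d) (rho : H -> 'M[K]_d') :=
  \sum_(i < n) del i *t rho (e i).

Section Braiding.
Hypothesis SS : involutive S.
Variables (d d' : nat) (del : 'I_n -> 'M[K]_d) (rho : H -> 'M[K]_d').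
Hypotheses (cdel : is_corep del) (rrho : is_rep rho).

(** When S^2 = 1, b S(a) = S(a S(b)), so this is the antipode axiom under S. *)
Lemma Sw_antir' W (f : H -> W) h :
  linear f -> Sw (fun a b => f (b * S a)) h = eps h *: f 1.
Proof.
move=> fl; rewrite -antipode1 -(Sw_antir (f := fun x => f (S x))); last by lin.
by apply: eq_Sw => a b; rewrite antipodeM SS.
Qed.

Lemma Sw_antil' W (f : H -> W) h :
  linear f -> Sw (fun a b => f (S b * a)) h = eps h *: f 1.
Proof.
move=> fl; rewrite -antipode1 -(Sw_antil (f := fun x => f (S x))); last by lin.
by apply: eq_Sw => a b; rewrite antipodeM SS.
Qed.

Let bmx_inv := \sum_(i < n) del i *t rho (S (e i)).

Lemma bmx_mulV : bmx del rho *m bmx_inv = 1%:M.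
Proof.
have [rl r1 rM] := rrho; have [dA d1] := cdel.
transitivity (\sum_(i < n) \sum_(j < n) (del j *m del i) *t rho (e j * S (e i))).
  rewrite /bmx_inv mulmx_sumr; apply: eq_bigr => i _.
  rewrite /bmx mulmx_suml; apply: eq_bigr => j _.
  by rewrite tensmx_mul rM.
rewrite -(dA _ (fun a b M => M *t rho (b * S a))); try lin.
transitivity ((\sum_(i < n) eps (e i) *: del i) *t (1%:M : 'M[K]_d')); last first.
  by rewrite d1 tens1mx.
rewrite (lin_sumE (f := fun X : 'M[K]_d => X *t (1%:M : 'M[K]_d'))); last by lin.
apply: eq_bigr => i _; rewrite (Sw_antir' (f := fun x => del i *t rho x)); last by lin.
rewrite r1 -(linZ (f := fun X : 'M[K]_d => X *t (1%:M : 'M[K]_d'))) //; lin.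
Qed.

(** Powers of [bmx] itself would produce the reversed products h_k ... h_1. The antipode in the
    inverse restores the order and yields Sweedler powers. *)
Lemma bmx_inv_exp k :
  mxexp bmx_inv k = \sum_(i < n) del i *t rho (S (psi k (e i))).
Proof.
have [rl r1 rM] := rrho; have [dA d1] := cdel.
elim: k => [|k IH].
  rewrite /= -(tens1mx _ d d') -d1 (lin_sumE (f := fun X : 'M[K]_d => X *t (1%:M : 'M[K]_d')));
    last by lin.
  apply: eq_bigr => i _; rewrite /= linearZ /= antipode1 (linZ _ _ rl) r1.
  have tl : linear (fun X : 'M[K]_d => X *t (1%:M : 'M[K]_d')) by lin.
  have tr : linear (fun X : 'M[K]_d' => del i *t X) by lin.
  by rewrite (linZ _ _ tl) (linZ _ _ tr).
have pl := sweedler_pow_lin k.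
rewrite mxexpSr IH; transitivity (\sum_(i < n) \sum_(j < n)
    (del j *m del i) *t rho (S (e i * psi k (e j)))).
  rewrite /bmx_inv mulmx_sumr; apply: eq_bigr => i _.
  rewrite mulmx_suml; apply: eq_bigr => j _.
  by rewrite tensmx_mul antipodeM rM.
rewrite -(dA _ (fun a b M => M *t rho (S (a * psi k b)))); try lin.
apply: eq_bigr => i _; rewrite sweedler_powS.
by rewrite (Sw_linear (L := fun x => del i *t rho (S x))) //; lin.
Qed.

Definition pow_relation (Q : {poly K}) N :=
  (size Q <= N)%N /\ forall h, \sum_(k < N) Q`_k *: psi k h = 0.

Lemma bmx_inv_annihilates Q N : pow_relation Q N -> annihilates Q bmx_inv.
Proof.
have [rl r1 rM] := rrho.
move=> [sQ QN]; exists N => //.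
under eq_bigr => k _ do rewrite bmx_inv_exp scaler_sumr.
rewrite exchange_big big1 // => i _ /=.
have l : linear (fun x => del i *t rho (S x)) by lin.
transitivity (del i *t rho (S (\sum_(k < N) Q`_k *: psi k (e i)))).
  by rewrite (lin_sumE _ _ _ l); apply: eq_bigr => k _; rewrite (linZ _ _ l).
by rewrite QN -(scale0r 0) (linZ _ _ l) scale0r.
Qed.

Lemma bmx_inv_unit : bmx_inv \in unitmx /\ invmx bmx_inv = bmx del rho.
Proof.
have [u1 u2] := mulmx1_unit bmx_mulV; split=> //.
by rewrite -[RHS]mulmx1 -(mulmxV u2) mulmxA bmx_mulV mul1mx.
Qed.

End Braiding.

(** The Sweedler power maps lie in the finite-dimensional space End(H). The relation depends on no
    module, which makes the determinant bounds uniform. *)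
Lemma ex_pow_relation : exists Q N, Q != 0 /\ pow_relation Q N.
Proof.
have [N [Q [Q0 sQ QN]]] := lin_dependence (fun k => opmx (psi k)).
exists Q, N; split=> //; split=> // h.
have l : linear (fun h : H => \sum_(k < N) Q`_k *: psi k h).
  by apply: lin_sum => k; apply: lin_scale; exact: sweedler_pow_lin.
have l0 : linear (fun _ : H => 0 : H) by move=> k u v; rewrite scaler0 addr0.
apply: (opmx_inj l l0); rewrite opmx_sum.
transitivity (\sum_(k < N) Q`_k *: opmx (psi k)).
  by apply: eq_bigr => k _; apply/matrixP => i j; rewrite !mxE linearZ.
by rewrite QN; apply/matrixP => i j; rewrite !mxE linear0.
Qed.

(* The Yetter-Drinfeld condition (h x)_(-1) (x) (h x)_(0) =
   h_1 x_(-1) S(h_3) (x) h_2 x_(0). *)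
Definition is_yd d (rho : H -> 'M[K]_d) (del : 'I_n -> 'M[K]_d) :=
  [/\ is_rep rho, is_corep del &
    forall W (F : H -> 'M[K]_d -> W) h,
     (forall M, linear (fun a => F a M)) -> (forall a, linear (fun M => F a M)) ->
     \sum_(i < n) F (e i) (del i *m rho h) =
     Sw (fun a x => Sw (fun b c =>
       \sum_(i < n) F (a * e i * S c) (rho b *m del i)) x) h].

(* The twist x |-> x_(-1) x_(0). *)
Definition theta d (rho : H -> 'M[K]_d) (del : 'I_n -> 'M[K]_d) :=
  \sum_(i < n) rho (e i) *m del i.

Section Twist.
Hypothesis SS : involutive S.
Variables (d : nat) (rho : H -> 'M[K]_d) (del : 'I_n -> 'M[K]_d).
Hypothesis yd : is_yd rho del.
Local Notation th := (theta rho del).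

(** In h_1 x_(-1) S(h_3) h_2 x_(0) the factor S(h_3) h_2 collapses because S^2 = 1. *)
Lemma theta_rho h : th *m rho h = rho h *m th.
Proof.
have [[rl r1 rM] [dA d1] ydc] := yd.
rewrite /theta mulmx_suml.
under eq_bigr => i _ do rewrite -mulmxA.
rewrite (ydc _ (fun a M => rho a *m M)); try lin.
transitivity (Sw (fun a x => eps x *: (rho a *m th)) h); last first.
  by rewrite (Sw_counitr (f := fun a => rho a *m th)) //; lin.
apply: eq_Sw => a x.
transitivity (Sw (fun b c => \sum_(i < n) rho (a * e i * (S c * b)) *m del i) x).
  by apply: eq_Sw => b c; apply: eq_bigr => i _; rewrite mulmxA -rM !mulrA.
rewrite (Sw_antil' SS (f := fun t => \sum_(i < n) rho (a * e i * t) *m del i));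
  last by lin.
congr (_ *: _); rewrite /theta mulmx_sumr; apply: eq_bigr => i _.
by rewrite mulr1 rM mulmxA.
Qed.

(** The coaction on theta(x) is x_(-4) x_(-1) S(x_(-2)) (x) x_(-3) x_(0), where x_(-1) S(x_(-2))
    collapses because S^2 = 1. [F] reads off the i-th coordinate in H. *)
Lemma theta_del i : th *m del i = del i *m th.
Proof.
have [[rl r1 rM] [dA d1] ydc] := yd.
pose F a (M : 'M[K]_d) := coord (vbasis {:H}) i a *: M.
have F1 M : linear (fun a => F a M) by rewrite /F; lin.
have F2 a : linear (fun M => F a M) by rewrite /F; lin.
have FE (A : 'I_n -> 'M[K]_d) : \sum_(s < n) F (e s) (A s) = A i.
  rewrite (bigD1 i) //= big1 => [|j ji]; rewrite /F coord_basis.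
    by rewrite eqxx scale1r addr0.
  by rewrite eq_sym (negPf ji) scale0r.
rewrite -(FE (fun s => th *m del s)) -(FE (fun s => del s *m th)).
transitivity (\sum_(s < n) Sw (fun a y => F a (rho y *m del s)) (e s)).
  rewrite (dA _ (fun a y M => F a (rho y *m M))); try lin.
  apply: eq_bigr => s _; rewrite /theta mulmx_suml (lin_sumE _ _ _ (F2 _)).
  by apply: eq_bigr => t _; rewrite mulmxA.
transitivity (\sum_(s < n) \sum_(t < n) F (e t) (del t *m rho (e s) *m del s));
  last first.
  rewrite exchange_big; apply: eq_bigr => s _ /=.
  rewrite /theta mulmx_sumr (lin_sumE _ _ _ (F2 _)).
  by apply: eq_bigr => t _; rewrite mulmxA.
transitivity (\sum_(s < n) Sw (fun p q => Sw (fun a x => Sw (fun b c =>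
   F (a * q * S c) (rho b *m del s)) x) p) (e s)).
  apply: eq_bigr => s _; symmetry.
  rewrite Sw_assoc; try lin.
  apply: eq_Sw => a y.
  transitivity (Sw (fun b z => Sw (fun c q => F (a * (q * S c)) (rho b *m del s)) z) y).
    rewrite Sw_assoc; try lin.
    by apply: eq_Sw => b z; apply: eq_Sw => c q; rewrite mulrA.
  transitivity (Sw (fun b z => eps z *: F a (rho b *m del s)) y).
    apply: eq_Sw => b z.
    by rewrite (Sw_antir' SS (f := fun t => F (a * t) (rho b *m del s))) ?mulr1 //; lin.
  by rewrite (Sw_counitr (f := fun b => F a (rho b *m del s))) //; lin.
rewrite (dA _ (fun p q M => Sw (fun a x => Sw (fun b c =>
   F (a * q * S c) (rho b *m M)) x) p)); try lin.
apply: eq_bigr => s _; rewrite (ydc _ (fun a M => F a (M *m del s))); try lin.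
rewrite -Sw_sum; apply: eq_Sw => a x; rewrite -Sw_sum; apply: eq_Sw => b c.
by apply: eq_bigr => t _; rewrite mulmxA.
Qed.

Lemma theta_exp_del k i : mxexp th k *m del i = del i *m mxexp th k.
Proof.
elim: k => [|k IH] /=; first by rewrite mulmx1 mul1mx.
by rewrite -mulmxA IH mulmxA theta_del -mulmxA.
Qed.

Lemma theta_exp k : mxexp th k = \sum_(i < n) rho (psi k (e i)) *m del i.
Proof.
have [[rl r1 rM] [dA d1] ydc] := yd.
elim: k => [|k IH].
  rewrite /= -d1; apply: eq_bigr => i _.
  by rewrite (linZ _ _ rl) r1 -scalemxAl mul1mx.
have pl := sweedler_pow_lin k.
rewrite -[mxexp th k.+1]/(th *m mxexp th k) {1}/theta mulmx_suml.
transitivity (\sum_(i < n) \sum_(j < n) rho (e i * psi k (e j)) *m (del j *m del i)).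
  apply: eq_bigr => i _; rewrite -mulmxA -theta_exp_del IH mulmx_suml mulmx_sumr.
  by apply: eq_bigr => j _; rewrite rM !mulmxA.
rewrite -(dA _ (fun a b M => rho (a * psi k b) *m M)); try lin.
apply: eq_bigr => i _; rewrite sweedler_powS.
by rewrite (Sw_linear (L := fun x => rho x *m del i)) //; lin.
Qed.

Lemma theta_annihilates Q N : pow_relation Q N -> annihilates Q th.
Proof.
have [[rl r1 rM] _ _] := yd.
move=> [sQ QN]; exists N => //.
under eq_bigr => k _ do rewrite theta_exp scaler_sumr.
rewrite exchange_big big1 // => i _ /=.
have l : linear (fun x => rho x *m del i) by lin.
transitivity (rho (\sum_(k < N) Q`_k *: psi k (e i)) *m del i).
  by rewrite (lin_sumE _ _ _ l); apply: eq_bigr => k _; rewrite (linZ _ _ l).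
by rewrite QN -(scale0r 0) (linZ _ _ l) scale0r.
Qed.

(** The inverse is x -> S(x_(-1)) x_(0). *)
Lemma theta_unit : th \in unitmx.
Proof.
have [[rl r1 rM] [dA d1] ydc] := yd.
suff : (\sum_(i < n) rho (S (e i)) *m del i) *m th = 1%:M by case/mulmx1_unit.
rewrite mulmx_suml.
transitivity (\sum_(i < n) \sum_(j < n) rho (S (e i) * e j) *m (del j *m del i)).
  apply: eq_bigr => i _; rewrite -mulmxA -theta_del {1}/theta mulmx_suml mulmx_sumr.
  by apply: eq_bigr => j _; rewrite rM !mulmxA.
rewrite -(dA _ (fun a b M => rho (S a * b) *m M)); try lin.
rewrite -d1; apply: eq_bigr => i _.
by rewrite (Sw_antil (f := fun x => rho x *m del i)) ?r1 ?mul1mx //; lin.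
Qed.

End Twist.
End Representations.

(** * Tensor products of Yetter-Drinfeld modules *)

Section TensorYD.
Variables (K : fieldType) (H : hopfAlgebra K).
Hypothesis SS : involutive (antipode H).
Implicit Types (W : vectType K) (g h : H).
Local Notation S := (antipode H).
Local Notation eps := (counit H).
Local Notation n := (\dim {:H}).
Local Notation e i := ((vbasis {:H})`_i).
Local Notation "e^ i" := (coord (vbasis {:H}) i) (at level 2, i at level 1).

(** The coaction x (x) y -> x_(-1) y_(-1) (x) x_(0) (x) y_(0), expanded in the basis of H. *)
Definition corep_tens d d' (del : 'I_n -> 'M[K]_d) (dlt : 'I_n -> 'M[K]_d') r :=
  \sum_(i < n) \sum_(j < n) e^r (e i * e j) *: (del i *t dlt j).

Section Def.
Variables (d d' : nat).
Variables (rho : H -> 'M[K]_d) (del : 'I_n -> 'M[K]_d).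
Variables (sig : H -> 'M[K]_d') (dlt : 'I_n -> 'M[K]_d').

Lemma corep_tensE W (F : H -> 'M[K]_(d * d') -> W) :
  (forall M, linear (fun a => F a M)) -> (forall a, linear (F a)) ->
  \sum_(r < n) F (e r) (corep_tens del dlt r) =
  \sum_(i < n) \sum_(j < n) F (e i * e j) (del i *t dlt j).
Proof.
move=> F1 F2; rewrite /corep_tens.
under eq_bigr => r _ do rewrite (lin_sumE _ _ _ (F2 _)).
rewrite exchange_big; apply: eq_bigr => i _ /=.
under eq_bigr => r _ do rewrite (lin_sumE _ _ _ (F2 _)).
rewrite exchange_big; apply: eq_bigr => j _ /=.
rewrite -[RHS](coord_exp (e i * e j) (F1 _)); apply: eq_bigr => r _.
by rewrite (linZ _ _ (F2 _)).
Qed.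

Lemma corep_tensP : is_corep del -> is_corep dlt -> is_corep (corep_tens del dlt).
Proof.
move=> [dA d1] [tA t1]; split=> [W F F1 F2 F3|]; last first.
  rewrite (corep_tensE (F := fun a M => eps a *: M)); try lin.
  rewrite -tens1mx -d1 -t1 sum_tensl; apply: eq_bigr => i _.
  rewrite sum_tensr; apply: eq_bigr => j _; rewrite counitM.
  have tl : linear (fun X : 'M[K]_d => X *t (eps (e j) *: dlt j)) by lin.
  have tr : linear (fun X : 'M[K]_d' => del i *t X) by lin.
  by rewrite (linZ _ _ tl) (linZ _ _ tr) scalerA.
rewrite (corep_tensE (F := fun x M => Sw (fun a b => F a b M) x)); try lin.
transitivity (\sum_(i < n) \sum_(j < n) Sw (fun a b => Sw (fun c k =>
    F (a * c) (b * k) (del i *t dlt j)) (e j)) (e i)).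
  by apply: eq_bigr => i _; apply: eq_bigr => j _; rewrite SwM //; lin.
transitivity (\sum_(j < n) \sum_(i < n) \sum_(i' < n) Sw (fun c k =>
    F (e i * c) (e i' * k) ((del i' *m del i) *t dlt j)) (e j)).
  rewrite exchange_big; apply: eq_bigr => j _.
  by rewrite (dA _ (fun a b M => Sw (fun c k => F (a * c) (b * k) (M *t dlt j)) (e j)));
    try lin.
transitivity (\sum_(i < n) \sum_(i' < n) \sum_(j < n) \sum_(j' < n)
    F (e i * e j) (e i' * e j') ((del i' *m del i) *t (dlt j' *m dlt j))).
  rewrite exchange_big; apply: eq_bigr => i _.
  rewrite exchange_big; apply: eq_bigr => i' _.
  by rewrite (tA _ (fun c k M => F (e i * c) (e i' * k) ((del i' *m del i) *t M)));
    try lin.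
symmetry.
rewrite (corep_tensE (F := fun a M => \sum_(r < n) F a (e r) (corep_tens del dlt r *m M)));
  try lin.
apply: eq_bigr => i _.
transitivity (\sum_(j < n) \sum_(i' < n) \sum_(j' < n) F (e i * e j) (e i' * e j')
    ((del i' *t dlt j') *m (del i *t dlt j))).
  apply: eq_bigr => j _.
  by rewrite (corep_tensE (F := fun b M => F (e i * e j) b (M *m (del i *t dlt j))));
    try lin.
rewrite exchange_big; apply: eq_bigr => i' _; apply: eq_bigr => j _.
by apply: eq_bigr => j' _; rewrite tensmx_mul.
Qed.

(** The coactions of the two factors contribute h_1 x_(-1) S(h_3) and h_4 y_(-1) S(h_6); in their
    product S(h_3) h_4 collapses. *)
Lemma yd_tensP : is_yd rho del -> is_yd sig dlt ->
  is_yd (rep_tens rho sig) (corep_tens del dlt).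
Proof.
move=> [rr cd ydc] [rs ct ydt]; split; [exact: rep_tensP|exact: corep_tensP|].
have [rl r1 rM] := rr; have [sl s1 sM] := rs.
move=> W F h F1 F2.
pose G a b z := Sw (fun q r => \sum_(i < n) \sum_(j < n) F (a * e i * e j * S r)
   ((rho b *m del i) *t (sig q *m dlt j))) z.
transitivity (Sw (fun a w => Sw (fun b z => G a b z) w) h); last first.
  apply: eq_Sw => a x.
  transitivity (Sw (fun y c => Sw (fun b q =>
    \sum_(i < n) \sum_(j < n) F (a * e i * e j * S c)
       ((rho b *m del i) *t (sig q *m dlt j))) y) x).
    by rewrite Sw_assoc //; lin.
  apply: eq_Sw => y c.
  rewrite (corep_tensE (F := fun t M => F (a * t * S c) (rep_tens rho sig y *m M)));
    try lin.
  rewrite Sw_sum; apply: eq_bigr => i _; rewrite Sw_sum; apply: eq_bigr => j _.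
  rewrite /rep_tens (Sw_linear (L := fun M => F (a * (e i * e j) * S c) (M *m _)));
    last by lin.
  by apply: eq_Sw => b q; rewrite tensmx_mul !mulrA.
rewrite (corep_tensE (F := fun a M => F a (M *m rep_tens rho sig h))); try lin.
transitivity (Sw (fun u v => \sum_(i < n) \sum_(j < n) F (e i * e j)
   ((del i *m rho u) *t (dlt j *m sig v))) h).
  rewrite Sw_sum; apply: eq_bigr => i _; rewrite Sw_sum; apply: eq_bigr => j _.
  rewrite /rep_tens (Sw_linear (L := fun M => F (e i * e j) (_ *m M))); last by lin.
  by apply: eq_Sw => u v; rewrite tensmx_mul.
transitivity (Sw (fun u v => Sw (fun a x => Sw (fun b c => Sw (fun p y => Sw (fun q r =>
   \sum_(i < n) \sum_(j < n) F (a * e i * (S c * p) * e j * S r)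
   ((rho b *m del i) *t (sig q *m dlt j))) y) v) x) u) h).
  apply: eq_Sw => u v.
  rewrite exchange_big.
  transitivity (\sum_(j < n) Sw (fun a x => Sw (fun b c =>
     \sum_(i < n) F (a * e i * S c * e j) ((rho b *m del i) *t (dlt j *m sig v))) x) u).
    apply: eq_bigr => j _.
    by rewrite (ydc _ (fun a M => F (a * e j) (M *t (dlt j *m sig v)))); try lin.
  rewrite -Sw_sum; apply: eq_Sw => a x; rewrite -Sw_sum; apply: eq_Sw => b c.
  transitivity (\sum_(i < n) Sw (fun p y => Sw (fun q r => \sum_(j < n)
     F (a * e i * S c * (p * e j * S r)) ((rho b *m del i) *t (sig q *m dlt j))) y) v).
    rewrite exchange_big; apply: eq_bigr => i _.
    by rewrite (ydt _ (fun t M => F (a * e i * S c * t) ((rho b *m del i) *t M)));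
      try lin.
  rewrite -Sw_sum; apply: eq_Sw => p y; rewrite -Sw_sum; apply: eq_Sw => q r.
  by apply: eq_bigr => i _; apply: eq_bigr => j _; rewrite !mulrA.
rewrite Sw_assoc; try lin.
apply: eq_Sw => a w; rewrite Sw_assoc; try lin.
apply: eq_Sw => b z; rewrite -Sw_assoc; try lin.
transitivity (Sw (fun k y => eps k *: G a b y) z); last first.
  by rewrite (Sw_counitl (f := G a b)) // /G; lin.
apply: eq_Sw => k y.
rewrite (Sw_antil (f := fun t => Sw (fun q r => \sum_(i < n) \sum_(j < n)
   F (a * e i * t * e j * S r) ((rho b *m del i) *t (sig q *m dlt j))) y)); last by lin.
congr (_ *: _); apply: eq_Sw => q r.
by apply: eq_bigr => i _; apply: eq_bigr => j _; rewrite mulr1.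
Qed.

(* For the braiding c, the twist of a tensor product is the composite of the
   tensor product of the twists with the monodromy c c. *)
Lemma theta_tens : is_yd rho del -> is_yd sig dlt ->
  theta (rep_tens rho sig) (corep_tens del dlt) =
  (theta rho del *t theta sig dlt) *m (\sum_(j < n) rho (e j) *t dlt j) *m bmx del sig.
Proof.
move=> ydX ydY; have [[rl r1 rM] [dA d1] ydc] := ydX.
have [[sl s1 sM] [tA t1] ydt] := ydY.
set tX := theta rho del; set tY := theta sig dlt.
transitivity (\sum_(i < n) Sw (fun a b => \sum_(j < n)
    (rho (a * e j) *m del i) *t (sig b *m tY *m dlt j)) (e i)).
  rewrite /theta (corep_tensE (F := fun x M => rep_tens rho sig x *m M)); last 2 first.
  - by move=> M; apply: lin_mulmxr; apply: Sw_lin.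
  - by lin.
  transitivity (\sum_(i < n) \sum_(j < n) Sw (fun c k => Sw (fun a b =>
     (rho (a * c) *m del i) *t (sig (b * k) *m dlt j)) (e i)) (e j)).
    apply: eq_bigr => i _; apply: eq_bigr => j _; rewrite /rep_tens SwM; try lin.
    rewrite (Sw_linear (L := fun M => M *m _)); last by lin.
    rewrite SwC; apply: eq_Sw => a b.
    rewrite (Sw_linear (L := fun M => M *m _)); last by lin.
    by apply: eq_Sw => c k; rewrite tensmx_mul.
  apply: eq_bigr => i _.
  rewrite (tA _ (fun c k M => Sw (fun a b =>
     (rho (a * c) *m del i) *t (sig (b * k) *m M)) (e i))); try lin.
  transitivity (\sum_(j < n) Sw (fun a b => \sum_(j' < n)
     (rho (a * e j) *m del i) *t (sig (b * e j') *m (dlt j' *m dlt j))) (e i)).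
    by apply: eq_bigr => j _; rewrite Sw_sum.
  rewrite -Sw_sum; apply: eq_Sw => a b; apply: eq_bigr => j _.
  rewrite -sum_tensr; congr (_ *t _); rewrite -mulmxA {1}/tY /theta.
  rewrite mulmx_suml mulmx_sumr; apply: eq_bigr => j' _.
  by rewrite sM !mulmxA.
symmetry.
transitivity (\sum_(i < n) \sum_(j < n)
    (tX *m rho (e j) *m del i) *t (tY *m (dlt j *m sig (e i)))).
  rewrite /bmx mulmx_sumr; apply: eq_bigr => i _.
  rewrite mulmx_sumr mulmx_suml; apply: eq_bigr => j _.
  by rewrite !tensmx_mul !mulmxA.
transitivity (\sum_(i < n) Sw (fun a x => Sw (fun b c => \sum_(j < n)
    (rho (a * e j * S c) *m tX *m del i) *t (sig b *m tY *m dlt j)) x) (e i)).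
  apply: eq_bigr => i _.
  rewrite (ydt _ (fun a M => (tX *m rho a *m del i) *t (tY *m M))); try lin.
  apply: eq_Sw => a x; apply: eq_Sw => b c; apply: eq_bigr => j _.
  by rewrite (theta_rho SS ydX) mulmxA (theta_rho SS ydY).
transitivity (\sum_(i < n) \sum_(k < n) Sw (fun a x => Sw (fun b c => \sum_(j < n)
    (rho (a * e j * (S c * e k)) *m (del k *m del i)) *t (sig b *m tY *m dlt j)) x) (e i)).
  apply: eq_bigr => i _; rewrite -Sw_sum; apply: eq_Sw => a x.
  rewrite -Sw_sum; apply: eq_Sw => b c; rewrite exchange_big; apply: eq_bigr => j _.
  rewrite -sum_tensl; congr (_ *t _); rewrite {1}/tX /theta mulmx_sumr mulmx_suml.
  by apply: eq_bigr => k _; rewrite !rM !mulmxA.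
rewrite -(dA _ (fun p q M => Sw (fun a x => Sw (fun b c => \sum_(j < n)
    (rho (a * e j * (S c * q)) *m M) *t (sig b *m tY *m dlt j)) x) p)); try lin.
apply: eq_bigr => i _; rewrite Sw_assoc; try lin.
apply: eq_Sw => a y.
rewrite Sw_assoc; try lin.
transitivity (Sw (fun b z => eps z *: \sum_(j < n)
    (rho (a * e j) *m del i) *t (sig b *m tY *m dlt j)) y); last first.
  by rewrite (Sw_counitr (f := fun b => \sum_(j < n)
    (rho (a * e j) *m del i) *t (sig b *m tY *m dlt j))) //; lin.
apply: eq_Sw => b z.
rewrite (Sw_antil (f := fun t => \sum_(j < n)
    (rho (a * e j * t) *m del i) *t (sig b *m tY *m dlt j))); last by lin.
by congr (_ *: _); apply: eq_bigr => j _; rewrite mulr1.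
Qed.

End Def.
End TensorYD.

(** * Determinants of braidings and twists have modulus 1 *)

Section UnitDeterminants.
Variables (C : numClosedFieldType) (H : hopfAlgebra C).
Hypothesis SS : involutive (antipode H).
Hypothesis arch : forall x : C, 0 <= x -> exists m : nat, x <= m%:R.
Local Notation S := (antipode H).
Local Notation n := (\dim {:H}).
Local Notation e i := ((vbasis {:H})`_i).

(** Hexagon identity: the braiding with a tensor product is a product of two braidings, each
    tensored with an identity matrix, which flips and reassociations move to an outer factor. *)
Lemma det_bmx_tens d d1 d2 (del : 'I_n -> 'M[C]_d) (rho : H -> 'M[C]_d1)
    (sig : H -> 'M[C]_d2) :
  is_corep del -> is_rep rho -> is_rep sig ->
  \det (bmx del (rep_tens rho sig)) =
  \det (bmx del sig) ^+ d1 * \det (bmx del rho) ^+ d2.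
Proof.
move=> [dA _] [rl r1 rM] [sl s1 sM].
have -> : bmx del (rep_tens rho sig) =
    (\sum_(j < n) del j *t (1%:M *t sig (e j))) *m
    (\sum_(i < n) del i *t (rho (e i) *t 1%:M)).
  transitivity (\sum_(i < n) Sw (fun a b => del i *t (rho a *t sig b)) (e i)).
    apply: eq_bigr => i _; rewrite /rep_tens.
    by rewrite (Sw_linear (L := fun M => del i *t M)) //; lin.
  rewrite (dA _ (fun a b M => M *t (rho a *t sig b))); try lin.
  rewrite mulmx_sumr; apply: eq_bigr => i _; rewrite mulmx_suml.
  by apply: eq_bigr => j _; rewrite !tensmx_mul mul1mx mulmx1.
rewrite det_mulmx; congr (_ * _).
  rewrite det_tens_assoc det_tens_flip det_tens_assoc -sum_tensl det_tens.
  by rewrite det1 expr1n mulr1 det_tens_flip.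
by rewrite det_tens_assoc -sum_tensl det_tens det1 expr1n mulr1.
Qed.

(** With d the dimension of x, the bound at [dbl x] reads q^(2 d) <= M^(N d^2), that is q^2 <= M^(N
    d). Repeating this bounds every q^(2^k) by the same number. *)
Lemma doubling_le1 (T : Type) (P : T -> Prop) (dim : T -> nat) (q : T -> C)
    (dbl : T -> T) (M : C) (N : nat) : 1 <= M ->
  (forall x, P x -> [/\ P (dbl x), dim (dbl x) = (dim x * dim x)%N,
     q (dbl x) = q x ^+ (dim x + dim x) & 0 <= q x <= M ^+ (N * dim x)]) ->
  forall x, P x -> (0 < dim x)%N -> q x <= 1.
Proof.
move=> M1 dblP x Px dx; have M0 : 0 <= M := le_trans ler01 M1.
have qle k : forall x, P x -> (0 < dim x)%N -> q x ^+ (2 ^ k) <= M ^+ (N * dim x).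
  elim: k => [|k IH] {Px dx}x Px dx.
    by have [_ _ _ /andP[_]] := dblP x Px; rewrite expn0 expr1.
  have [Pd dd qd /andP[q0 _]] := dblP x Px.
  have := IH _ Pd; rewrite dd muln_gt0 dx qd => /(_ isT).
  rewrite -exprM mulnA [(M ^+ _)]exprM addnn -mul2n -mulnA mulnCA mulnC exprM.
  by rewrite -expnS ler_pXn2r // nnegrE exprn_ge0.
have [_ _ _ /andP[q0 _]] := dblP x Px.
apply: (bounded_powers_le1 arch (B := M ^+ (N * dim x))) => // [|k].
  by rewrite exprn_ge0.
exact: qle.
Qed.

Lemma norm_eq1 (x : C) : x != 0 -> `|x| <= 1 -> `|x|^-1 <= 1 -> `|x| = 1.
Proof.
move=> x0 le1; rewrite invf_le1 ?normr_gt0 // => ge1.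
by apply/eqP; rewrite eq_le le1.
Qed.

(** [doubling_le1] applies to |det| and to its inverse, with the comodule fixed and the
    representation replaced by its tensor square. *)
Lemma norm_det_bmx d d' (del : 'I_n -> 'M[C]_d) (rho : H -> 'M[C]_d') :
  (0 < d')%N -> is_corep del -> is_rep rho -> `|\det (bmx del rho)| = 1.
Proof.
move=> d'0 cdel rrho.
have [Q [N [Q0 QN]]] := ex_pow_relation H.
have [M M1 MP] := annihilated_det_bound Q0.
have bound d1 (sig : H -> 'M[C]_d1) : is_rep sig ->
    [/\ \det (bmx del sig) != 0, `|\det (bmx del sig)| <= M ^+ (d * d1) &
        `|\det (bmx del sig)|^-1 <= M ^+ (d * d1)].
  move=> rsig; have [u iE] := bmx_inv_unit SS cdel rsig.
  have [] := MP _ _ u (bmx_inv_annihilates cdel rsig QN).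
  rewrite -iE det_inv normfV invrK; split=> //.
  by rewrite invr_eq0 -unitfE -unitmxE.
pose T := {d1 : nat & H -> 'M[C]_d1}.
pose P (x : T) := is_rep (projT2 x).
pose dbl (x : T) : T := existT _ _ (rep_tens (projT2 x) (projT2 x)).
have [b0 _ _] := bound _ rho rrho.
apply: norm_eq1 => //.
  apply: (@doubling_le1 T P (fun x => projT1 x)
    (fun x => `|\det (bmx del (projT2 x))|) dbl M d M1 _ (existT _ d' rho)) => //.
  move=> [d1 sig] rsig; split=> //; first exact: rep_tensP.
    by rewrite /= det_bmx_tens // normrM !normrX exprD.
  by have [_ le _] := bound _ _ rsig; rewrite normr_ge0.
apply: (@doubling_le1 T P (fun x => projT1 x)
    (fun x => `|\det (bmx del (projT2 x))|^-1) dbl M d M1 _ (existT _ d' rho)) => //.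
move=> [d1 sig] rsig; split=> //; first exact: rep_tensP.
  by rewrite /= det_bmx_tens // normrM !normrX -exprD exprVn.
by have [_ _ le] := bound _ _ rsig; rewrite invr_ge0 normr_ge0.
Qed.

(** In [theta_tens] both braidings have determinant of modulus 1, so |det theta| satisfies the
    doubling rule. *)
Lemma norm_det_theta d (rho : H -> 'M[C]_d) del :
  (0 < d)%N -> is_yd rho del -> `|\det (theta rho del)| = 1.
Proof.
move=> d0 yd.
have [Q [N [Q0 QN]]] := ex_pow_relation H.
have [M M1 MP] := annihilated_det_bound Q0.
pose T := {d1 : nat & ((H -> 'M[C]_d1) * ('I_n -> 'M[C]_d1))%type}.
pose P (x : T) := (0 < projT1 x)%N /\ is_yd (projT2 x).1 (projT2 x).2.
pose th (x : T) := theta (projT2 x).1 (projT2 x).2.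
pose dbl (x : T) : T := existT _ _ (rep_tens (projT2 x).1 (projT2 x).1,
  corep_tens (projT2 x).2 (projT2 x).2).
have bound x : P x -> [/\ \det (th x) != 0,
   `|\det (th x)| <= M ^+ (1 * projT1 x) & `|\det (th x)|^-1 <= M ^+ (1 * projT1 x)].
  move=> [_ ydx]; have u := theta_unit SS ydx; rewrite mul1n.
  have [le1 le2] := MP _ _ u (theta_annihilates SS ydx QN); split=> //.
  by rewrite -unitfE -unitmxE.
have dblE x : P x -> `|\det (th (dbl x))| =
    `|\det (th x)| ^+ (projT1 x + projT1 x).
  move: x => [d1 [sig dlt]] [/= d10 ydx]; have [rs cs _] := ydx.
  rewrite /th /= theta_tens // !det_mulmx !normrM det_tens -exprD normrX.
  by rewrite det_tens_flip !norm_det_bmx // !mulr1.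
have dblP x : P x -> P (dbl x).
  by move=> [dx ydx]; split; rewrite /= ?muln_gt0 ?dx //; exact: yd_tensP.
have Px : P (existT _ d (rho, del)) by [].
have [b0 _ _] := bound _ Px.
apply: norm_eq1 => //.
  apply: (@doubling_le1 T P (fun x => projT1 x)
    (fun x => `|\det (th x)|) dbl M 1 M1 _ _ Px) => // x Px'.
  split=> //; [exact: dblP|exact: dblE|].
  by have [_ le _] := bound _ Px'; rewrite normr_ge0.
apply: (@doubling_le1 T P (fun x => projT1 x)
  (fun x => `|\det (th x)|^-1) dbl M 1 M1 _ _ Px) => // x Px'.
split=> //; [exact: dblP|by rewrite dblE // exprVn|].
by have [_ _ le] := bound _ Px'; rewrite invr_ge0 normr_ge0.
Qed.

(** The eigenspace is stable because theta commutes with action and coaction. The columns of [B] are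
    a basis of it and [B'] is a left inverse; the transposes appear because [kermx] is a row
    space. *)
Lemma sub_yd d (rho : H -> 'M[C]_d) del (v : 'cV[C]_d) mu :
  is_yd rho del -> v != 0 -> theta rho del *m v = mu *: v ->
  exists r (rho' : H -> 'M[C]_r) del',
    [/\ (0 < r)%N, is_yd rho' del' & theta rho' del' = mu%:M].
Proof.
move=> yd v0 thv; have [[rl r1 rM] [dA d1] ydc] := yd.
set th := theta rho del in thv *; pose A := (th - mu%:M)^T.
pose r := \rank (kermx A).
have [K [Kp [KE KKp KpK]]] : exists (K : 'M[C]_(r, d)) (Kp : 'M[C]_(d, r)), [/\ (K :=: kermx A)%MS,
    K *m Kp = 1%:M & forall m (X : 'M_(m, d)), (X <= K)%MS -> X *m Kp *m K = X].
  exists (row_base (kermx A)), (pinvmx (row_base (kermx A))); split.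
  - exact: eq_row_base.
  - by rewrite mulmxVp // row_base_free.
  - by move=> m X; apply: mulmxKpV.
pose B : 'M[C]_(d, r) := K^T; pose B' : 'M[C]_(r, d) := Kp^T.
have B'B : B' *m B = 1%:M by rewrite -trmx_mul KKp trmx1.
have AK : K *m A = 0 by apply/sub_kermxP; rewrite KE.
have thB : th *m B = mu *: B.
  apply: trmx_inj; rewrite trmx_mul trmxK linearZ /= trmxK.
  apply/eqP; rewrite -subr_eq0 -mul_mx_scalar -mulmxBr.
  by rewrite -[X in _ - X]tr_scalar_mx -linearB /= AK.
have BM (M : 'M_d) : th *m M = M *m th -> B *m (B' *m M *m B) = M *m B.
  move=> thM; have AM : A *m M^T = M^T *m A.
    rewrite /A -!trmx_mul; congr (_^T).
    by rewrite mulmxBl mulmxBr thM scalar_mxC.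
  apply: trmx_inj; rewrite /B /B' !trmx_mul !trmxK !mulmxA KpK // KE.
  by apply/sub_kermxP; rewrite -mulmxA -AM mulmxA AK mul0mx.
pose phi M := B' *m M *m B.
have phil : linear phi by rewrite /phi; lin.
(* Compression to the eigenspace is multiplicative as soon as the right factor preserves it. *)
have phiM (M N : 'M_d) : th *m N = N *m th -> phi (M *m N) = phi M *m phi N.
  by move=> thN; rewrite /phi -!mulmxA [M *m (N *m B)]mulmxA -[in LHS](mulmxA M)
    -{1}(BM N) // !mulmxA.
have phi1 : phi 1%:M = 1%:M by rewrite /phi mulmx1.
have thr h : th *m rho h = rho h *m th := theta_rho SS yd h.
have thd i : th *m del i = del i *m th := theta_del SS yd i.
exists r, (fun h => phi (rho h)), (fun i => phi (del i)); split.
- rewrite lt0n mxrank_eq0; apply/rowV0Pn; exists v^T.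
    apply/sub_kermxP; rewrite /A -trmx_mul mulmxBl thv mul_scalar_mx subrr.
    by rewrite trmx0.
  by apply: contra_neq v0 => vT0; rewrite -[v]trmxK vT0 trmx0.
- split; first by split=> [||g h]; [lin|rewrite r1|rewrite rM phiM].
    split=> [W F F1 F2 F3|].
      rewrite (dA _ (fun a b M => F a b (phi M))); try lin.
      by apply: eq_bigr => i _; apply: eq_bigr => j _; rewrite phiM.
    rewrite -phi1 -d1 (lin_sumE _ _ _ phil); apply: eq_bigr => i _.
    by rewrite (linZ _ _ phil).
  move=> W F h F1 F2.
  transitivity (\sum_(i < n) F (e i) (phi (del i *m rho h))).
    by apply: eq_bigr => i _; rewrite phiM.
  rewrite (ydc _ (fun a M => F a (phi M))); try lin.
  by apply: eq_Sw => a x; apply: eq_Sw => b c; apply: eq_bigr => i _; rewrite phiM.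
transitivity (phi th).
  rewrite /th /theta (lin_sumE _ _ _ phil); apply: eq_bigr => i _.
  by rewrite phiM.
by rewrite /phi -mulmxA thB -scalemxAr B'B scalemx1.
Qed.

Lemma norm_theta_eigenvalue d (rho : H -> 'M[C]_d) del (v : 'cV[C]_d) mu :
  is_yd rho del -> v != 0 -> theta rho del *m v = mu *: v -> `|mu| = 1.
Proof.
move=> yd v0 /(sub_yd yd v0)[r [rho' [del' [r0 yd' thE]]]].
have := norm_det_theta r0 yd'; rewrite thE det_scalar normrX => /eqP.
by rewrite pexpr_eq1 // => /eqP.
Qed.

End UnitDeterminants.

(** * The cofree Yetter-Drinfeld module *)

Section Cofree.
Variables (K : fieldType) (H : hopfAlgebra K).
Hypothesis SS : involutive (antipode H).
Implicit Types (W : vectType K) (g h : H).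
Local Notation S := (antipode H).
Local Notation eps := (counit H).
Local Notation n := (\dim {:H}).
Local Notation e i := ((vbasis {:H})`_i).
Local Notation "e^ i" := (coord (vbasis {:H}) i) (at level 2, i at level 1).
Local Notation psi k := (fun h : H => sweedler_pow h k).

Lemma opmxZ (U V : vectType K) c (f : U -> V) :
  opmx (fun x => c *: f x) = c *: opmx f.
Proof. by apply/matrixP => i j; rewrite !mxE linearZ. Qed.

Lemma opmx_Sw (U V : vectType K) (F : H -> H -> U -> V) h :
  opmx (fun x => Sw (fun a b => F a b x) h) = Sw (fun a b => opmx (F a b)) h.
Proof.
rewrite /Sw /tlift opmx_sum; apply: eq_bigr => i _; rewrite opmx_sum.
by apply: eq_bigr => j _; rewrite opmxZ.
Qed.

Definition Dl (s : 'I_n) : 'M[K]_n := opmx (fun x => Sw (fun a b => e^s a *: b) x : H).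
Definition Dr (s : 'I_n) : 'M[K]_n := opmx (fun x => Sw (fun a b => e^s b *: a) x : H).

Lemma sum_Dl (ga : H -> H -> H) :
  (forall v, linear (fun u => ga u v)) -> (forall u, linear (ga u)) ->
  \sum_(s < n) opmx (ga (e s)) *m Dl s = opmx (fun y => Sw ga y).
Proof.
move=> g1 g2.
transitivity (\sum_(s < n) opmx (fun y => ga (e s) (Sw (fun a b => e^s a *: b) y))).
  by apply: eq_bigr => s _; rewrite -opmx_comp.
rewrite -opmx_sum; apply: eq_opmx => y.
under eq_bigr => s _ do rewrite (Sw_linear _ _ (g2 _)).
rewrite -Sw_sum; apply: eq_Sw => a b.
rewrite -[RHS](coord_exp a (g1 b)); apply: eq_bigr => s _.
by rewrite (linZ _ _ (g2 _)).
Qed.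

Lemma sum_DlZ (phi : H -> K^o) : linear phi ->
  \sum_(s < n) (phi (e s) : K) *: Dl s =
  opmx (fun y => Sw (fun u v => (phi u : K) *: v) y : H).
Proof.
move=> pl; rewrite -(sum_Dl (ga := fun u v => (phi u : K) *: v)); try lin.
by apply: eq_bigr => s _; rewrite opmxZ -scalemxAl opmx_id mul1mx.
Qed.

Lemma sum_DrZ (phi : H -> K^o) : linear phi ->
  \sum_(s < n) (phi (e s) : K) *: Dr s =
  opmx (fun y => Sw (fun u v => (phi v : K) *: u) y : H).
Proof.
move=> pl; under eq_bigr => s _ do rewrite -opmxZ.
rewrite -opmx_sum; apply: eq_opmx => y.
under eq_bigr => s _ do rewrite -Sw_scale.
rewrite -Sw_sum; apply: eq_Sw => a b.
rewrite -(coord_exp b pl) scaler_suml; apply: eq_bigr => s _.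
by rewrite scalerA mulrC.
Qed.

Variables (d : nat) (rho : H -> 'M[K]_d).
Hypothesis rrho : is_rep rho.

(* The cofree Yetter-Drinfeld module H (x) V, with coaction h_1 (x) (h_2 (x) v)
   and action a (h (x) v) = a_1 h S(a_3) (x) a_2 v. *)
Definition cofree_del (s : 'I_n) : 'M[K]_(n * d) := Dl s *t 1%:M.
Definition cofree_rho h : 'M[K]_(n * d) :=
  Sw (fun a x => Sw (fun b c => opmx (fun y : H => a * y * S c) *t rho b) x) h.

Lemma cofree_rep : is_rep cofree_rho.
Proof.
have [rl r1 rM] := rrho; split; first exact: Sw_lin.
  rewrite /cofree_rho Sw1; try lin.
  rewrite Sw1; try lin.
  rewrite r1 -tens1mx -opmx_id; congr (_ *t _); apply: eq_opmx => y.
  by rewrite antipode1 mul1r mulr1.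
move=> g h; rewrite /cofree_rho SwM; try lin.
rewrite (Sw_linear (L := fun M => M *m _)); last by lin.
apply: eq_Sw => a x.
transitivity (Sw (fun p y => Sw (fun b c => Sw (fun q r =>
   opmx (fun z : H => a * p * z * S (c * r)) *t rho (b * q)) y) x) h).
  by apply: eq_Sw => p y; rewrite SwM //; lin.
rewrite (Sw_linear (L := fun M => _ *m M)); last by lin.
apply: eq_Sw => p y.
rewrite (Sw_linear (L := fun M => M *m _)); last by lin.
apply: eq_Sw => b c.
rewrite (Sw_linear (L := fun M => _ *m M)); last by lin.
apply: eq_Sw => q r; rewrite tensmx_mul rM -opmx_comp; last by lin.
by congr (_ *t _); apply: eq_opmx => z; rewrite antipodeM !mulrA.
Qed.

Lemma cofree_corep : is_corep cofree_del.
Proof.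
have tl : linear (fun M : 'M[K]_n => M *t (1%:M : 'M[K]_d)) by lin.
split=> [W F F1 F2 F3|]; last first.
  rewrite /cofree_del -tens1mx -opmx_id.
  transitivity ((\sum_(i < n) (eps (e i) : K^o) *: Dl i) *t (1%:M : 'M[K]_d)).
    rewrite sum_tensl; apply: eq_bigr => i _.
    by rewrite (linZ _ _ tl).
  rewrite sum_DlZ; last by exact: (lin_scalar _ (@lin_id _ H)).
  congr (_ *t _); apply: eq_opmx => y.
  exact: (Sw_counitl y (@lin_id _ H)).
pose phi s t h : K^o := Sw (fun a b => e^s a *: (e^t b : K^o)) h.
have phil s t : linear (phi s t) by exact: Sw_lin.
transitivity (\sum_(s < n) \sum_(t < n) F (e s) (e t)
    ((\sum_(r < n) (phi s t (e r) : K) *: Dl r) *t (1%:M : 'M[K]_d))).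
  transitivity (\sum_(r < n) \sum_(s < n) \sum_(t < n)
      (phi s t (e r) : K) *: F (e s) (e t) (cofree_del r)).
    apply: eq_bigr => r _.
    transitivity (Sw (fun a b => \sum_(s < n) \sum_(t < n)
        (e^s a * e^t b) *: F (e s) (e t) (cofree_del r)) (e r)).
      apply: eq_Sw => a b.
      rewrite -[LHS](coord_exp a (F1 _ _)); apply: eq_bigr => s _.
      rewrite -(coord_exp b (F2 (e s) _)) scaler_sumr; apply: eq_bigr => t _.
      by rewrite scalerA.
    rewrite Sw_sum; apply: eq_bigr => s _; rewrite Sw_sum; apply: eq_bigr => t _.
    by rewrite /phi (Sw_linear (L := fun k : K^o => (k : K) *: _)) //; lin.
  rewrite exchange_big; apply: eq_bigr => s _; rewrite exchange_big.
  apply: eq_bigr => t _; rewrite sum_tensl (lin_sumE _ _ _ (F3 _ _)).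
  by apply: eq_bigr => r _; rewrite (linZ _ _ tl) (linZ _ _ (F3 _ _)).
apply: eq_bigr => s _; apply: eq_bigr => t _; congr (F _ _ _).
rewrite /cofree_del tensmx_mul mulmx1; congr (_ *t _).
rewrite sum_DlZ // /Dl -opmx_comp; last by exact: Sw_lin.
apply: eq_opmx => y; rewrite /= (Sw_linear _ _ (Sw_lin _)).
transitivity (Sw (fun a b => Sw (fun c k => e^s a *: (e^t c *: k)) b) y); last first.
  by apply: eq_Sw => a b; rewrite (linZ _ _ (Sw_lin _)) Sw_scale.
rewrite -Sw_assoc; try lin.
apply: eq_Sw => u v; rewrite /phi (Sw_linear (L := fun k : K^o => (k : K) *: v));
  last by lin.
by apply: eq_Sw => a b; rewrite scalerA.
Qed.

(** On y (x) v both sides are h_1 y_1 S(h_5) (x) h_2 y_2 S(h_4) (x) h_3 v; they are compared at each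
    basis vector of the first factor. *)
Lemma cofree_yd : is_yd cofree_rho cofree_del.
Proof.
have [rl r1 rM] := rrho.
split; [exact: cofree_rep|exact: cofree_corep|move=> W F h F1 F2].
pose Phi t a1 a2 b c1 c2 : 'M[K]_(n * d) :=
  opmx (fun y => Sw (fun u v => e^t (a1 * u * S c2) *: (a2 * v * S c1)) y : H) *t rho b.
transitivity (\sum_(t < n) F (e t) (Sw (fun a1 x => Sw (fun a2 y => Sw (fun b z =>
  Sw (fun c1 c2 => Phi t a1 a2 b c1 c2) z) y) x) h)).
  apply: eq_bigr => t _; congr (F _ _); rewrite /cofree_rho.
  rewrite (Sw_linear (L := fun M => _ *m M)); last by lin.
  transitivity (Sw (fun a x => Sw (fun a1 a2 => Sw (fun b c => Sw (fun c1 c2 =>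
     Phi t a1 a2 b c1 c2) c) x) a) h).
    apply: eq_Sw => a x; rewrite (Sw_linear (L := fun M => _ *m M)); last by lin.
    rewrite SwC; apply: eq_Sw => b c.
    rewrite /cofree_del tensmx_mul mul1mx /Dl -opmx_comp; last by exact: Sw_lin.
    transitivity (Sw (fun a1 a2 => Sw (fun c1 c2 =>
      opmx (fun y => Sw (fun u v => e^t (a1 * u * S c2) *: (a2 * v * S c1)) y : H)) c) a
        *t rho b).
      congr (_ *t _).
      transitivity (opmx (fun y : H => Sw (fun a1 a2 => Sw (fun c1 c2 =>
         Sw (fun u v => e^t (a1 * u * S c2) *: (a2 * v * S c1)) y) c) a)); last first.
        rewrite opmx_Sw; apply: eq_Sw => a1 a2; rewrite opmx_Sw.
        by apply: eq_Sw => c1 c2.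
      apply: eq_opmx => y; rewrite /= SwM; try lin.
      rewrite SwM; try lin.
      apply: eq_Sw => a1 a2.
      rewrite [RHS]SwC; apply: eq_Sw => u v.
      by rewrite Sw_antipode; try lin.
    rewrite (Sw_linear (L := fun M => M *t rho b)); last by lin.
    apply: eq_Sw => a1 a2; rewrite (Sw_linear (L := fun M => M *t rho b)) //.
    by lin.
  by rewrite Sw_assoc //; rewrite /Phi; lin.
transitivity (\sum_(t < n) F (e t) (Sw (fun a x => Sw (fun b c => \sum_(s < n)
    e^t (a * e s * S c) *: (cofree_rho b *m cofree_del s)) x) h)); last first.
  transitivity (\sum_(t < n) Sw (fun a x => Sw (fun b c => \sum_(s < n)
     e^t (a * e s * S c) *: F (e t) (cofree_rho b *m cofree_del s)) x) h).
    apply: eq_bigr => t _; rewrite (Sw_linear _ _ (F2 _)); apply: eq_Sw => a x.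
    rewrite (Sw_linear _ _ (F2 _)); apply: eq_Sw => b c.
    rewrite (lin_sumE _ _ _ (F2 _)); apply: eq_bigr => s _.
    by rewrite (linZ _ _ (F2 _)).
  rewrite -Sw_sum; apply: eq_Sw => a x; rewrite -Sw_sum; apply: eq_Sw => b c.
  rewrite exchange_big; apply: eq_bigr => s _.
  by rewrite (coord_exp _ (F1 _)).
apply: eq_bigr => t _; congr (F _ _); apply: eq_Sw => a x.
transitivity (Sw (fun b c => Sw (fun b1 b' => Sw (fun b2 b3 =>
    Phi t a b1 b2 b3 c) b') b) x).
  rewrite Sw_assoc; try by rewrite /Phi; lin.
  apply: eq_Sw => b1 w; rewrite -Sw_assoc //; rewrite /Phi; lin.
apply: eq_Sw => b c; rewrite /cofree_rho.
transitivity (cofree_rho b *m (\sum_(s < n)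
    e^t (a * e s * S c) *: Dl s *t (1%:M : 'M[K]_d))); last first.
  rewrite mulmx_sumr; apply: eq_bigr => s _; rewrite scalemxAr; congr (_ *m _).
  have tl : linear (fun M : 'M[K]_n => M *t (1%:M : 'M[K]_d)) by lin.
  by rewrite (linZ _ _ tl).
rewrite -sum_tensl (sum_DlZ (phi := fun u => e^t (a * u * S c))); last by lin.
rewrite /cofree_rho (Sw_linear (L := fun M => M *m _)); last by lin.
apply: eq_Sw => b1 b'; rewrite (Sw_linear (L := fun M => M *m _)); last by lin.
apply: eq_Sw => b2 b3; rewrite tensmx_mul mulmx1 -opmx_comp; last by lin.
congr (_ *t _); apply: eq_opmx => y.
rewrite (Sw_linear (L := fun z : H => b1 * z * S b3)); last by lin.
by apply: eq_Sw => u v; rewrite -scalerAr -scalerAl.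
Qed.

(** theta sends h (x) v to h_1 h_4 S(h_3) (x) h_2 v, and h_4 S(h_3) collapses because S^2 = 1. *)
Lemma cofree_theta :
  theta cofree_rho cofree_del = \sum_(t < n) Dr t *t rho (e t).
Proof.
have [rl r1 rM] := rrho.
transitivity (\sum_(t < n) (\sum_(s < n) opmx (fun v : H => Sw (fun a x =>
   Sw (fun b c => e^t b *: (a * v * S c)) x) (e s)) *m Dl s) *t rho (e t)).
  under [RHS]eq_bigr => t _ do rewrite sum_tensl.
  rewrite exchange_big; apply: eq_bigr => s _ /=; rewrite /cofree_rho.
  rewrite (Sw_linear (L := fun M => M *m _)); last by lin.
  transitivity (Sw (fun a x => \sum_(t < n) Sw (fun b c =>
     e^t b *: ((opmx (fun v : H => a * v * S c) *m Dl s) *t rho (e t))) x) (e s)).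
    apply: eq_Sw => a x; rewrite (Sw_linear (L := fun M => M *m _)); last by lin.
    rewrite -Sw_sum; apply: eq_Sw => b c; rewrite /cofree_del tensmx_mul mulmx1.
    have l : linear (fun b => (opmx (fun v : H => a * v * S c) *m Dl s) *t rho b).
      by lin.
    by rewrite -[LHS](coord_exp b l).
  rewrite Sw_sum; apply: eq_bigr => t _.
  rewrite opmx_Sw.
  rewrite (Sw_linear (L := fun M => M *m Dl s *t rho (e t))); last by lin.
  apply: eq_Sw => a x; rewrite opmx_Sw.
  rewrite (Sw_linear (L := fun M => M *m Dl s *t rho (e t))); last by lin.
  apply: eq_Sw => b c; rewrite opmxZ -scalemxAl.
  have l : linear (fun M : 'M[K]_n => M *t rho (e t)) by lin.
  by rewrite (linZ _ _ l).
apply: eq_bigr => t _; congr (_ *t _).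
rewrite (sum_Dl (ga := fun u v => Sw (fun a x =>
   Sw (fun b c => e^t b *: (a * v * S c)) x) u)); try lin.
apply: eq_opmx => y; rewrite Sw_assoc; try lin.
apply: eq_Sw => a z; rewrite Sw_assoc; try lin.
transitivity (Sw (fun b w => eps w *: (e^t b *: a)) z); last first.
  by rewrite (Sw_counitr (f := fun b => e^t b *: a)) //; lin.
apply: eq_Sw => b w.
rewrite -[a in RHS]mulr1 -(Sw_antir' SS (f := fun x => e^t b *: (a * x))); last by lin.
by apply: eq_Sw => c v; rewrite mulrA.
Qed.

Let T : 'M[K]_(n * d) := \sum_(t < n) Dr t *t rho (e t).

Lemma cofree_theta_exp k : mxexp T k = \sum_(t < n) Dr t *t rho (psi k (e t)).
Proof.
have [rl r1 rM] := rrho.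
elim: k => [|k IH].
  transitivity ((\sum_(t < n) (eps (e t) : K^o) *: Dr t) *t (1%:M : 'M[K]_d)).
    rewrite sum_DrZ; last by exact: (lin_scalar _ (@lin_id _ H)).
    rewrite /= -tens1mx -opmx_id; congr (_ *t _); apply: eq_opmx => y.
    by rewrite (Sw_counitr y (@lin_id _ H)).
  rewrite sum_tensl; apply: eq_bigr => t _; rewrite /= (linZ _ _ rl) r1.
  have tl : linear (fun M : 'M[K]_n => M *t (1%:M : 'M[K]_d)) by lin.
  have tr : linear (fun M : 'M[K]_d => Dr t *t M) by lin.
  by rewrite (linZ _ _ tl) (linZ _ _ tr).
have pl := sweedler_pow_lin k.
pose phi s t h : K^o := Sw (fun a b => e^s a *: (e^t b : K^o)) h.
have phil s t : linear (phi s t) by exact: Sw_lin.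
rewrite -[mxexp T k.+1]/(T *m mxexp T k) IH.
transitivity (\sum_(s < n) \sum_(t < n)
    (\sum_(r < n) (phi s t (e r) : K) *: Dr r) *t rho (e s * psi k (e t))).
  rewrite mulmx_suml; apply: eq_bigr => s _; rewrite mulmx_sumr.
  apply: eq_bigr => t _; rewrite tensmx_mul rM; congr (_ *t _).
  rewrite sum_DrZ // /Dr -opmx_comp; last by exact: Sw_lin.
  apply: eq_opmx => y; rewrite /= (Sw_linear _ _ (Sw_lin _)).
  transitivity (Sw (fun x b => Sw (fun c k => e^s k *: (e^t b *: c)) x) y).
    apply: eq_Sw => x b; rewrite (linZ _ _ (Sw_lin _)) -Sw_scale.
    by apply: eq_Sw => c c'; rewrite !scalerA mulrC.
  rewrite Sw_assoc; try lin.
  apply: eq_Sw => c z; rewrite /phi (Sw_linear (L := fun k : K^o => (k : K) *: c));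
    last by lin.
  by apply: eq_Sw => a b; rewrite scalerA.
transitivity (\sum_(r < n) \sum_(s < n) \sum_(t < n)
    (phi s t (e r) : K) *: (Dr r *t rho (e s * psi k (e t)))).
  rewrite [RHS]exchange_big; apply: eq_bigr => s _; rewrite [RHS]exchange_big.
  apply: eq_bigr => t _; rewrite sum_tensl; apply: eq_bigr => r _.
  have tl : linear (fun M : 'M[K]_n => M *t rho (e s * psi k (e t))) by lin.
  by rewrite (linZ _ _ tl).
apply: eq_bigr => r _; rewrite sweedler_powS.
rewrite (Sw_linear (L := fun x => Dr r *t rho x)); last by lin.
transitivity (Sw (fun a b => \sum_(s < n) \sum_(t < n)
    (e^s a * e^t b) *: (Dr r *t rho (e s * psi k (e t)))) (e r)).
  rewrite Sw_sum; apply: eq_bigr => s _; rewrite Sw_sum; apply: eq_bigr => t _.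
  by rewrite /phi (Sw_linear (L := fun k : K^o => (k : K) *: _)) //; lin.
apply: eq_Sw => a b.
have l1 : linear (fun a => Dr r *t rho (a * psi k b)) by lin.
rewrite -[RHS](coord_exp a l1); apply: eq_bigr => s _.
have l2 : linear (fun b => Dr r *t rho (e s * psi k b)) by lin.
rewrite -(coord_exp b l2) scaler_sumr; apply: eq_bigr => t _.
by rewrite scalerA.
Qed.

Lemma mxtrace_tens p q (A : 'M[K]_p) (B : 'M[K]_q) : \tr (A *t B) = \tr A * \tr B.
Proof.
rewrite [RHS]mulr_sum; apply: eq_bigr => i _.
by case: (mxtens_indexP i) => a b; rewrite tensmxE mxtens_indexK.
Qed.

(** T^k sends h (x) v to h_1 (x) (h_2)^{[k]} v, so its trace is that of h -> p(h_2) h_1;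
    [optr_dual_int] evaluates it as tr(S^2) p(L), with tr(S^2) = dim H. *)
Lemma cofree_trace (L : H) k : normalized_integral L ->
  \tr (mxexp T k) = n%:R * \tr (rho (psi k L)).
Proof.
have [rl r1 rM] := rrho; move=> HL; have pl := sweedler_pow_lin k.
pose p h : K^o := \tr (rho (psi k h)).
have trl : linear (fun M : 'M[K]_d => \tr M : K^o).
  by move=> c x y; rewrite linearD linearZ.
have p_lin : linear p.
  by apply: (lin_comp (f := fun M : 'M[K]_d => \tr M : K^o)) => //; lin.
have := optr_dual_int HL p_lin.
have -> : optr (fun y : H => S (S y)) = n%:R.
  by rewrite (eq_optr (g := id)) ?optr_id // => y; rewrite SS.
rewrite -/(p L) => <-; rewrite cofree_theta_exp linear_sum.
transitivity (\tr (\sum_(t < n) (p (e t) : K) *: Dr t)).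
  rewrite linear_sum; apply: eq_bigr => t _.
  by rewrite /= mxtrace_tens linearZ /= mulrC.
rewrite sum_DrZ //; apply: (@eq_optr K H) => y.
by apply: eq_Sw => a b; rewrite SS.
Qed.

Lemma cofree_fixed : exists (B : 'M[K]_(n * d, 1 * d)) (B' : 'M[K]_(1 * d, n * d)),
  T *m B = B /\ B' *m B = 1%:M.
Proof.
have [rl r1 rM] := rrho.
pose c : 'M[K]_(n, 1) := \col_i e^i 1.
have [i ei] : exists i, e^i (1 : H) != 0.
  apply/existsP; apply: contraT => /existsPn e0; have := oner_neq0 H.
  rewrite (coord_vbasis (memvf (1 : H))) big1 ?eqxx // => i _.
  by have /negbNE/eqP-> := e0 i; rewrite scale0r.
(* [B] embeds v as 1 (x) v; [B'] reads a coordinate of H at which the unit is nonzero. *)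
exists (c *t 1%:M), (((e^i (1 : H))^-1 *: delta_mx 0 i) *t 1%:M); split.
  transitivity (c *t rho 1); last by rewrite r1.
  have l : linear (fun x => c *t rho x) by lin.
  rewrite -(coord_exp (1 : H) l) /T mulmx_suml; apply: eq_bigr => t _.
  rewrite tensmx_mul mulmx1.
  have -> : Dr t *m c = e^t 1 *: c.
    apply/matrixP => k j; rewrite !mxE.
    transitivity (e^k (Sw (fun a b => e^t b *: a) (1 : H) : H)).
      have gl : linear (fun y : H => e^k (Sw (fun a b => e^t b *: a) y : H) : K^o) by lin.
      rewrite -[RHS](coord_exp (1 : H) gl); apply: eq_bigr => s _.
      by rewrite !mxE mulrC.
    by rewrite Sw1 ?linearZ //; lin.
  have tl : linear (fun M : 'M[K]_(n, 1) => M *t rho (e t)) by lin.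
  by rewrite (linZ _ _ tl).
rewrite tensmx_mul mulmx1 -(tens1mx _ 1 d); congr (_ *t _).
rewrite -scalemxAl -rowE; apply/matrixP => a b; rewrite !ord1 !mxE.
by rewrite mulVf.
Qed.

End Cofree.

(** * Power sums *)

Section PowerSums.
Variable C : numClosedFieldType.

Lemma trig_eigen_diag n (P U : 'M[C]_n) (v : 'cV[C]_n) mu :
  P \in unitmx -> is_trig_mx U -> v != 0 ->
  (invmx P *m U *m P) *m v = mu *: v -> exists i, mu = U i i.
Proof.
move=> Pu tU v0 Uv; pose w := P *m v.
have w0 : w != 0.
  by apply: contra_neq v0 => w0; rewrite -(mulKmx Pu v) -/w w0 mulmx0.
have Uw : U *m w = mu *: w.
  by rewrite /w scalemxAr -Uv !mulmxA mulmxV // mul1mx.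
suff /existsP[i /eqP muE] : [exists i, mu == U i i] by exists i.
apply: contraT => /existsPn muU.
have tD : is_trig_mx (U - mu%:M).
  apply/is_trig_mxP => i j ij; rewrite !mxE -val_eqE ltn_eqF // subr0.
  by have /is_trig_mxP-> := tU.
have uD : U - mu%:M \in unitmx.
  rewrite unitmxE det_trig // unitfE; apply/prodf_neq0 => i _.
  by rewrite !mxE eqxx mulr1n subr_eq0 eq_sym.
by case/eqP: w0; rewrite -(mulKmx uD w) mulmxBl Uw mul_scalar_mx subrr mulmx0.
Qed.

Lemma trace_exp n (P U : 'M[C]_n) k : P \in unitmx -> is_trig_mx U ->
  \tr (mxexp (invmx P *m U *m P) k) = \sum_i U i i ^+ k.
Proof.
move=> Pu tU; rewrite mxexp_conj // mxtrace_mulC mulmxA mulmxV // mul1mx.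
by apply: eq_bigr => i _; have [_ ->] := trig_exp k tU.
Qed.

Lemma sum_root_unity_ge0 (x : C) N :
  x = 0 \/ x ^+ N = 1 -> 0 <= \sum_(1 <= k < N.+1) x ^+ k.
Proof.
rewrite big_add1 /=; case=> [->|xN].
  by rewrite big1 // => k _; rewrite expr0n.
have [->|x1] := eqVneq x 1.
  by apply: sumr_ge0 => k _; rewrite expr1n ler01.
suff -> : \sum_(0 <= k < N) x ^+ k.+1 = 0 by [].
apply: (mulfI (_ : x - 1 != 0)); first by rewrite subr_eq0.
under eq_bigr => k _ do rewrite exprS.
by rewrite -mulr_sumr mulr0 mulrCA big_mkord -subrX1 xN subrr mulr0.
Qed.

(* Splitting off the fixed vectors im B through the projection Q = 1 - B B',
   the remaining eigenvalues are 0 or N-th roots of unity, whose first N power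
   sums add up to N or 0. *)
Lemma trace_power_sum m f (T : 'M[C]_m) (B : 'M[C]_(m, f)) B' N :
  (0 < N)%N -> T *m B = B -> B' *m B = 1%:M ->
  (forall (v : 'cV[C]_m) mu, v != 0 -> T *m v = mu *: v -> `|mu| = 1) ->
  \tr (mxexp T N) = m%:R ->
  (N * f)%:R <= \sum_(1 <= k < N.+1) \tr (mxexp T k).
Proof.
move=> N0 TB BB Tnorm trN; pose Q := 1%:M - B *m B'.
have QB : Q *m B = 0 by rewrite mulmxBl mul1mx -mulmxA BB mulmx1 subrr.
have QQ : Q *m Q = Q by rewrite {2}/Q mulmxBr mulmx1 mulmxA QB mul0mx subr0.
have QTQ : Q *m T *m Q = Q *m T.
  by rewrite {2}/Q mulmxBr mulmx1 mulmxA -(mulmxA Q) TB QB mul0mx subr0.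
have TkB k : mxexp T k *m B = B.
  by elim: k => [|k IH]; rewrite ?mul1mx // mxexpSr -mulmxA TB.
have QTk k : mxexp (Q *m T) k.+1 = Q *m mxexp T k.+1.
  elim: k => [|k IH]; first by rewrite /= !mulmx1.
  rewrite -[LHS]/(Q *m T *m mxexp (Q *m T) k.+1) IH mulmxA QTQ.
  by rewrite -mulmxA.
have trk k : \tr (mxexp T k.+1) = f%:R + \tr (mxexp (Q *m T) k.+1).
  rewrite QTk; move: (mxexp T k.+1) (TkB k.+1) => M MB.
  rewrite /Q mulmxBl mul1mx linearB /= -(mulmxA B) (mxtrace_mulC B) -mulmxA MB BB.
  by rewrite mxtrace1 addrC subrK.
have rootN (v : 'cV[C]_m) mu : v != 0 -> T *m v = mu *: v -> mu ^+ N = 1.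
  have [P [U [Pu tU TE]]] := trigonalizable T.
  (* m numbers of modulus 1 have sum m, so by equality in the triangle inequality each of them is
     1. *)
  have Ui i : U i i ^+ N = 1.
    apply: (normC_sum_upper (P := xpredT) (F := fun i => U i i ^+ N) (G := fun=> 1)) => //.
      move=> j _; have [w w0 Tw] := trig_eigenvalue j Pu tU.
      by rewrite normrX (Tnorm w) ?TE // expr1n.
    by rewrite -(trace_exp N Pu tU) -TE trN sumr_const card_ord.
  move=> v0; rewrite TE => /(trig_eigen_diag Pu tU v0)[i ->]; exact: Ui.
have [P [U [Pu tU QTE]]] := trigonalizable (Q *m T).
have Ui i : U i i = 0 \/ U i i ^+ N = 1.
  have [v v0] := trig_eigenvalue i Pu tU; rewrite -QTE; move: (U i i) => mu Qv.
  have [->|mu0] := eqVneq mu 0; [by left|right].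
  have Qvv : Q *m v = v.
    have QQT : Q *m (Q *m T *m v) = Q *m T *m v by rewrite 2!mulmxA QQ.
    by apply: (scalerI mu0); rewrite Qv -scalemxAr in QQT.
  have [->|mu1] := eqVneq mu 1; first by rewrite expr1n.
  (* The image of [Q] need not be stable under T: T v = mu v + B w. As T fixes the image of [B],
     adding B w / (mu - 1) to v gives an eigenvector of T itself. *)
  pose w := B' *m T *m v.
  have Tv : T *m v = mu *: v + B *m w.
    by rewrite -Qv -mulmxA {1}/Q mulmxBl mul1mx -mulmxA /w -[B' *m T *m v]mulmxA subrK.
  pose v' := v + (mu - 1)^-1 *: (B *m w).
  apply: (rootN v').
    apply: contra_neq v0 => v'0; rewrite -Qvv.
    have : Q *m v' = 0 by rewrite v'0 mulmx0.
    by rewrite /v' mulmxDr -scalemxAr mulmxA QB mul0mx scaler0 addr0.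
  rewrite /v' mulmxDr -scalemxAr mulmxA TB Tv scalerDr -addrA; congr (_ + _).
  rewrite scalerA -{1}[B *m w]scale1r -scalerDl; congr (_ *: _).
  by field; rewrite subr_eq0.
rewrite big_add1 /=; under eq_bigr => k _ do rewrite trk QTE (trace_exp _ Pu tU).
rewrite big_split /= sumr_const_nat subn0 -mulrnA (mulnC f) lerDl.
rewrite exchange_big sumr_ge0 // => i _.
by have := sum_root_unity_ge0 (Ui i); rewrite big_add1.
Qed.

End PowerSums.

(** * Complex numbers, modules and the final estimate *)

Lemma complex_archimedean (R : realType) (x : R[i]) :
  0 <= x -> exists m : nat, x <= m%:R.
Proof.
rewrite lecE => /= /andP[/eqP x0 rx]; exists (Num.bound (complex.Re x)).
rewrite -(rmorph_nat (real_complex R)) lecE /= x0 eqxx /=.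
exact/ltW/archi_boundP.
Qed.

Lemma hact_rep (K : fieldType) (H : hopfAlgebra K) (V : hmodule H) :
  is_rep (fun h => opmx (hact V h)).
Proof.
split=> [||g h]; first by apply: opmx_lin => v k x y; rewrite linearP add_lfunE scale_lfunE.
  by rewrite -opmx_id; apply: eq_opmx => v; rewrite hact1 id_lfunE.
rewrite hactM -opmx_comp; last exact: linearP.
by apply: eq_opmx => v; rewrite comp_lfunE.
Qed.

(** [passmx.mxof] acts on rows and [opmx] on columns; the trace does not see the transpose. *)
Lemma hcharE (K : fieldType) (H : hopfAlgebra K) (V : hmodule H) h :
  hchar V h = \tr (opmx (hact V h)).
Proof.
rewrite /hchar -[RHS]mxtrace_tr; congr (\tr _); apply/matrixP => i j.
by rewrite /passmx.mxof /opmx !mxE /= passmx.vecof_delta.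
Qed.

Theorem theoremB (R : realType) (H : hopfAlgebra R[i]) (L : H) (N : nat)
    (Hss : semisimple H) (HL : normalized_integral L) (HN : is_FSexp L N) :
  (forall V : hmodule H,
     (N%:R * (\dim {:V})%:R) / (\dim {:H})%:R <= total_fs_indicator L N V) /\
  (forall V : hmodule H,
     {:V}%VS != 0%VS -> 0 < total_fs_indicator L N V).
Proof.
have SS := antipode_involutive Hss HL.
have [N0 trivN _] := HN.
have n0 : 0 < (\dim {:H})%:R :> R[i].
  rewrite ltr0n lt0n dimv_eq0; apply/eqP => H0.
  have := memvf (1 : H); rewrite H0 memv0 => /eqP/eqP; apply/negP.
  exact: oner_neq0.
have main (V : hmodule H) :
    (N%:R * (\dim {:V})%:R) / (\dim {:H})%:R <= total_fs_indicator L N V.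
  have rV := hact_rep V; set rho := fun h => _ in rV.
  have trT k : \tr (mxexp (theta (cofree_rho rho) (cofree_del _)) k) =
      (\dim {:H})%:R * fs_indicator L k V.
    rewrite cofree_theta // (cofree_trace SS rV k HL) //.
    by rewrite /fs_indicator hcharE.
  have [B [B' [TB BB]]] := cofree_fixed rV.
  rewrite -(cofree_theta SS rV) in TB.
  rewrite ler_pdivrMr // -natrM mulrC /total_fs_indicator mulr_sumr.
  under eq_bigr => k _ do rewrite -trT.
  have := trace_power_sum N0 TB BB; rewrite mul1n; apply.
    move=> v mu; apply: (norm_theta_eigenvalue SS (@complex_archimedean R)).
    exact: cofree_yd.
  (* The N-th indicator is dim V, so the N-th power of theta has trace dim H dim V, the size of the
     matrix. *)
  by rewrite trT trivN natrM.
split=> // V V0; apply: lt_le_trans (main V).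
by rewrite divr_gt0 // mulr_gt0 // ltr0n // lt0n dimv_eq0.
Qed.
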